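(* Let $[x_k]=\{x_k\}_{k=0}^{N}$ be a zero-mean nonsingular Gaussian (ZMNG) sequence of $\mathbb{R}^d$-valued random vectors. Then $[x_k]$ is reciprocal if and only if there exist $d\times d$ matrices $M_{k,k-1}$, $k\in\{1,\dots,N\}$, and positive definite $d\times d$ matrices $M_k$, $k\in\{1,\dots,N\}$, such that $[x_k]$ is governed by $$x_k=G_{k,k-1}x_{k-1}+G_{k,N}x_N+e_k,\qquad k\in\{1,\dots,N-1\},$$ where $[e_k]=\{e_k\}_{k=0}^N$ is a zero-mean white Gaussian sequence with nonsingular covariances $G_k=\mathrm{Cov}(e_k)$, along with the boundary condition $$x_0=e_0,\qquad x_N=G_{N,0}x_0+e_N$$ for some matrix $G_{N,0}$, or the boundary condition $$x_N=e_N,\qquad x_0=G_{0,N}x_N+e_0$$ for some matrix $G_{0,N}$, and where, for every $k\in\{1,\dots,N-1\}$, the parameters $(G_{k,k-1},G_{k,N},G_k)$ are given by $$G_{k,k-1}=M_{k,k-1}-G_{k,N}M_{N|k-1},$$ $$G_{k,N}=G_kM_{N|k}'C_{N|k}^{-1},$$ $$G_k=\left(M_k^{-1}+M_{N|k}'C_{N|k}^{-1}M_{N|k}\right)^{-1},$$ with $$M_{N|k}=M_{N,N-1}M_{N-1,N-2}\cdots M_{k+1,k}\quad (k\in\{0,\dots,N-1\}),\qquad M_{N|N}=I,$$ $$C_{N|k}=\sum_{n=k}^{N-1}M_{N|n+1}M_{n+1}M_{N|n+1}',\qquad k\in\{1,\dots,N-1\}.$$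
   Context: Sequences are indexed by the discrete interval $[0,N]=\{0,1,\dots,N\}$, and each $x_k$ takes values in $\mathbb{R}^d$. A prime denotes matrix transpose. ''ZMNG'' means zero-mean nonsingular Gaussian: the variables $x_0,\dots,x_N$ are jointly Gaussian with mean zero and the covariance matrix of the whole stacked vector $(x_0,\dots,x_N)$ is nonsingular. ''White'' means that the vectors $e_k$ with different indices are mutually uncorrelated (hence independent, being jointly Gaussian). $F(\cdot|\cdot)$ denotes the conditional cumulative distribution function. $[x_k]$ is reciprocal iff for any two times $k_1<k_2$ in $[0,N]$ the subsequences inside and outside the interval $[k_1,k_2]$ are independent conditioned on $x_{k_1}$ and $x_{k_2}$; equivalently, iff $F(\xi_k\,|\,x_0,\dots,x_j,x_l,\dots,x_N)=F(\xi_k\,|\,x_j,x_l)$ for all $j,k,l\in[0,N]$ with $j<k<l$ and every $\xi_k\in\mathbb{R}^d$, where the left and right sides are the conditional CDFs of $x_k$ evaluated at $\xi_k$. The two boundary conditions are equivalent alternatives; the symbols $e_0,e_N$ (and their covariances $G_0,G_N$) need not denote the same objects in the two alternatives. No constraint is imposed on the boundary parameters ($G_{N,0}$ or $G_{0,N}$, and $G_0,G_N$) beyond nonsingularity of $G_0$ and $G_N$. *)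

(* Defs.v *)
From HB Require Import structures.
From mathcomp Require Import all_boot all_order all_algebra.
From mathcomp Require Import all_classical all_reals all_analysis.

Set Implicit Arguments.
Unset Strict Implicit.
Unset Printing Implicit Defensive.

Import Order.TTheory GRing.Theory Num.Theory.
Import numFieldNormedType.Exports.

Local Open Scope classical_set_scope.
Local Open Scope ring_scope.

(* Random vectors are functions T -> 'cV[R]_n with measurable coordinates.    *)
(* Sequences [x_k], k = 0, ..., N, and families of matrices are indexed by    *)
(* nat; their values outside the stated range of indices are never used.      *)

Section RandomVectors.
Context {disp : measure_display} {T : measurableType disp} {R : realType}.
Variable P : probability T R.

(* The degenerate case is separate because [normal_prob m 0] is, by           *)
(* convention, a uniform distribution and not the point mass at m.            *)
Definition gaussian_variable (Y : T -> R) : Prop :=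
  measurable_fun [set: T] Y /\
  ((exists m : R, forall A : set R, measurable A ->
      pushforward P Y A = (\d_m : set R -> \bar R) A) \/
   (exists m s : R, 0 < s /\ forall A : set R, measurable A ->
      pushforward P Y A = normal_prob m s A)).

(* Jointly Gaussian coordinates: every linear combination is Gaussian. *)
Definition gaussian_vector (n : nat) (X : T -> 'cV[R]_n) : Prop :=
  (forall i, measurable_fun [set: T] (fun w => X w i ord0)) /\
  (forall c : 'rV[R]_n, gaussian_variable (fun w => (c *m X w) ord0 ord0)).

Definition zero_mean (n : nat) (X : T -> 'cV[R]_n) : Prop :=
  forall i, expectation P (fun w => X w i ord0) = 0%E.

(* [covariance] is \bar R-valued; it is finite for Gaussian vectors. *)
Definition covmx (m n : nat) (X : T -> 'cV[R]_m) (Y : T -> 'cV[R]_n) :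
    'M[R]_(m, n) :=
  \matrix_(i, j)
    fine (covariance P (fun w => X w i ord0) (fun w => Y w j ord0)).

Definition stack (d N : nat) (x : nat -> T -> 'cV[R]_d) (w : T) :
    'cV[R]_(\sum_(k < N.+1) d) :=
  \mxcol_(k < N.+1) x k w.

Definition ZMNG (d N : nat) (x : nat -> T -> 'cV[R]_d) : Prop :=
  [/\ gaussian_vector (stack N x), zero_mean (stack N x)
    & covmx (stack N x) (stack N x) \in unitmx].

Definition white_gaussian (d N : nat) (e : nat -> T -> 'cV[R]_d) : Prop :=
  [/\ gaussian_vector (stack N e), zero_mean (stack N e)
    & forall j k : nat, (j <= N)%N -> (k <= N)%N -> j != k ->
        covmx (e j) (e k) = 0].

(* The real function p is a version of the conditional probability of the     *)
(* event A given the sub-sigma-algebra F.                                     *)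
Definition cond_prob_version (F : set (set T)) (A : set T) (p : T -> R) : Prop :=
  [/\ forall B : set R, measurable B -> F (p @^-1` B),
      P.-integrable [set: T] (EFin \o p)
    & forall B : set T, F B -> (\int[P]_(w in B) (p w)%:E)%E = P (A `&` B)].

(* P(A /\ B | F) = P(A | F) P(B | F) almost surely for A in G and B in H.     *)
(* Versions of conditional probabilities exist and are almost surely unique,  *)
(* so it does not matter which ones are taken.                                *)
Definition cond_independent (F G H : set (set T)) : Prop :=
  forall A B : set T, G A -> H B ->
    exists pA pB : T -> R,
      [/\ cond_prob_version F A pA, cond_prob_version F B pB
        & cond_prob_version F (A `&` B) (fun w => pA w * pB w)].

(* The sigma-algebra generated by the vectors x_k, k in S. *)
Definition sigma_of (d : nat) (x : nat -> T -> 'cV[R]_d) (S : set nat) :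
    set (set T) :=
  <<s \bigcup_(k in S) \bigcup_(i in [set: 'I_d])
        preimage_set_system [set: T] (fun w => x k w i ord0) measurable >>.

Definition reciprocal (d N : nat) (x : nat -> T -> 'cV[R]_d) : Prop :=
  forall k1 k2 : nat, (k1 < k2)%N -> (k2 <= N)%N ->
    cond_independent (sigma_of x [set k1; k2])
      (sigma_of x [set k | (k1 < k < k2)%N])
      (sigma_of x [set k | (k < k1)%N \/ (k2 < k <= N)%N]).

(* Gp k, GN k and G k are G_{k,k-1}, G_{k,N} and G_k. The matrices G 0 and    *)
(* G N may depend on which boundary condition is used.                        *)
Definition governed_by (d N : nat) (x : nat -> T -> 'cV[R]_d)
    (Gp GN G : nat -> 'M[R]_d) : Prop :=
  exists e : nat -> T -> 'cV[R]_d,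
    [/\ white_gaussian N e,
        forall k : nat, (k <= N)%N -> covmx (e k) (e k) = G k /\ G k \in unitmx,
        forall k : nat, (0 < k < N)%N ->
          {ae P, forall w, x k w = Gp k *m x k.-1 w + GN k *m x N w + e k w}
      & (exists GN0 : 'M[R]_d,
           {ae P, forall w, x 0%N w = e 0%N w} /\
           {ae P, forall w, x N w = GN0 *m x 0%N w + e N w}) \/
        (exists G0N : 'M[R]_d,
           {ae P, forall w, x N w = e N w} /\
           {ae P, forall w, x 0%N w = G0N *m x N w + e 0%N w})].

End RandomVectors.

Section MarkovParameters.
Context {R : realType}.
Variables d N : nat.

Definition posdefmx (A : 'M[R]_d) : Prop :=
  A^T = A /\ forall v : 'cV[R]_d, v != 0 -> 0 < (v^T *m A *m v) ord0 ord0.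

(* Mt k is M_{k,k-1} and M k is M_k. *)
Variables Mt M : nat -> 'M[R]_d.

(* M_{N|k} = M_{N,N-1} M_{N-1,N-2} ... M_{k+1,k}, and M_{N|N} = I. *)
Definition MNcond (k : nat) : 'M[R]_d :=
  \prod_(0 <= i < N - k) Mt (N - i).

(* C_{N|k} *)
Definition CNcond (k : nat) : 'M[R]_d :=
  \sum_(k <= n < N) MNcond n.+1 *m M n.+1 *m (MNcond n.+1)^T.

End MarkovParameters.

(* Main.v *)
Require Import Defs.
From HB Require Import structures.
From mathcomp Require Import all_boot all_order all_algebra.
From mathcomp Require Import all_classical all_reals all_analysis.
From mathcomp Require Import measurable_realfun ring lra zify.

(* Uncorrelated linear images of a Gaussian vector are independent. This rests on *)
(* the characteristic function of a centered Gaussian law being multiplicative in *)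
(* the variance, and on bounded functions of a vector being approximable by       *)
(* trigonometric polynomials. Hence two groups of coordinates of a nonsingular    *)
(* Gaussian vector are independent conditionally on the remaining coordinates if  *)
(* and only if the corresponding block of the precision matrix (the inverse of    *)
(* the covariance) vanishes, and a sequence is reciprocal if and only if its      *)
(* precision matrix is cyclic block tridiagonal.                                  *)
(*   Eliminating the blocks N, N - 1, ..., 1 from such a matrix yields the M_k    *)
(* and M_{k,k-1}, and the rows of the precision matrix are then                   *)
(* G_k^-1 e_k - G_{k+1,k}' G_{k+1}^-1 e_{k+1} in terms of the residuals e_k.      *)
(* Conversely, the parameter formulas entail the identity                         *)
(* G_k^-1 G_{k,N} = G_{k+1,k}' G_{k+1}^-1 G_{k+1,N}, which is precisely what      *)
(* cancels the block (k, N), 0 < k < N - 1, of the precision matrix of a model.   *)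

Set Implicit Arguments.
Unset Strict Implicit.
Unset Printing Implicit Defensive.

Import Order.TTheory GRing.Theory Num.Theory.
Import numFieldNormedType.Exports.

Local Open Scope classical_set_scope.
Local Open Scope ring_scope.

(** * The characteristic function of a centered Gaussian law *)

(** Write K for the covariance of the stacked vector, A for its inverse and E_k for the selector of
    block k. [reciprocal_tridiagonal] reduces reciprocity to the zero pattern of A. Conditional
    independence of inner and outer coordinates given the two ends means that the residual of the
    inner coordinates, regressed on the ends, is uncorrelated with the outer ones
    ([cond_independent_of_residual], [residual_of_cond_independent]); this in turn is the vanishing
    of the inner-outer block of A ([residual_of_precision_zero], [precision_zero_of_residual]). The
    intervals [k-1, k+1] already confine the row k of A, 0 < k < N, to the columns k-1, k, k+1, and
    this pattern is enough for all other intervals.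

    The probabilistic input is the passage from uncorrelated to independent. It combines a
    factorization of cosine moments ([cos_lin_uncorrelated], based on [chi_add]) with a uniqueness
    theorem for Fourier transforms ([fourier_null_sigma]).

    The algebraic input is one relation. With r_k = G_k^-1 e_k, seen as a row acting on the stacked
    vector, E_k A = r_k - G_{k+1,k}' r_{k+1} for 0 < k < N-1, and E_{N-1} A = r_{N-1}.
    [tridiagonal_of_model] derives it from whiteness and reads off the columns that occur.
    [model_of_tridiagonal] obtains the parameters by block elimination, proves the same relation
    from the parameter formulas, and recovers orthogonality of the residuals by downward induction.
    The two end residuals are then supplied by a Gram-Schmidt step in [white_rows_of_model]. *)

Section NormalLaw.
Context {R : realType}.
Implicit Types (m s t : R) (f : R -> R).
Local Notation mu := (@lebesgue_measure R).
Local Notation gauss := (normal_prob 0 1 : set R -> \bar R).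

(** The Radon-Nikodym derivative of the normal law agrees almost everywhere with its density,
    because both have the same integral over every measurable set. *)
Lemma ge0_integral_normal_prob m s f : measurable_fun setT f ->
  (forall x, 0 <= f x) ->
  (\int[normal_prob m s]_x (f x)%:E =
   \int[mu]_x (f x * normal_pdf m s x)%:E)%E.
Proof.
move=> mf f0.
have mEf : measurable_fun setT (EFin \o f) by exact/measurable_EFinP.
rewrite -(Radon_Nikodym_SigmaFinite.change_of_variables (normal_prob_dominates m s))//=.
have mpdf : measurable_fun setT (fun x => (normal_pdf m s x)%:E).
  by apply/measurable_EFinP; apply: measurable_normal_pdf.
have iRN := Radon_Nikodym_SigmaFinite.f_integrable (normal_prob_dominates m s).
under [in RHS]eq_integral do rewrite EFinM.
apply: ae_eq_integral => //.
- apply: emeasurable_funM; first exact: mEf.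
  exact: measurable_int iRN.
- by apply: emeasurable_funM; [exact: mEf|exact: mpdf].
- apply: ae_eqe_mul2l; apply: integral_ae_eq => //.
  by move=> E _ mE; rewrite -Radon_Nikodym_SigmaFinite.f_integral//;
    exact: normal_prob_dominates.
Qed.

Let affine' m s : (fun z : R => m + s * z)^`()%classic = cst s.
Proof.
apply/funext => z; rewrite derive1E deriveD// deriveM//.
by rewrite !derive_cst derive_id scaler0 add0r addr0 [RHS]/= scaler1.
Qed.

Lemma continuous_integral_normal_prob m s f : 0 < s -> continuous f ->
  (forall x, 0 <= f x) ->
  (\int[normal_prob m s]_x (f x)%:E =
   \int[normal_prob 0 1]_z (f (m + s * z))%:E)%E.
Proof.
move=> s0 cf f0.
have caff : continuous (fun z : R => m + s * z).
  by move=> z; apply: cvgD; [exact: cvg_cst | apply: cvgM; [exact: cvg_cst | exact: cvg_id]].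
have sn0 : s != 0 by rewrite gt_eqF.
rewrite (ge0_integral_normal_prob m s)//; last exact: continuous_measurable_fun.
have mfaff : measurable_fun setT (fun z => f (m + s * z)).
  by apply: continuous_measurable_fun => z; apply: continuous_comp; [exact: caff|exact: cf].
rewrite (ge0_integral_normal_prob 0 1 mfaff (fun z => f0 _)).
rewrite (@increasing_ge0_integration_by_substitutionT R (fun z : R => m + s * z))//.
- apply: eq_integral => z _; rewrite affine' /=; congr EFin.
  rewrite -mulrA; congr (_ * _).
  rewrite !normal_pdfE ?oner_eq0// /normal_peak /normal_fun.
  transitivity ((Num.sqrt (s ^+ 2 * pi *+ 2))^-1 *
      expR (- (m + s * z - m) ^+ 2 / (s ^+ 2 *+ 2)) * s); first by [].
  have -> : (Num.sqrt (s ^+ 2 * pi *+ 2))^-1 *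
      expR (- (m + s * z - m) ^+ 2 / (s ^+ 2 *+ 2)) =
      (s * Num.sqrt (pi *+ 2))^-1 * expR (- z ^+ 2 / 2).
    congr (_^-1 * expR _).
      by rewrite -mulrnAr sqrtrM ?sqr_ge0// sqrtr_sqr gtr0_norm.
    have -> : m + s * z - m = s * z by ring.
    by rewrite exprMn; field.
  rewrite subr0 expr1n mul1r /cst; field.
  by rewrite sn0 gt_eqF// sqrtr_gt0 pmulrn_lgt0// pi_gt0.
- by move=> x y xy; rewrite ltrD2l ltr_pM2l.
- by rewrite affine' => ?; exact: cvg_cst.
- by rewrite affine'; exact: is_cvg_cst.
- by rewrite affine'; exact: is_cvg_cst.
- apply: (cvg_comp (fun z : R => s * z) (fun u => m + u)).
    by apply: gt0_cvgMrNy s0 _; exact: cvg_id.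
  exact: cvg_addrl_Ny.
- apply: (cvg_comp (fun z : R => s * z) (fun u => m + u)).
    by apply: gt0_cvgMry s0 _; exact: cvg_id.
  exact: cvg_addrl.
- move=> x; apply: cvgM; first exact: cf.
  exact: continuous_normal_pdf.
- by move=> x; rewrite mulr_ge0 ?normal_pdf_ge0.
Qed.

Lemma ge0_integral_gaussN f : measurable_fun setT f -> (forall x, 0 <= f x) ->
  (\int[normal_prob 0 1]_z (f (- z)%R)%:E = \int[normal_prob 0 1]_z (f z)%:E)%E.
Proof.
move=> mf f0.
have mN : measurable_fun setT (fun z : R => f (- z)).
  by apply: measurableT_comp mf _; exact: oppr_measurable.
rewrite (ge0_integral_normal_prob 0 1 mf f0) (ge0_integral_normal_prob 0 1 mN)//.
have mg : measurable_fun [set: measurableTypeR R] (fun z => (f z * normal_pdf 0 1 z)%:E).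
  have : measurable_fun setT (fun z => f z * normal_pdf 0 1 z).
    by apply: measurable_funM => //; exact: measurable_normal_pdf.
  by move/measurable_EFinP.
transitivity (\int[pushforward mu (-%R : _ -> measurableTypeR R)]_z
    (f z * normal_pdf 0 1 z)%:E)%E.
  rewrite (ge0_integral_pushforward _ _ measurableT mg); last first.
    by move=> z _; rewrite lee_fin mulr_ge0 ?normal_pdf_ge0.
    exact: oppr_measurable.
  rewrite preimage_setT; apply: eq_integral => z _ /=; congr EFin; congr (_ * _).
  by rewrite !normal_pdfE ?oner_eq0// /normal_fun !subr0 sqrrN.
by apply: eq_measure_integral => //= A mA AS; exact: lebesgue_measureN.
Qed.

End NormalLaw.

(** * From nonnegative test functions to integrable ones *)

Section Transfer.
Context {R : realType}.

Lemma integrable_bounded {disp : measure_display} {T : measurableType disp}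
    (mu : {finite_measure set T -> \bar R}) (f : T -> R) (C : R) :
  measurable_fun setT f -> (forall x, `|f x| <= C) ->
  mu.-integrable setT (EFin \o f).
Proof.
move=> mf fC.
apply: (le_integrable measurableT _ _
  (finite_measure_integrable_cst mu C measurableT)).
- exact/measurable_EFinP.
- move=> x _ /=; rewrite lee_fin (le_trans (fC x))//; exact: ler_norm.
Qed.

(** The positive and negative parts of a continuous function are continuous, so equality of laws,
    tested on nonnegative continuous functions only, extends to signed ones. *)
Lemma integral_continuous_transfer {d1 d2 : measure_display}
    {T1 : measurableType d1} {T2 : measurableType d2}
    (p : {measure set T1 -> \bar R}) (q : {measure set T2 -> \bar R})
    (Y : T1 -> R) (Z : T2 -> R) :
  measurable_fun setT Y -> measurable_fun setT Z ->
  (forall f : R -> R, continuous f -> (forall x, 0 <= f x) ->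
    (\int[p]_w (f (Y w))%:E = \int[q]_w (f (Z w))%:E)%E) ->
  forall f : R -> R, continuous f ->
    q.-integrable setT (fun w => (f (Z w))%:E) ->
    p.-integrable setT (fun w => (f (Y w))%:E) /\
    (\int[p]_w (f (Y w))%:E = \int[q]_w (f (Z w))%:E)%E.
Proof.
move=> mY mZ YZ f cf /integrableP[_ fZ].
have mf := continuous_measurable_fun cf.
split.
  apply/integrableP; split; first exact/measurable_EFinP/measurableT_comp.
  rewrite (YZ (fun x => `|f x|))//.
  by move=> x; apply: continuous_comp; [exact: cf|exact: norm_continuous].
rewrite integralE [RHS]integralE; congr (_ - _)%E.
- transitivity (\int[p]_w (Num.max (f (Y w)) 0)%:E)%E.
    by apply: eq_integral => w _; rewrite funeposE EFin_max.
  rewrite (YZ (fun x => Num.max (f x) 0)).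
  + by apply: eq_integral => w _; rewrite funeposE EFin_max.
  + by move=> x; apply: (@continuous_max R _ f (cst 0)); [exact: cf|exact: cst_continuous].
  + by move=> x; rewrite le_max lexx orbT.
- transitivity (\int[p]_w (Num.max (- f (Y w)) 0)%:E)%E.
    by apply: eq_integral => w _; rewrite funenegE EFin_max.
  rewrite (YZ (fun x => Num.max (- f x) 0)).
  + by apply: eq_integral => w _; rewrite funenegE EFin_max.
  + move=> x; apply: (@continuous_max R _ (fun x => - f x) (cst 0)); last exact: cst_continuous.
    by apply: cvgN; exact: cf.
  + by move=> x; rewrite le_max lexx orbT.
Qed.

End Transfer.

(** * Moments and cosine transform of the standard normal law *)

Section GaussIntegrals.
Context {R : realType}.
Implicit Types (m s t : R) (f : R -> R).
Local Notation mu := (@lebesgue_measure R).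
Local Notation gauss := (normal_prob (0 : R) (1 : R)).

Lemma continuous_affine m s : continuous (fun z : R => s * z + m).
Proof.
by move=> z; apply: cvgD; [apply: cvgM; [exact: cvg_cst|exact: cvg_id]|exact: cvg_cst].
Qed.

Lemma integrable_gauss_sqr : gauss.-integrable setT (fun z : R => (z ^+ 2)%:E).
Proof.
have mX : measurable_fun setT (fun z : R => z ^+ 2).
  by apply: continuous_measurable_fun => z; exact: exprn_continuous.
apply/integrableP; split; first exact/measurable_EFinP.
under eq_integral do rewrite /= ger0_norm ?sqr_ge0//.
rewrite (ge0_integral_normal_prob 0 1 mX); last by move=> z; exact: sqr_ge0.
(* Domination by a wider Gaussian: exp(t) >= 1 + t at t = 3 z^2 / 8 gives z^2 exp(- 3 z^2 / 8) <= 8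
   / 3, and the peak for deviation 2 is half of the standard one, whence 16 / 3. *)
have pdf2 : mu.-integrable setT (fun z : R => (16 / 3 * normal_pdf 0 2 z)%:E).
  under eq_fun do rewrite EFinM.
  by apply: integrableZl => //; exact: integrable_normal_pdf.
have /integrableP[_] : mu.-integrable setT (fun z : R => (z ^+ 2 * normal_pdf 0 1 z)%:E).
  apply: le_integrable pdf2 => //.
    have : measurable_fun setT (fun z : R => z ^+ 2 * normal_pdf 0 1 z).
      by apply: measurable_funM => //; exact: measurable_normal_pdf.
    by move/measurable_EFinP.
  move=> z _ /=; rewrite lee_fin !ger0_norm; last 2 first.
  - by rewrite mulr_ge0 ?normal_pdf_ge0.
  - by rewrite mulr_ge0 ?sqr_ge0 ?normal_pdf_ge0.
  rewrite !normal_pdfE ?oner_eq0 ?pnatr_eq0// /normal_peak /normal_fun !subr0.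
  rewrite expr1n mul1r -mulrnAr sqrtrM ?sqr_ge0// sqrtr_sqr ger0_norm// invfM.
  have p0 : 0 < Num.sqrt (pi *+ 2 : R) by rewrite sqrtr_gt0 pmulrn_lgt0// pi_gt0.
  have -> : - z ^+ 2 / 2 = - (z ^+ 2 * (3 / 8)) + (- z ^+ 2 / (2 ^+ 2 *+ 2)) by field.
  rewrite expRD.
  have := expR_ge1Dx (z ^+ 2 * (3 / 8)).
  rewrite expRN; set a := expR (z ^+ 2 * _); set b := expR (_ / _); set p := Num.sqrt _ => ha.
  have b0 : 0 <= b by exact: expR_ge0.
  have a0 : 0 < a by exact: expR_gt0.
  rewrite (_ : 16 / 3 * _ = (8 / 3) * (p^-1 * b)); last by field; rewrite gt_eqF.
  rewrite (_ : z ^+ 2 * _ = (z ^+ 2 / a) * (p^-1 * b)); last by field; rewrite !gt_eqF.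
  apply: ler_wpM2r; first by rewrite mulr_ge0// invr_ge0 ltW.
  by rewrite ler_pdivrMr//; lra.
congr (_ < _)%E; apply: eq_integral => z _ /=.
by rewrite ger0_norm// mulr_ge0 ?sqr_ge0 ?normal_pdf_ge0.
Qed.

Lemma integrable_gauss_id : gauss.-integrable setT (fun z : R => z%:E).
Proof.
apply: (le_integrable measurableT _ _ (integrableD measurableT
  (finite_measure_integrable_cst gauss 1 measurableT) integrable_gauss_sqr)).
  exact/measurable_EFinP.
move=> z _ /=; rewrite lee_fin [leRHS]ger0_norm ?addr_ge0 ?sqr_ge0//.
by rewrite -(@real_normK _ z) ?num_real//; nra.
Qed.

(** Otherwise z = 0 almost surely, and the normal law would be carried by a Lebesgue-null point. *)
Lemma integral_gauss_sqr_gt0 : (0 < \int[gauss]_z (z ^+ 2)%:E)%E.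
Proof.
have mX : measurable_fun setT (fun z : R => z ^+ 2).
  by apply: continuous_measurable_fun => z; exact: exprn_continuous.
rewrite lt_neqAle integral_ge0 ?andbT; last by move=> z _; rewrite lee_fin sqr_ge0.
apply/negP => /eqP/esym z20.
have /ae_eq_integral_abs : (\int[gauss]_z `|(z ^+ 2)%:E| = 0)%E.
  by under eq_integral do rewrite gee0_abs ?lee_fin ?sqr_ge0//.
move=> /(_ measurableT) [].
  exact/measurable_EFinP.
move=> N [mN N0 NS].
have : gauss [set: R] = 0%E.
  apply/eqP; rewrite eq_le measure_ge0 andbT.
  apply: (@le_trans _ _ (gauss (N `|` [set 0%R]))).
    apply: le_measure; rewrite ?inE//; first exact: measurableU.
    move=> z _; have [->|z0] := eqVneq z 0; [by right|left].
    apply: NS => /= /(_ I) [] /eqP; rewrite sqrf_eq0; exact/negP.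
  have g0 : gauss [set 0%R] = 0%E.
    apply: (null_content_dominatesP _ _).1 (normal_prob_dominates (0 : R) 1) _ _ _.
      exact: measurable_set1.
    exact: lebesgue_measure_set1.
  by rewrite null_set_setU.
by rewrite probability_setT => /eqP; rewrite onee_eq0.
Qed.

Lemma Rintegral_gaussN f : continuous f ->
  gauss.-integrable setT (fun z => (f z)%:E) ->
  \int[gauss]_z f (- z) = \int[gauss]_z f z.
Proof.
move=> cf fi; rewrite /Rintegral.
have gN (g : R -> R) : continuous g -> (forall x, 0 <= g x) ->
    (\int[gauss]_z (g (- z)%R)%:E = \int[gauss]_z (g z)%:E)%E.
  by move=> cg g0; apply: (@ge0_integral_gaussN _ g) => //; exact: continuous_measurable_fun.
have mid : measurable_fun setT (fun z : R => z) by [].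
have mN : measurable_fun setT (fun z : R => - z) by exact: oppr_measurable.
by have [_ ->] := @integral_continuous_transfer R _ _ _ _ gauss gauss _ _ mN mid gN f cf fi.
Qed.

Lemma Rintegral_gauss_id : \int[gauss]_z z = 0.
Proof.
have cid : continuous (fun z : R => z) by move=> z; exact: cvg_id.
have := Rintegral_gaussN cid integrable_gauss_id.
under eq_Rintegral do rewrite -mulN1r.
rewrite RintegralZl//; last exact: integrable_gauss_id.
by lra.
Qed.

Definition psi s := \int[gauss]_z cos (s * z).

Lemma integrable_gauss_cos s (phi : R) :
  gauss.-integrable setT (fun z : R => (cos (s * z + phi))%:E).
Proof.
apply: (@integrable_bounded _ _ _ gauss (fun z : R => cos (s * z + phi)) 1).
  apply: continuous_measurable_fun => z; apply: continuous_comp; last exact: continuous_cos.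
  exact: continuous_affine.
by move=> z; rewrite ler_norml cos_geN1 cos_le1.
Qed.

Lemma psi0 : psi 0 = 1.
Proof.
rewrite /psi; under eq_Rintegral do rewrite mul0r cos0.
rewrite Rintegral_cst// ?mul1r; exact: (congr1 fine (probability_setT gauss)).
Qed.

(** By symmetry of the law phi may be replaced by - phi; averaging the two integrands removes the
    sine term. *)
Lemma Rintegral_gauss_cos s (phi : R) :
  \int[gauss]_z cos (s * z + phi) = cos phi * psi s.
Proof.
have cc (f : R -> R) : continuous f -> continuous (fun z => cos (f z)).
  by move=> cf z; apply: continuous_comp; [exact: cf|exact: continuous_cos].
have E : \int[gauss]_z cos (s * z + phi) = \int[gauss]_z cos (s * z + - phi).
  rewrite -Rintegral_gaussN//.
  - by apply: eq_Rintegral => z _; rewrite -[LHS]cosN; congr cos; ring.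
  - exact/cc/continuous_affine.
  - exact: integrable_gauss_cos.
have : \int[gauss]_z cos (s * z + phi) + \int[gauss]_z cos (s * z + phi) =
    2 * cos phi * psi s.
  rewrite {2}E -RintegralD//; try exact: integrable_gauss_cos.
  rewrite /psi -RintegralZl//; last first.
    by have := integrable_gauss_cos s 0; under eq_fun do rewrite addr0.
  apply: eq_Rintegral => z _; rewrite !cosD cosN sinN; ring.
by move: (\int[_]_(z in _) _) (psi s) => a b h; lra.
Qed.

End GaussIntegrals.

(** * Multiplicativity of the cosine transform *)

Section GaussConvolution.
Context {R : realType}.
Implicit Types (m s t : R) (f : R -> R).
Local Notation mu := (@lebesgue_measure R).
Local Notation gauss := (normal_prob (0 : R) (1 : R)).

(* Completing the square: X + Y for independent X ~ N(0, c^2), Y ~ N(0, d^2). *)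
Lemma normal_pdf_exchange (c d u y : R) : 0 < c -> c ^+ 2 + d ^+ 2 = 1 ->
  normal_pdf (d * y) c u * normal_pdf 0 1 y =
  normal_pdf 0 1 u * normal_pdf (d * u) c y.
Proof.
move=> c0 cd; rewrite !normal_pdfE ?oner_eq0 ?gt_eqF// /normal_fun.
rewrite mulrACA [RHS]mulrACA -!expRD [_ * normal_peak 1]mulrC.
congr (_ * expR _); rewrite expr1n !subr0.
have -> : c ^+ 2 = 1 - d ^+ 2 by rewrite -cd addrK.
have d1 : 1 - d ^+ 2 != 0 by rewrite -cd addrK expf_neq0// gt_eqF.
by field.
Qed.

(** The added constant 1 keeps the integrand nonnegative, as Tonelli's theorem requires in
    [psi_convolution]. *)
Lemma integral_gauss_1Dcos s (k phi : R) : `|k| <= 1 ->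
  (\int[gauss]_z (1 + k * cos (s * z + phi))%:E =
   (1 + k * (cos phi * psi s))%:E)%E.
Proof.
move=> k1; rewrite -Rintegral_gauss_cos.
have ik : gauss.-integrable setT (fun z : R => (k * cos (s * z + phi))%:E).
  by under eq_fun do rewrite EFinM; apply: integrableZl => //; exact: integrable_gauss_cos.
have i1 : gauss.-integrable setT (fun z : R => 1%:E).
  exact: (finite_measure_integrable_cst gauss 1 measurableT).
under eq_integral do rewrite EFinD.
rewrite integralD//.
have -> : (\int[gauss]_z 1%:E = 1%:E)%E.
  by rewrite integral_cst// mul1e; exact: (probability_setT gauss).
rewrite EFinD; congr (_ + _)%E.
under eq_integral do rewrite EFinM.
rewrite integralZl//; last exact: integrable_gauss_cos.
rewrite EFinM fineK//; apply: integrable_fin_num => //.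
exact: integrable_gauss_cos.
Qed.

Lemma norm_psi_le1 s : `|psi s| <= 1.
Proof.
have i : gauss.-integrable setT (EFin \o (fun z : R => cos (s * z))).
  by have := integrable_gauss_cos s 0; under eq_fun do rewrite addr0.
have i1 : gauss.-integrable setT (EFin \o (fun z : R => 1 : R)).
  exact: (finite_measure_integrable_cst gauss 1 measurableT).
apply: (le_trans (le_normr_Rintegral measurableT i)).
rewrite [leRHS](_ : 1 = \int[gauss]_z (1 : R)); last first.
  by rewrite Rintegral_cst// ?mul1r; exact/esym/(congr1 fine (probability_setT gauss)).
apply: le_Rintegral => //.
- exact: integrable_norm.
- by move=> z _; rewrite ler_norml cos_geN1 cos_le1.
Qed.

(** Let Y be standard normal and U, given Y = y, normal with mean d y and deviation c. Then U is
    standard normal, and integrating 1 + cos(r U) against the joint density in the two possible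
    orders gives the two sides. *)
Lemma psi_convolution (c d r : R) : 0 < c -> c ^+ 2 + d ^+ 2 = 1 ->
  psi (r * c) * psi (r * d) = psi r.
Proof.
move=> c0 cd.
have r2 u : 0 <= 1 + cos (r * u) :> R by have := cos_geN1 (r * u); lra.
have cF : continuous (fun u : R => 1 + cos (r * u)).
  move=> u; apply: cvgD; first exact: cvg_cst.
  apply: continuous_comp; last exact: continuous_cos.
  by apply: cvgM; [exact: cvg_cst|exact: cvg_id].
have mpdf m s : measurable_fun setT (normal_pdf m s) by exact: measurable_normal_pdf.
pose G (w : R * R) := (1 + cos (r * w.2)) * (normal_pdf (d * w.1) c w.2 * normal_pdf 0 1 w.1).
have G0 w : 0 <= G w by rewrite !mulr_ge0 ?normal_pdf_ge0.
have mG : measurable_fun setT G.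
  apply: measurable_funM.
    exact: (measurableT_comp (continuous_measurable_fun cF) measurable_snd).
  apply: measurable_funM; last exact: (measurableT_comp (mpdf 0 1) measurable_fst).
  rewrite (_ : (fun x : R * R => _) = (fun x =>
      normal_peak c * expR (- (x.2 - d * x.1) ^+ 2 / (c ^+ 2 *+ 2)))); last first.
    by apply/funext => x; rewrite normal_pdfE ?gt_eqF.
  apply: measurable_funM => //; apply: measurableT_comp => //.
  apply: measurable_funM => //; apply: measurableT_comp => //.
  apply: measurable_funX; apply: measurable_funB => //.
  by apply: measurable_funM.
have mEG : measurable_fun setT (EFin \o G) by exact/measurable_EFinP.
have := @fubini_tonelli _ _ _ _ _ mu mu (EFin \o G) mEG (fun w => G0 w).
have -> : (\int[mu]_x \int[mu]_y (EFin \o G) (x, y) = (1 + psi (r * c) * psi (r * d))%:E)%E.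
  transitivity (\int[mu]_y ((1 + psi (r * c) * cos (r * d * y + 0)) * normal_pdf 0 1 y)%:E)%E.
    apply: eq_integral => y _.
    transitivity (\int[mu]_u ((normal_pdf 0 1 y)%:E *
        ((1 + cos (r * u)) * normal_pdf (d * y) c u)%:E))%E.
      by apply: eq_integral => u _; rewrite -EFinM /G /=; congr EFin; rewrite mulrA mulrC.
    have mf : measurable_fun setT (fun u => ((1 + cos (r * u)) * normal_pdf (d * y) c u)%:E).
      have : measurable_fun setT (fun u => (1 + cos (r * u)) * normal_pdf (d * y) c u).
        by apply: measurable_funM => //; exact: continuous_measurable_fun.
      by move/measurable_EFinP.
    rewrite (ge0_integralZl mu measurableT mf); last 2 first.
    - by move=> u _; rewrite lee_fin mulr_ge0 ?normal_pdf_ge0.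
    - by rewrite lee_fin normal_pdf_ge0.
    rewrite -(ge0_integral_normal_prob (d * y) c (continuous_measurable_fun cF) r2).
    rewrite (continuous_integral_normal_prob (d * y) c0 cF r2).
    transitivity ((normal_pdf 0 1 y)%:E *
        \int[gauss]_z (1 + 1 * cos (r * c * z + r * d * y))%:E)%E.
      congr (_ * _)%E; apply: eq_integral => z _; congr (1 + _)%:E.
      by rewrite mul1r; congr cos; ring.
    rewrite integral_gauss_1Dcos ?normr1// -EFinM; congr EFin.
    by rewrite mul1r addr0 mulrC (mulrC (cos _)).
  have mc : measurable_fun setT (fun y : R => 1 + psi (r * c) * cos (r * d * y + 0)).
    apply: continuous_measurable_fun => y; apply: cvgD; first exact: cvg_cst.
    apply: cvgM; first exact: cvg_cst.
    by apply: continuous_comp; [exact: continuous_affine|exact: continuous_cos].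
  rewrite -(ge0_integral_normal_prob 0 1 mc); last first.
    move=> y; have h1 := norm_psi_le1 (r * c).
    have h2 : `|cos (r * d * y + 0)| <= 1 :> R by rewrite ler_norml cos_geN1 cos_le1.
    have : `|psi (r * c) * cos (r * d * y + 0)| <= 1.
      by rewrite normrM mulr_ile1.
    rewrite ler_norml => /andP[+ _].
    by move: (psi _ * _) => q; lra.
  by rewrite integral_gauss_1Dcos ?norm_psi_le1// cos0 mul1r.
have -> : (\int[mu]_y \int[mu]_x (EFin \o G) (x, y) = (1 + psi r)%:E)%E.
  transitivity (\int[mu]_u ((1 + cos (r * u)) * normal_pdf 0 1 u)%:E)%E.
    apply: eq_integral => u _.
    transitivity (\int[mu]_y (((1 + cos (r * u)) * normal_pdf 0 1 u)%:E *
        (normal_pdf (d * u) c y)%:E))%E.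
      apply: eq_integral => y _; rewrite -EFinM /G /=; congr EFin.
      by rewrite normal_pdf_exchange// mulrA.
    have mf : measurable_fun setT (fun y => (normal_pdf (d * u) c y)%:E).
      by have := mpdf (d * u) c; move/measurable_EFinP.
    rewrite (ge0_integralZl mu measurableT mf).
    - by rewrite integral_normal_pdf mule1.
    - by move=> y _; rewrite lee_fin normal_pdf_ge0.
    - by rewrite lee_fin mulr_ge0 ?normal_pdf_ge0.
  rewrite -(ge0_integral_normal_prob 0 1 (continuous_measurable_fun cF) r2).
  transitivity (\int[gauss]_z (1 + 1 * cos (r * z + 0))%:E)%E.
    by apply: eq_integral => z _; rewrite mul1r addr0.
  by rewrite integral_gauss_1Dcos ?normr1// cos0 !mul1r.
by move=> [] /addrI.
Qed.

Lemma psi_sqrtD s t : 0 <= s -> 0 <= t ->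
  psi (Num.sqrt (s ^+ 2 + t ^+ 2)) = psi s * psi t.
Proof.
move=> s0 t0; set r := Num.sqrt _.
(* A vanishing s is separated because [psi_convolution] needs a positive conditional deviation c = s
   / r. *)
have [s00|sn0] := eqVneq s 0.
  by rewrite /r s00 psi0 mul1r expr0n add0r sqrtr_sqr ger0_norm.
have r0 : 0 < r by rewrite sqrtr_gt0 ltr_pwDl// ?sqr_ge0// exprn_gt0// lt_neqAle eq_sym sn0.
have r2 : r ^+ 2 = s ^+ 2 + t ^+ 2 by rewrite sqr_sqrtr// addr_ge0 ?sqr_ge0.
have rn0 : r != 0 by rewrite gt_eqF.
rewrite -(@psi_convolution (s / r) (t / r)).
- by congr (psi _ * psi _); field.
- by rewrite divr_gt0// lt_neqAle eq_sym sn0.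
- by rewrite !expr_div_n -mulrDl -r2 divff// expf_neq0.
Qed.

End GaussConvolution.

(** * Gaussian variables as affine images of the standard normal law *)

Section GaussianVariable.
Context {disp : measure_display} {T : measurableType disp} {R : realType}.
Variable P : probability T R.
Local Notation gauss := (normal_prob (0 : R) (1 : R)).

(* The Dirac case is the affine image of the standard normal law with s = 0. *)
Lemma gaussian_variable_affine (Y : T -> R) : gaussian_variable P Y ->
  exists m s : R, 0 <= s /\ forall f : R -> R, continuous f ->
    (forall x, 0 <= f x) ->
    (\int[P]_w (f (Y w))%:E = \int[gauss]_z (f (s * z + m))%:E)%E.
Proof.
move=> [mY law].
have push (nu : {measure set (measurableTypeR R) -> \bar R}) (f : R -> R) :
    (forall A : set R, measurable A -> pushforward P Y A = nu A) ->
    continuous f -> (forall x, 0 <= f x) ->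
    (\int[P]_w (f (Y w))%:E = \int[nu]_x (f x)%:E)%E.
  move=> nuE cf f0.
  have mEf : measurable_fun [set: measurableTypeR R] (EFin \o f).
    by apply/measurable_EFinP; exact: continuous_measurable_fun.
  have mY' : measurable_fun setT (Y : T -> measurableTypeR R) by [].
  have := ge0_integral_pushforward mY' P measurableT mEf.
  rewrite preimage_setT => <-; last by move=> y _; rewrite lee_fin.
  by apply: eq_measure_integral => A mA _; exact: nuE.
case: law => [[m law]|[m [s [s0 law]]]].
  exists m, 0; split=> // f cf f0; rewrite (push (@dirac _ (measurableTypeR R) m R) f law cf f0).
  rewrite integral_dirac ?diracT ?mul1e//; last first.
    by apply/measurable_EFinP; exact: continuous_measurable_fun.
  under eq_integral do rewrite mul0r add0r.
  by rewrite integral_cst// -[LHS]mule1; congr (_ * _)%E; exact/esym/(probability_setT gauss).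
exists m, s; split=> [|f cf f0]; first exact: ltW.
rewrite (push (normal_prob m s) f law cf f0).
rewrite (continuous_integral_normal_prob m s0 cf f0).
by apply: eq_integral => z _; rewrite addrC.
Qed.

(** The second moment of the standard normal law is kept as a symbol; its positivity allows dividing
    by it in [chi]. *)
Definition gauss_sqr : R := fine (\int[gauss]_z (z ^+ 2)%:E)%E.

Lemma gauss_sqr_gt0 : 0 < gauss_sqr.
Proof.
rewrite fine_gt0// integral_gauss_sqr_gt0/=.
have := integrable_fin_num measurableT (@integrable_gauss_sqr R).
by rewrite fin_numElt => /andP[].
Qed.

(* The real characteristic function at 1 of a centered Gaussian variable, as a *)
(* function of its variance. *)
Definition chi (v : R) : R := psi (Num.sqrt (v / gauss_sqr)).

Lemma chi_add (u v : R) : 0 <= u -> 0 <= v -> chi (u + v) = chi u * chi v.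
Proof.
move=> u0 v0; have c0 := gauss_sqr_gt0.
rewrite /chi -psi_sqrtD ?sqrtr_ge0// !sqr_sqrtr ?divr_ge0// ?ltW//.
by rewrite mulrDl.
Qed.

(** Y has the law of s Z + m with Z standard normal. A zero mean forces m = 0, and then the second
    moment is s^2 times [gauss_sqr], from which [chi] recovers psi s. *)
Lemma gaussian_variable_moments (Y : T -> R) : gaussian_variable P Y ->
  [/\ measurable_fun setT Y,
      P.-integrable setT (fun w => (Y w ^+ 2)%:E) &
      \int[P]_w Y w = 0 -> forall phi : R,
        \int[P]_w cos (Y w + phi) = cos phi * chi (\int[P]_w (Y w ^+ 2))].
Proof.
move=> gY; have [mY _] := gY.
have [m [s [s0 law]]] := gaussian_variable_affine gY.
have ma : measurable_fun setT (fun z : R => s * z + m).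
  by apply: continuous_measurable_fun; exact: continuous_affine.
have tr := @integral_continuous_transfer R _ _ _ _ P gauss _ _ mY ma law.
have i1 : gauss.-integrable setT (fun z : R => (s * z)%:E).
  by under eq_fun do rewrite EFinM; apply: integrableZl => //; exact: integrable_gauss_id.
have ic (k : R) : gauss.-integrable setT (fun z : R => k%:E).
  exact: (finite_measure_integrable_cst gauss k measurableT).
have i2 : gauss.-integrable setT (fun z : R => (s ^+ 2 * z ^+ 2)%:E).
  by under eq_fun do rewrite EFinM; apply: integrableZl => //; exact: integrable_gauss_sqr.
have im : gauss.-integrable setT (fun z : R => (s * z + m)%:E).
  by under eq_fun do rewrite EFinD; apply: integrableD.
have isq : gauss.-integrable setT (fun z : R => ((s * z + m) ^+ 2)%:E).
  have -> : (fun z : R => ((s * z + m) ^+ 2)%:E) =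
      (fun z : R => (s ^+ 2 * z ^+ 2)%:E + ((2 * m)%:E * (s * z)%:E + (m ^+ 2)%:E))%E.
    apply/funext => z; rewrite -!EFinM -!EFinD; congr EFin; ring.
  by do 2 apply: integrableD => //; apply: integrableZl.
have [iY2 EY2] := tr (fun x => x ^+ 2) (@exprn_continuous _ 2) isq.
split=> // EY phi.
have cid : continuous (fun x : R => x) by move=> z; exact: cvg_id.
have [iY EY'] := tr _ cid im.
have m0 : m = 0.
  move: EY; rewrite /Rintegral EY' => EY; have {EY} : \int[gauss]_z (s * z + m) = 0 by [].
  rewrite (RintegralD measurableT i1 (ic m)).
  rewrite RintegralZl//; last exact: integrable_gauss_id.
  rewrite Rintegral_gauss_id mulr0 add0r Rintegral_cst//.
  by rewrite (congr1 fine (probability_setT gauss)) mulr1.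
have ccos : continuous (fun x : R => cos (x + phi)).
  move=> x; apply: continuous_comp; last exact: continuous_cos.
  by apply: cvgD; [exact: cvg_id|exact: cvg_cst].
have icos : gauss.-integrable setT (fun z : R => (cos (s * z + m + phi))%:E).
  by under eq_fun do rewrite -addrA; exact: integrable_gauss_cos.
have [_ Ecos] := tr _ ccos icos; subst m.
transitivity (\int[gauss]_z cos (s * z + 0 + phi)); first by rewrite /Rintegral Ecos.
under eq_Rintegral do rewrite addr0.
rewrite Rintegral_gauss_cos; congr (_ * _); rewrite /chi; congr psi.
rewrite /Rintegral EY2.
under eq_integral do rewrite addr0 exprMn EFinM.
rewrite integralZl//; last exact: integrable_gauss_sqr.
rewrite fineM//; last exact/integrable_fin_num/integrable_gauss_sqr.
by rewrite mulfK ?gt_eqF ?gauss_sqr_gt0// sqrtr_sqr ger0_norm.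
Qed.

End GaussianVariable.

(** * Functions determined by Fourier transforms *)

Section SignIteration.
Context {R : realType}.
Implicit Types y : R.

(* The odd map steepen has the attracting fixed points 1 and -1 on [-1, 1], so    *)
(* its iterates converge to the sign: sg(f) is a limit of polynomials in f.       *)
Definition steepen y : R := (3 * y - y ^+ 3) / 2.

Lemma steepenN y : steepen (- y) = - steepen y.
Proof. by rewrite /steepen; field. Qed.

(** The distance to the fixed point 1 contracts by a factor that is uniform on [a, 1], and this
    interval is stable; hence the geometric rate of the iterates. *)
Lemma steepen_itv (a y : R) : 0 < a -> a <= y <= 1 ->
  a <= steepen y <= 1 /\ 1 - steepen y <= (1 - y) * (1 - a / 2).
Proof.
move=> a0 /andP[ay y1].
have h1 : 0 <= (1 - y) * (y * (1 + y)) by rewrite !mulr_ge0//; lra.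
have h2 : 0 <= (1 - y) * ((1 - y) * (2 + y)) by rewrite !mulr_ge0//; lra.
have h3 : 0 <= (1 - y) * (y + y ^+ 2 - a).
  by rewrite mulr_ge0//; have := sqr_ge0 y; lra.
rewrite /steepen; split; [apply/andP; split|].
- rewrite -subr_ge0 (_ : _ - _ = (y - a) + (1 - y) * (y * (1 + y)) / 2); last by field.
  by rewrite addr_ge0 ?divr_ge0//; lra.
- by rewrite -subr_ge0 (_ : _ - _ = (1 - y) * ((1 - y) * (2 + y)) / 2) ?divr_ge0//; field.
- by rewrite -subr_ge0 (_ : _ - _ = (1 - y) * (y + y ^+ 2 - a) / 2) ?divr_ge0//; field.
Qed.

Lemma iter_steepenN n y : iter n steepen (- y) = - iter n steepen y.
Proof. by elim: n => //= n ->; rewrite steepenN. Qed.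

Lemma iter_steepen_itv n y : 0 < y -> y <= 1 ->
  y <= iter n steepen y <= 1 /\ 1 - iter n steepen y <= (1 - y / 2) ^+ n.
Proof.
move=> y0 y1; elim: n => [|n [IH1 IH2]] /=.
  by rewrite lexx y1 expr0; split=> //; lra.
have [-> le1] := steepen_itv y0 IH1; split=> //.
by rewrite exprSr (le_trans le1)// ler_wpM2r//; lra.
Qed.

Lemma iter_steepen_bound n y : `|y| <= 1 -> `|iter n steepen y| <= 1.
Proof.
rewrite ler_norml => /andP[y1 y2]; rewrite ler_norml.
have [y0|y0|y0] := ltrgtP 0 y.
- have [/andP[] h1 h2 _] := iter_steepen_itv n y0 y2; apply/andP; split=> //; lra.
- have Ny0 : 0 < - y by lra.
  have Ny1 : - y <= 1 by lra.
  have [/andP[] + + _] := iter_steepen_itv n Ny0 Ny1.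
  by rewrite iter_steepenN => h1 h2; apply/andP; split; lra.
- suff -> : iter n steepen y = 0 by apply/andP; split; lra.
  by rewrite -y0; elim: n => //= n ->; rewrite /steepen; field.
Qed.

Lemma cvg_iter_steepen y : `|y| <= 1 ->
  iter n steepen y @[n --> \oo] --> Num.sg y.
Proof.
have pos z : 0 < z -> z <= 1 -> iter n steepen z @[n --> \oo] --> (1 : R).
  move=> z0 z1.
  apply: (@squeeze_cvgr _ _ _ _ (fun n => 1 - (1 - z / 2) ^+ n) (cst 1)).
  - apply: nearW => n; have [/andP[_ ->] h] := iter_steepen_itv n z0 z1.
    by rewrite andbT; lra.
  - rewrite -[X in _ --> X]subr0; apply: cvgB; first exact: cvg_cst.
    by apply: cvg_expr; rewrite ger0_norm; lra.
  - exact: cvg_cst.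
rewrite ler_norml => /andP[y1 y2].
have [y0|y0|y0] := ltrgtP 0 y.
- by rewrite gtr0_sg//; exact: pos.
- rewrite ltr0_sg// (_ : (fun n => _) = (fun n => - iter n steepen (- y))); last first.
    by apply/funext => n; rewrite iter_steepenN opprK.
  by apply: cvgN; apply: pos; lra.
- rewrite -y0 sgr0 (_ : (fun n => _) = cst 0); first exact: cvg_cst.
  by apply/funext; elim=> //= n ->; rewrite /steepen /=; field.
Qed.

End SignIteration.

(** * Multipliers and the uniqueness theorem for Fourier transforms *)

Section Fourier.
Context {disp : measure_display} {T : measurableType disp} {R : realType}.
Variable P : probability T R.

Lemma integrable_mul_bounded (h f : T -> R) (C : R) :
  P.-integrable setT (fun w => (h w)%:E) -> measurable_fun setT f ->
  (forall w, `|f w| <= C) -> P.-integrable setT (fun w => (h w * f w)%:E).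
Proof.
move=> ih mf fC.
apply: (integrableMl measurableT ih mf).
exists C; split; first exact: num_real.
by move=> M CM w _ /=; rewrite (le_trans (fC w))// ltW.
Qed.

Lemma integral_mul_cvg (h f : T -> R) (f_ : nat -> T -> R) (C : R) :
  P.-integrable setT (fun w => (h w)%:E) ->
  (forall n, measurable_fun setT (f_ n)) ->
  (forall n w, `|f_ n w| <= C) ->
  (forall w, f_ n w @[n --> \oo] --> f w) ->
  (forall n, (\int[P]_w (h w * f_ n w)%:E = 0)%E) ->
  (\int[P]_w (h w * f w)%:E = 0)%E.
Proof.
move=> ih mf_ fC ff hf.
have mh : measurable_fun setT h.
  by have /integrableP[/measurable_EFinP] := ih.
have mf : measurable_fun setT f.
  by apply: measurable_fun_cvg mf_ _ => w _; exact: ff.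
have ig : P.-integrable setT (fun w => (`|h w| * C)%:E).
  under eq_fun do rewrite EFinM.
  by apply: integrableZr => //; exact: integrable_norm ih.
have [|||||_ _] := @dominated_convergence _ _ _ P setT measurableT
  (fun n w => (h w * f_ n w)%:E) (fun w => (h w * f w)%:E) (fun w => (`|h w| * C)%:E).
- by move=> n; apply/measurable_EFinP/measurable_funM.
- exact/measurable_EFinP/measurable_funM.
- apply: aeW => w _; apply: cvg_EFin; first exact: nearW.
  by apply: cvgM; [exact: cvg_cst|exact: ff].
- exact: ig.
- by apply: aeW => w n _; rewrite /= lee_fin normrM ler_wpM2l.
move=> cv; apply/esym; apply: (cvg_unique _ _ cv) => //.
rewrite (_ : [sequence _]_n%R = cst 0%E); first exact: cvg_cst.
by apply/funext => n; exact: hf.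
Qed.

Section Multipliers.
Variables (p : nat) (Y : T -> 'cV[R]_p).
Hypothesis mY : forall i, measurable_fun setT (fun w => Y w i ord0).

Local Notation lin a w := ((a *m Y w) ord0 ord0).

Lemma measurable_lin (a : 'rV[R]_p) : measurable_fun setT (fun w => lin a w).
Proof.
under eq_fun do rewrite mxE.
by apply: measurable_sum => i; apply: measurable_funM => //; exact: mY.
Qed.

Lemma measurable_cos_lin (a : 'rV[R]_p) phi :
  measurable_fun setT (fun w => cos (lin a w + phi)).
Proof.
have mc : measurable_fun setT (@cos R).
  by apply: continuous_measurable_fun; exact: continuous_cos.
by apply: (measurableT_comp mc); apply: measurable_funD => //; exact: measurable_lin.
Qed.

(** The image under Y of the signed measure h P has zero Fourier transform; the free phase phi lets
    cosines stand for both the real and the imaginary part. *)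
Definition fourier_null (h : T -> R) :=
  P.-integrable setT (fun w => (h w)%:E) /\
  forall (a : 'rV[R]_p) phi, (\int[P]_w (h w * cos (lin a w + phi))%:E = 0)%E.

(* The functions f that multiply every function with vanishing Fourier         *)
(* transform to another one form an algebra closed under bounded limits.        *)
Definition multiplier (f : T -> R) :=
  [/\ measurable_fun setT f, exists C, forall w, `|f w| <= C &
      forall h, fourier_null h -> fourier_null (fun w => h w * f w)].

Let integrable_cos (h : T -> R) (a : 'rV[R]_p) phi : P.-integrable setT (fun w => (h w)%:E) ->
  P.-integrable setT (fun w => (h w * cos (lin a w + phi))%:E).
Proof.
move=> ih; apply: (integrable_mul_bounded ih (measurable_cos_lin a phi) (C := 1)).
by move=> w; rewrite ler_norml cos_geN1 cos_le1.
Qed.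

(** A product of two cosines is half the sum of the cosines at the frequencies a + b and a - b. *)
Lemma multiplier_cos (a : 'rV[R]_p) phi : multiplier (fun w => cos (lin a w + phi)).
Proof.
split; first exact: measurable_cos_lin.
  by exists 1 => w; rewrite ler_norml cos_geN1 cos_le1.
move=> h [ih h0]; split; first exact: integrable_cos.
move=> b psi'.
transitivity (\int[P]_w (2^-1%:E * ((h w * cos (lin (a + b) w + (phi + psi')))%:E +
   (h w * cos (lin (a - b) w + (phi - psi')))%:E)))%E.
  apply: eq_integral => w _; rewrite -EFinD -EFinM; congr EFin.
  have -> : lin (a + b) w + (phi + psi') = (lin a w + phi) + (lin b w + psi').
    by rewrite mulmxDl mxE; ring.
  have -> : lin (a - b) w + (phi - psi') = (lin a w + phi) - (lin b w + psi').
    by rewrite mulmxBl !mxE; ring.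
  by move: (lin a w + phi) (lin b w + psi') => u v; rewrite cosB cosD; field.
rewrite integralZl//; last by apply: integrableD => //; exact: integrable_cos.
by rewrite integralD//; try exact: integrable_cos; rewrite !h0 adde0 mule0.
Qed.

Lemma multiplier_cst c : multiplier (cst c).
Proof.
split=> //; first by exists `|c|.
move=> h [ih h0]; split.
  exact: (integrable_mul_bounded ih (measurable_cst _) (C := `|c|)).
move=> a phi; under eq_integral do rewrite mulrAC mulrC EFinM.
by rewrite integralZl//; [rewrite h0 mule0|exact: integrable_cos].
Qed.

Lemma multiplier_mul f g : multiplier f -> multiplier g ->
  multiplier (fun w => f w * g w).
Proof.
move=> [mf [C fC] hf] [mg [D gD] hg]; split; first exact: measurable_funM.
  exists (C * D) => w; rewrite normrM ler_pM//.
move=> h /hf/hg; congr fourier_null.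
by apply/funext => w; rewrite mulrA.
Qed.

Lemma multiplier_add f g : multiplier f -> multiplier g ->
  multiplier (fun w => f w + g w).
Proof.
move=> [mf [C fC] hf] [mg [D gD] hg]; split; first exact: measurable_funD.
  by exists (C + D) => w; rewrite (le_trans (ler_normD _ _))// lerD.
move=> h h0; have [i1 h1] := hf _ h0; have [i2 h2] := hg _ h0; split.
  by under eq_fun do rewrite mulrDr EFinD; exact: integrableD.
move=> a phi; under eq_integral do rewrite mulrDr mulrDl EFinD.
by rewrite integralD//; [rewrite h1 h2 adde0|exact: integrable_cos..].
Qed.

Lemma multiplier_opp f : multiplier f -> multiplier (fun w => - f w).
Proof.
move=> /(multiplier_mul (multiplier_cst (- 1))); congr multiplier.
by apply/funext => w; rewrite mulN1r.
Qed.

Lemma multiplier_lim (f_ : nat -> T -> R) f C : (forall n, multiplier (f_ n)) ->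
  (forall n w, `|f_ n w| <= C) -> (forall w, f_ n w @[n --> \oo] --> f w) ->
  multiplier f.
Proof.
move=> mf_ fC ff.
have mf : measurable_fun setT f.
  by apply: (@measurable_fun_cvg _ _ _ _ f_) => [n|w _]; [have [] := mf_ n|exact: ff].
have fC' w : `|f w| <= C.
  rewrite leNgt; apply/negP => /(cvgr_gt _ (cvg_norm (ff w))) [n _ /(_ n (leqnn n))] /=.
  by rewrite ltNge fC.
split=> //; first by exists C.
move=> h h0; have ih := h0.1; split; first exact: integrable_mul_bounded fC'.
move=> a phi; under eq_integral do rewrite mulrAC.
apply: (integral_mul_cvg (f_ := f_) (C := C)) => //.
- exact: integrable_cos.
- by move=> n; have [] := mf_ n.
- by move=> n; have [_ _ /(_ _ h0)[_ +]] := mf_ n; under eq_integral do rewrite mulrAC.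
Qed.

Lemma multiplier_sg f : multiplier f -> (forall w, `|f w| <= 1) ->
  multiplier (fun w => Num.sg (f w)).
Proof.
move=> mf f1; apply: (@multiplier_lim (fun n w => iter n steepen (f w)) _ 1).
- elim=> //= n IH; rewrite /steepen.
  apply: multiplier_mul; last exact: multiplier_cst.
  apply: multiplier_add; first by apply: multiplier_mul => //; exact: multiplier_cst.
  apply: multiplier_opp; rewrite (_ : (fun w => _) = (fun w =>
    iter n steepen (f w) * (iter n steepen (f w) * iter n steepen (f w)))).
    by do 2 apply: multiplier_mul => //.
  by apply/funext => w; rewrite !exprS expr0 mulr1.
- by move=> n w; exact: iter_steepen_bound.
- by move=> w; exact: cvg_iter_steepen.
Qed.

(** A linear form is unbounded, so its sign is reached through bounded functions: for n large, sin(y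
    / (n + 1)) has the sign of y. *)
Lemma multiplier_gt (a : 'rV[R]_p) c :
  multiplier (\1_[set w | c < lin a w]).
Proof.
have msin (n : nat) : multiplier (fun w => sin ((lin a w - c) / n.+1%:R)).
  have := multiplier_cos (n.+1%:R^-1 *: a) (- c / n.+1%:R - pi / 2).
  congr multiplier; apply/funext => w.
  rewrite -[RHS]cosBpihalf; congr cos.
  by rewrite -scalemxAl mxE; ring.
have msg : multiplier (fun w => Num.sg (lin a w - c)).
  apply: (@multiplier_lim (fun n w => Num.sg (sin ((lin a w - c) / n.+1%:R))) _ 1).
  - by move=> n; apply: multiplier_sg => // w; rewrite ler_norml sin_geN1 sin_le1.
  - by move=> n w; rewrite normr_sg; case: (_ != 0).
  - move=> w; set y := lin a w - c.
    have pos z : 0 < z -> \forall n \near \oo, 0 < sin (z / n.+1%:R).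
      move=> z0; near=> n; apply: sin_gt0_pi; apply/andP; split; first exact: divr_gt0.
      rewrite ltr_pdivrMr// (@lt_le_trans _ _ (2 * n.+1%:R))//; last first.
        by rewrite ler_wpM2r// pi_ge2.
      rewrite (@lt_le_trans _ _ n.+1%:R)//; last by rewrite ler_peMl// ler1n.
      rewrite (@lt_le_trans _ _ n%:R)//; last by rewrite ler_nat.
      by near: n; exact: nbhs_infty_gtr.
    have [y0|y0|y0] := ltrgtP 0 y.
    + rewrite gtr0_sg//; apply: cvg_near_cst.
      by near=> n; apply: gtr0_sg; near: n; exact: pos.
    + rewrite ltr0_sg//; apply: cvg_near_cst.
      have Ny0 : 0 < - y by lra.
      near=> n; apply: ltr0_sg; rewrite -oppr_gt0 -sinN -mulNr.
      by near: n; exact: pos.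
    + by rewrite -y0; under eq_fun do rewrite mul0r sin0 sgr0; rewrite sgr0; exact: cvg_cst.
(* With s the sign of y, the indicator of y > 0 is (s^2 + s) / 2. *)
have := multiplier_mul (multiplier_cst 2^-1) (multiplier_add (multiplier_mul msg msg) msg).
congr multiplier; apply/funext => w; rewrite indicE.
have -> : (w \in [set w | c < lin a w]) = (0 < lin a w - c).
  by rewrite subr_gt0; apply/idP/idP; rewrite inE.
have [y0|y0|y0] := ltrgtP 0 (lin a w - c).
- by rewrite gtr0_sg//=; field.
- by rewrite ltr0_sg//=; field.
- by rewrite -y0 sgr0 /=; field.
Unshelve. all: end_near. Qed.

Lemma multiplier_setC (A : set T) : multiplier (\1_A) -> multiplier (\1_(~` A)).
Proof.
move=> /multiplier_opp/(multiplier_add (multiplier_cst 1)); congr multiplier.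
by apply/funext => w; rewrite /= !indicE in_setC; case: (w \in A) => /=; ring.
Qed.

(** Finite unions come from complements and products; the countable union is their bounded pointwise
    limit. *)
Lemma multiplier_bigcup (A : nat -> set T) : (forall n, multiplier (\1_(A n))) ->
  multiplier (\1_(\bigcup_n A n)).
Proof.
move=> mA; pose U n := \big[setU/set0]_(k < n) A k.
have mU n : multiplier (\1_(U n)).
  elim: n => [|n IH].
    rewrite /U big_ord0; have := multiplier_cst 0; congr multiplier.
    by apply/funext => w; rewrite indicE in_set0.
  rewrite /U big_ord_recr /= -/(U n) -[_ `|` _]setCK setCU.
  apply: multiplier_setC.
  have := multiplier_mul (multiplier_setC IH) (multiplier_setC (mA n)).
  by congr multiplier; apply/funext => w; rewrite !indicE in_setI -natrM mulnb.
apply: (multiplier_lim mU (C := 1)) => [n w|w].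
  by rewrite indicE; case: (_ \in _); rewrite ?normr1 ?normr0.
have [[n _ An]|nA] := pselect ((\bigcup_n A n) w).
  apply: cvg_near_cst; exists n.+1 => // m /= nm; rewrite !indicE !mem_set//.
    by exists n.
  by rewrite /U -bigcup_mkord; exists n.
apply: cvg_near_cst; apply: nearW => m; rewrite !indicE !memNset//.
by rewrite /U -bigcup_mkord => -[k _ Ak]; apply: nA; exists k.
Qed.

Definition sigma_vec : set (set T) :=
  <<s \bigcup_(i in [set: 'I_p])
        preimage_set_system [set: T] (fun w => Y w i ord0) measurable >>.

(** The sets whose indicator is a multiplier form a sigma-algebra, so open half-lines of single
    coordinates suffice as generators. *)
Lemma multiplier_sigma (D : set T) : sigma_vec D -> multiplier (\1_D).
Proof.
move: D; apply: smallest_sub.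
  split.
  - have := multiplier_cst 0; congr multiplier.
    by apply/funext => w; rewrite indicE in_set0.
  - by move=> A mA; rewrite setTD; exact: multiplier_setC.
  - by move=> A mA; exact: multiplier_bigcup.
move=> _ [i _ [B mB <-]]; rewrite setTI.
have {}mB : (@ocitv R).-sigma.-measurable B by exact: mB.
rewrite RGenOInfty.measurableE in mB; move: B mB; apply: smallest_sub.
  split.
  - rewrite /= preimage_set0; have := multiplier_cst 0; congr multiplier.
    by apply/funext => w; rewrite indicE in_set0.
  - by move=> A mA; rewrite /= setTD preimage_setC; exact: multiplier_setC.
  - by move=> A mA; rewrite /= preimage_bigcup; exact: multiplier_bigcup.
move=> _ [c ->] /=.
have := multiplier_gt (delta_mx ord0 i) c; congr (multiplier (\1_ _)).
by apply/seteqP; split=> w /=; rewrite in_itv/= andbT -rowE mxE.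
Qed.

Lemma sigma_vec_measurable : sigma_vec `<=` measurable.
Proof.
apply: smallest_sub; first exact: sigma_algebra_measurable.
by move=> _ [i _ [B mB <-]]; exact: mY.
Qed.

(** Multiplying h by the indicator of D keeps its transform zero; the value at frequency 0 is the
    integral over D. *)
Lemma fourier_null_sigma (h : T -> R) (D : set T) : fourier_null h ->
  sigma_vec D -> (\int[P]_(w in D) (h w)%:E = 0)%E.
Proof.
move=> h0 sD; have [_ _ /(_ _ h0)[_ /(_ 0 0)]] := multiplier_sigma sD.
under eq_integral do rewrite mul0mx mxE addr0 cos0 mulr1.
rewrite [in X in _ -> X]integral_mkcond => hD; rewrite -[RHS]hD.
by apply: eq_integral => w _; rewrite epatch_indic EFinM.
Qed.

End Multipliers.

End Fourier.

(** * Versions of conditional probabilities *)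

Section ConditionalProbability.
Context {disp : measure_display} {T : measurableType disp} {R : realType}.
Variable P : probability T R.

Import HBNNSimple.

(** Measurability is stated for a set system on T, so that several sub-sigma-algebras coexist on one
    type; [sub_measurableP] passes to the type of a generated sigma-algebra. *)
Definition sub_measurable (F : set (set T)) (X : T -> R) :=
  forall B : set R, measurable B -> F (X @^-1` B).

Lemma sub_measurableP (gen : set (set T)) (X : T -> R) :
  sub_measurable <<s gen>> X <->
  measurable_fun [set: g_sigma_algebraType gen] X.
Proof.
split=> [mX _ B mB|mX B mB]; first by rewrite setTI; exact: mX.
by rewrite -[_ @^-1` _]setTI; exact: mX.
Qed.

(** A function whose conditional expectation given F is zero is orthogonal to every F-measurable X
    with integrable product: simple functions first, then limits. *)
Lemma integral_mul_sub_measurable (F : set (set T)) (h X : T -> R) :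
  F `<=` measurable -> sub_measurable F X ->
  P.-integrable setT (fun w => (h w)%:E) ->
  P.-integrable setT (fun w => (h w * X w)%:E) ->
  (forall D, F D -> (\int[P]_(w in D) (h w)%:E = 0)%E) ->
  (\int[P]_w (h w * X w)%:E = 0)%E.
Proof.
move=> FT FX ih ihX h0.
have mX : measurable_fun setT X by move=> _ B mB; rewrite setTI; exact/FT/FX.
have mh : measurable_fun setT h by have /integrableP[/measurable_EFinP] := ih.
have simple (s : {nnsfun measurableTypeR R >-> R}) : (\int[P]_w (h w * s (X w))%:E = 0)%E.
  have mpre (r : R) : measurable (s @^-1` [set r] : set R).
    have mr : measurable ([set r] : set R) by exact: measurable_set1.
    by have := measurable_funPTI s mr.
  have intS (r : R) (B : set R) : measurable B ->
      P.-integrable setT (fun w => (h w * (r * \1_B (X w)))%:E).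
    move=> mB; apply: (integrable_mul_bounded ih (C := `|r|)).
      by apply: measurable_funM => //; apply: measurableT_comp.
    by move=> w; rewrite normrM ler_piMr// indicE; case: (_ \in _); rewrite ?normr1 ?normr0.
  under eq_integral do rewrite fimfunEord mulr_sumr -sumEFin.
  rewrite integral_sum//; last by move=> i; apply: intS; exact: mpre.
  apply: big1 => i _.
  set r := nth _ _ _; set B := s @^-1` _.
  have mB : measurable B by exact: mpre.
  have iB : P.-integrable setT (fun w => (h w * \1_B (X w))%:E).
    by have := intS 1 _ mB; under eq_fun do rewrite mul1r.
  under eq_integral do rewrite mulrCA EFinM.
  rewrite integralZl// [X in (_ * X)%E](_ : _ = 0%E) ?mule0//.
  rewrite -[RHS](h0 _ (FX _ mB)) [RHS]integral_mkcond.
  apply: eq_integral => w _; rewrite epatch_indic -EFinM; congr (_ * _)%:E.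
(* The bound by the absolute value makes h X an integrable dominating function; it holds for the
   positive and negative parts. *)
have pos (phi : R -> R) : measurable_fun [set: measurableTypeR R] phi ->
    (forall x, 0 <= phi x <= `|x|) -> (\int[P]_w (h w * phi (X w))%:E = 0)%E.
  move=> mphi phi0.
  have mEphi : measurable_fun [set: measurableTypeR R] (EFin \o phi) by exact/measurable_EFinP.
  pose s := nnsfun_approx measurableT mEphi.
  have E0 x : setT x -> (0 <= (EFin \o phi) x)%E by rewrite lee_fin; have /andP[] := phi0 x.
  have sle n x : s n x <= phi x.
    by rewrite -lee_fin /s nnsfun_approxE; apply: le_approx.
  have ms n : measurable_fun setT (fun w => s n (X w)).
    exact: (measurableT_comp (measurable_funP (s n)) mX).
  have [|||||_ _] := @dominated_convergence _ _ _ P setT measurableT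
    (fun n w => (h w * s n (X w))%:E) (fun w => (h w * phi (X w))%:E)
    (fun w => `|(h w * X w)%:E|%E).
  - by move=> n; apply/measurable_EFinP/measurable_funM.
  - by apply/measurable_EFinP/measurable_funM => //; apply: measurableT_comp.
  - apply: aeW => w _; apply: cvg_EFin; first exact: nearW.
    apply: cvgM; first exact: cvg_cst.
    have := cvg_nnsfun_approx measurableT mEphi E0 (x := X w) I.
    by move=> /fine_cvg.
  - exact: integrable_abse.
  - apply: aeW => w n _; rewrite /= lee_fin !normrM ler_wpM2l//.
    rewrite ger0_norm ?(le_trans (sle _ _))//; have /andP[_ +] := phi0 (X w) => //.
  move=> cv; apply/esym; apply: (cvg_unique _ _ cv) => //.
  rewrite (_ : [sequence _]_n%R = cst 0%E); first exact: cvg_cst.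
  by apply/funext => n; exact: simple.
have iphi (phi : R -> R) : measurable_fun [set: measurableTypeR R] phi ->
    (forall x, 0 <= phi x <= `|x|) -> P.-integrable setT (fun w => (h w * phi (X w))%:E).
  move=> mphi phi0; apply: le_integrable ihX => //.
    by apply/measurable_EFinP/measurable_funM => //; apply: measurableT_comp.
  move=> w _ /=; rewrite lee_fin !normrM ler_wpM2l//.
  by have /andP[p0 +] := phi0 (X w); rewrite ger0_norm.
pose pp (x : R) := Num.max x 0; pose pn (x : R) := Num.max (- x) 0.
have mpp : measurable_fun [set: measurableTypeR R] pp.
  by apply: measurable_maxr.
have mpn : measurable_fun [set: measurableTypeR R] pn.
  by apply: measurable_maxr.
have bpp x : 0 <= pp x <= `|x| by rewrite /pp le_max lexx orbT ge_max ler_norm normr_ge0.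
have bpn x : 0 <= pn x <= `|x|.
  by rewrite /pn le_max lexx orbT ge_max -{1}normrN ler_norm normr_ge0.
have -> : (\int[P]_w (h w * X w)%:E =
    \int[P]_w ((h w * pp (X w))%:E - (h w * pn (X w))%:E))%E.
  apply: eq_integral => w _; rewrite -EFinB -mulrBr; congr (_ * _)%:E.
  by rewrite /pp /pn; case: (lerP (X w) 0) => ?; case: (lerP (- X w) 0) => ?; lra.
by rewrite integralB_EFin//; [rewrite !pos// subee|exact: iphi..].
Qed.

Lemma sub_measurable_measurable (F : set (set T)) (X : T -> R) :
  F `<=` measurable -> sub_measurable F X -> measurable_fun setT X.
Proof. by move=> FT FX _ B mB; rewrite setTI; exact/FT/FX. Qed.

Section Versions.
Variable gen : set (set T).
Hypothesis genT : <<s gen>> `<=` measurable.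
Local Notation F := (<<s gen>>).

Lemma sub_measurable_lt (p q : T -> R) : sub_measurable F p ->
  sub_measurable F q -> F [set w | q w < p w].
Proof.
move=> /sub_measurableP mp /sub_measurableP mq.
have /sub_measurableP mpq := measurable_funB mp mq.
have -> : [set w | q w < p w] = (fun w => p w - q w) @^-1` `]0, +oo[.
  by apply/seteqP; split=> w /=; rewrite in_itv/= andbT subr_gt0.
by apply: mpq; exact: measurable_itv.
Qed.

(** The set where q < p belongs to F; there p - q is positive with nonpositive integral, so the set
    is null. *)
Lemma ae_le_of_integral (p q : T -> R) : sub_measurable F p -> sub_measurable F q ->
  P.-integrable setT (EFin \o p) -> P.-integrable setT (EFin \o q) ->
  (forall C, F C -> (\int[P]_(w in C) (p w)%:E <= \int[P]_(w in C) (q w)%:E)%E) ->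
  {ae P, forall w, p w <= q w}.
Proof.
move=> mp mq ip iq pq.
have FC := sub_measurable_lt mp mq; set C := [set w | _] in FC.
have mC : measurable C by exact: genT.
have ipC := integrableS measurableT mC (@subsetT _ _) ip.
have iqC := integrableS measurableT mC (@subsetT _ _) iq.
have i0 : (\int[P]_(w in C) `|(p w)%:E - (q w)%:E| = 0)%E.
  apply/eqP; rewrite eq_le integral_ge0 ?andbT//.
  under eq_integral.
    move=> w; rewrite inE => Cw; rewrite gee0_abs; first over.
    by rewrite -EFinB lee_fin subr_ge0 ltW.
  by rewrite integralB_EFin// sube_le0; exact: pq.
have mpq : measurable_fun C (fun w => ((p w)%:E - (q w)%:E)%E).
  by apply: emeasurable_funB; [exact: measurable_int ipC|exact: measurable_int iqC].
have /(ae_eq_integral_abs P mC mpq) := i0.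
apply: filterS => w /= h; rewrite leNgt; apply/negP => qp.
by have /eqP := h qp; rewrite -EFinB eqe subr_eq0 gt_eqF.
Qed.

Lemma cond_prob_version_unique (A : set T) (p q : T -> R) :
  cond_prob_version P F A p -> cond_prob_version P F A q ->
  {ae P, forall w, p w = q w}.
Proof.
move=> [mp ip pA] [mq iq qA].
have h1 : {ae P, forall w, p w <= q w}.
  by apply: ae_le_of_integral => // C FC; rewrite pA// qA.
have h2 : {ae P, forall w, q w <= p w}.
  by apply: ae_le_of_integral => // C FC; rewrite pA// qA.
by apply: filterS2 h1 h2 => w pq qp; apply/eqP; rewrite eq_le pq qp.
Qed.

Lemma integral_ae_eqr (D : set T) (p q : T -> R) : measurable D ->
  measurable_fun setT p -> measurable_fun setT q ->
  {ae P, forall w, p w = q w} ->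
  (\int[P]_(w in D) (p w)%:E = \int[P]_(w in D) (q w)%:E)%E.
Proof.
move=> mD mp mq pq; apply: ae_eq_integral => //.
- exact/measurable_EFinP/measurable_funTS.
- exact/measurable_EFinP/measurable_funTS.
- by apply: filterS pq => w -> _.
Qed.

(** Versions with values in [0, 1] everywhere can be used as bounded factors under integrals. *)
Lemma cond_prob_version_clip (A : set T) (p : T -> R) : measurable A ->
  cond_prob_version P F A p ->
  exists2 q, cond_prob_version P F A q & forall w, 0 <= q w <= 1.
Proof.
move=> mA [mp ip pA].
have mF (c : R) : sub_measurable F (cst c).
  by apply/sub_measurableP; exact: measurable_cst.
have ic (c : R) : P.-integrable setT (EFin \o cst c).
  exact: finite_measure_integrable_cst.
have Ecst (c : R) C : F C -> (\int[P]_(w in C) (cst c w)%:E = c%:E * P C)%E.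
  by move=> FC; rewrite -integral_cst//; exact: genT.
have h0 : {ae P, forall w, (cst 0 : T -> R) w <= p w}.
  apply: ae_le_of_integral => // C FC.
  by rewrite pA// Ecst// mul0e measure_ge0.
have h1 : {ae P, forall w, p w <= (cst 1 : T -> R) w}.
  apply: ae_le_of_integral => // C FC.
  rewrite pA// Ecst// mul1e.
  by apply: measureIr => //; exact: genT.
have mq : sub_measurable F (fun w => Num.max 0 (Num.min 1 (p w))).
  apply/sub_measurableP; apply: measurable_maxr; first exact: measurable_cst.
  by apply: measurable_minr; [exact: measurable_cst|exact/sub_measurableP].
have pq : {ae P, forall w, Num.max 0 (Num.min 1 (p w)) = p w}.
  by apply: filterS2 h0 h1 => w p0 p1; rewrite min_r// max_r.
exists (fun w => Num.max 0 (Num.min 1 (p w))); last first.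
  by move=> w; rewrite le_max lexx /= ge_max ler01 ge_min lexx.
have mqT := sub_measurable_measurable genT mq.
have mpT := sub_measurable_measurable genT mp.
split=> //.
- apply: (integrable_bounded _ mqT (C := 1)) => w.
  by rewrite ger0_norm ?le_max ?lexx// ge_max ler01 ge_min lexx.
- by move=> B FB; rewrite -pA//; apply: integral_ae_eqr => //; exact: genT.
Qed.

End Versions.

Section Existence.
Variables (gen : set (set T)) (A : set T).
Hypothesis genT : <<s gen>> `<=` measurable.
Hypothesis mA : measurable A.
Local Notation Tg := (g_sigma_algebraType gen).

(** On the sub-sigma-algebra, the density of this measure with respect to the one obtained for A =
    setT is the conditional probability of A. *)
Let trace (C : set Tg) : \bar R := P (A `&` C).

Let trace0 : trace set0 = 0%E.
Proof. by rewrite /trace setI0 measure0. Qed.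

Let trace_ge0 C : (0 <= trace C)%E.
Proof. exact: measure_ge0. Qed.

Let trace_sigma_additive : semi_sigma_additive trace.
Proof.
move=> E mE tE mU; rewrite /trace setI_bigcupr.
apply: measure_semi_sigma_additive.
- by move=> i; apply: measurableI => //; apply: genT; exact: mE.
- exact: trivIset_setIl.
- rewrite -setI_bigcupr; apply: measurableI => //; exact: genT.
Qed.

HB.instance Definition _ := isMeasure.Build _ _ _ trace
  trace0 trace_ge0 trace_sigma_additive.

Let trace_fin : fin_num_fun trace.
Proof.
move=> C mC; rewrite /trace; apply: fin_num_measure.
by apply: measurableI => //; exact: genT.
Qed.

HB.instance Definition _ := @Measure_isFinite.Build _ Tg R trace trace_fin.

Definition trace_measure : {finite_measure set Tg -> \bar R} := trace.

End Existence.

Lemma cond_prob_version_exists (gen : set (set T)) (A : set T) :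
  <<s gen>> `<=` measurable -> measurable A ->
  exists2 p, cond_prob_version P <<s gen>> A p & forall w, 0 <= p w <= 1.
Proof.
move=> genT mA.
pose Tg := g_sigma_algebraType gen.
pose nu := trace_measure genT mA; pose mu := trace_measure genT measurableT.
have numu : nu `<< mu.
  apply/null_content_dominatesP => C mC muC0.
  apply/eqP; rewrite eq_le measure_ge0 andbT -muC0.
  apply: le_measure; rewrite ?inE; last exact: setSI.
    by apply: measurableI => //; apply: (genT _ mC).
  by apply: measurableI => //; apply: (genT _ mC).
pose f := Radon_Nikodym_SigmaFinite.f nu mu.
have f0 w : (0 <= f w)%E by exact: Radon_Nikodym_SigmaFinite.f_ge0.
have ffin w : f w \is a fin_num by exact: Radon_Nikodym_SigmaFinite.f_fin_num.
have fi : mu.-integrable [set: Tg] f by exact: Radon_Nikodym_SigmaFinite.f_integrable.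
have mf : measurable_fun [set: Tg] f by exact: measurable_int fi.
have mid : measurable_fun setT (id : T -> Tg).
  by move=> _ C mC; rewrite setTI; apply: (genT _ mC).
(* The restriction [mu] is the image of P under the identity map into the coarser measurable
   space. *)
have transfer (C : set Tg) : measurable C -> (\int[mu]_(w in C) f w = \int[P]_(w in C) f w)%E.
  move=> mC; rewrite -(ge0_integral_pushforward mid P mC)//; last exact: measurable_funTS.
  by apply: eq_measure_integral => B mB _; rewrite /= /pushforward setTI.
have fE : EFin \o (fine \o f) = f by apply/funext => w /=; rewrite fineK.
have mp : sub_measurable <<s gen>> (fine \o f).
  by apply/sub_measurableP; apply: measurableT_comp mf.
apply: (cond_prob_version_clip genT mA (p := fine \o f)); split=> //.
- have /integrableP[_ fioo] := fi; apply/integrableP; split.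
    by apply/measurable_EFinP; exact: (sub_measurable_measurable genT mp).
  rewrite fE (_ : (\int[P]_w `|f w| = \int[mu]_w `|f w|)%E)//.
  transitivity (\int[P]_w f w)%E; first by apply: eq_integral => w _; rewrite gee0_abs.
  by rewrite -transfer//; apply: eq_integral => w _; rewrite gee0_abs.
- move=> C FC; rewrite -[LHS]/(\int[P]_(w in C) (EFin \o (fine \o f)) w)%E.
  by rewrite fE -transfer// -Radon_Nikodym_SigmaFinite.f_integral.
Qed.

End ConditionalProbability.

(** * Gaussian vectors *)

Section GaussianVector.
Context {disp : measure_display} {T : measurableType disp} {R : realType}.
Variable P : probability T R.

Lemma integral_indicr (D : set T) (f : T -> R) :
  (\int[P]_(w in D) (f w)%:E = \int[P]_w (f w * \1_D w)%:E)%E.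
Proof.
rewrite integral_mkcond; apply: eq_integral => w _.
by rewrite epatch_indic EFinM.
Qed.

Lemma EFin_Rintegral (f : T -> R) : P.-integrable setT (fun w => (f w)%:E) ->
  (\int[P]_w (f w)%:E = (\int[P]_w f w)%:E)%E.
Proof. by move=> fi; rewrite /Rintegral fineK//; exact: integrable_fin_num. Qed.

Lemma covmx_Rintegral (m n : nat) (X : T -> 'cV[R]_m) (Y : T -> 'cV[R]_n) i j :
  zero_mean P X -> zero_mean P Y ->
  covmx P X Y i j = \int[P]_w (X w i ord0 * Y w j ord0).
Proof.
move=> X0 Y0; rewrite mxE unlock X0 Y0 /=; congr fine; rewrite unlock.
by apply: eq_integral => w _; rewrite -[(_ * _)%R w]/((X w i ord0 - 0) * (Y w j ord0 - 0)) !subr0.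
Qed.

Section Moments.
Variables (n : nat) (X : T -> 'cV[R]_n).
Hypotheses (gX : gaussian_vector P X) (X0 : zero_mean P X).
Local Notation K := (covmx P X X).

Lemma gaussian_vector_measurable i : measurable_fun setT (fun w => X w i ord0).
Proof. by have [mX _] := gX; exact: mX. Qed.

Lemma measurable_gaussian_lin p (a : 'M[R]_(p, n)) i :
  measurable_fun setT (fun w => (a *m X w) i ord0).
Proof.
under eq_fun do rewrite mxE.
apply: measurable_sum => j; apply: measurable_funM => //.
exact: gaussian_vector_measurable.
Qed.

Lemma integrable_gaussian_lin_sqr p (a : 'M[R]_(p, n)) i :
  P.-integrable setT (fun w => ((a *m X w) i ord0 ^+ 2)%:E).
Proof.
have [_ gl] := gX.
have [_ + _] := gaussian_variable_moments (gl (row i a)).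
by under eq_fun do rewrite -row_mul mxE.
Qed.

Lemma integrable_gaussian_linM p q (a : 'M[R]_(p, n)) (b : 'M[R]_(q, n)) i j :
  P.-integrable setT (fun w => ((a *m X w) i ord0 * (b *m X w) j ord0)%:E).
Proof.
apply: (le_integrable measurableT _ _ (integrableD measurableT
  (integrable_gaussian_lin_sqr a i) (integrable_gaussian_lin_sqr b j))).
  by apply/measurable_EFinP/measurable_funM; exact: measurable_gaussian_lin.
move=> w _ /=; rewrite lee_fin [leRHS]ger0_norm ?addr_ge0 ?sqr_ge0//.
move: (_ i ord0) (_ j ord0) => x y; rewrite ler_norml; apply/andP; split; nra.
Qed.

Lemma integrable_gaussian_lin p (a : 'M[R]_(p, n)) i :
  P.-integrable setT (fun w => ((a *m X w) i ord0)%:E).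
Proof.
apply: (le_integrable measurableT _ _ (integrableD measurableT
  (integrable_gaussian_lin_sqr a i) (finite_measure_integrable_cst P 1 measurableT))).
  by apply/measurable_EFinP; exact: measurable_gaussian_lin.
move=> w _ /=; rewrite lee_fin [leRHS]ger0_norm ?addr_ge0 ?sqr_ge0//.
move: (_ i ord0) => x; rewrite ler_norml; apply/andP; split; nra.
Qed.

Lemma integrable_gaussian_coord i : P.-integrable setT (fun w => (X w i ord0)%:E).
Proof. by have := integrable_gaussian_lin 1%:M i; under eq_fun do rewrite mul1mx. Qed.

Lemma integrable_gaussian_coordM i j :
  P.-integrable setT (fun w => (X w i ord0 * X w j ord0)%:E).
Proof.
by have := integrable_gaussian_linM 1%:M 1%:M i j; under eq_fun do rewrite !mul1mx.
Qed.

Lemma Rintegral_sum_gaussian (I : Type) (r : seq I) (F : I -> T -> R) :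
  (forall i, P.-integrable setT (fun w => (F i w)%:E)) ->
  \int[P]_w (\sum_(i <- r) F i w) = \sum_(i <- r) \int[P]_w F i w.
Proof.
move=> iF; elim: r => [|i r IH].
  under eq_Rintegral do rewrite big_nil.
  by rewrite big_nil Rintegral_cst// mul0r.
under eq_Rintegral do rewrite big_cons.
rewrite big_cons RintegralD ?IH//.
  exact: iF.
have -> : EFin \o (fun w => \sum_(i <- r) F i w) =
    (fun w => \sum_(i <- r) (F i w)%:E)%E by apply/funext => w /=; rewrite sumEFin.
exact: integrable_sum.
Qed.

Lemma zero_mean_lin p (a : 'M[R]_(p, n)) : zero_mean P (fun w => a *m X w).
Proof.
move=> i; rewrite unlock (EFin_Rintegral (integrable_gaussian_lin a i)).
under eq_Rintegral do rewrite mxE.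
rewrite Rintegral_sum_gaussian; last first.
  move=> j; under eq_fun do rewrite EFinM.
  by apply: integrableZl => //; exact: integrable_gaussian_coord.
rewrite big1// => j _; rewrite RintegralZl//; last exact: integrable_gaussian_coord.
have := X0 j; rewrite unlock (EFin_Rintegral (integrable_gaussian_coord j)).
by move=> [->]; rewrite mulr0.
Qed.

Lemma gaussian_vector_lin p (a : 'M[R]_(p, n)) :
  gaussian_vector P (fun w => a *m X w).
Proof.
split=> [i|c]; first exact: measurable_gaussian_lin.
by under eq_fun do rewrite mulmxA; have [_] := gX; exact.
Qed.

Lemma covmx_lin p q (a : 'M[R]_(p, n)) (b : 'M[R]_(q, n)) :
  covmx P (fun w => a *m X w) (fun w => b *m X w) = a *m K *m b^T.
Proof.
have iM i j (x y : R) : P.-integrable setT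
    (fun w => (x * y * (X w i ord0 * X w j ord0))%:E).
  under eq_fun do rewrite EFinM.
  by apply: integrableZl => //; exact: integrable_gaussian_coordM.
apply/matrixP => i j; rewrite covmx_Rintegral; [|exact: zero_mean_lin..].
transitivity (\int[P]_w (\sum_k \sum_l (a i l * b j k * (X w l ord0 * X w k ord0)))).
  apply: eq_Rintegral => w _; rewrite !mxE mulr_sumr; apply: eq_bigr => k _.
  by rewrite mulr_suml; apply: eq_bigr => l _; ring.
rewrite Rintegral_sum_gaussian; last first.
  move=> k; under eq_fun do rewrite -sumEFin.
  by apply: integrable_sum => // l _.
rewrite mxE; apply: eq_bigr => k _; rewrite Rintegral_sum_gaussian//.
rewrite !mxE mulr_suml; apply: eq_bigr => l _.
rewrite RintegralZl//; last exact: integrable_gaussian_coordM.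
by rewrite covmx_Rintegral//; ring.
Qed.

Lemma covmx_sym : K^T = K.
Proof. by apply/matrixP => i j; rewrite !mxE covarianceC. Qed.

Lemma Rintegral_lin_sqr (c : 'rV[R]_n) :
  \int[P]_w ((c *m X w) ord0 ord0 ^+ 2) = (c *m K *m c^T) ord0 ord0.
Proof.
rewrite -covmx_lin covmx_Rintegral; [|exact: zero_mean_lin..].
by apply: eq_Rintegral => w _; rewrite expr2.
Qed.

Lemma covmx_ge0 (c : 'rV[R]_n) : 0 <= (c *m K *m c^T) ord0 ord0.
Proof. by rewrite -Rintegral_lin_sqr; apply: Rintegral_ge0 => w _; exact: sqr_ge0. Qed.

Lemma Rintegral_cos_lin (c : 'rV[R]_n) phi :
  \int[P]_w cos ((c *m X w) ord0 ord0 + phi) =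
  cos phi * chi ((c *m K *m c^T) ord0 ord0).
Proof.
have [_ gl] := gX; have [_ _ ->] := gaussian_variable_moments (gl c).
  by rewrite Rintegral_lin_sqr.
have := zero_mean_lin c ord0; rewrite unlock.
by rewrite (EFin_Rintegral (integrable_gaussian_lin c ord0)) => -[].
Qed.

Lemma integrable_cos_lin (c : 'rV[R]_n) phi :
  P.-integrable setT (fun w => (cos ((c *m X w) ord0 ord0 + phi))%:E).
Proof.
apply: (@integrable_bounded _ _ _ P (fun w => cos ((c *m X w) ord0 ord0 + phi)) 1).
  by apply: measurable_cos_lin => i; exact: gaussian_vector_measurable.
by move=> w; rewrite ler_norml cos_geN1 cos_le1.
Qed.

(** The forms c + d and c - d both have the sum of the two variances as variance, so [chi] factors
    out of both terms of the product-to-sum formula. *)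
Lemma cos_lin_uncorrelated (c d : 'rV[R]_n) phi phi' : c *m K *m d^T = 0 ->
  \int[P]_w (cos ((c *m X w) ord0 ord0 + phi) * cos ((d *m X w) ord0 ord0 + phi')) =
  cos phi * chi ((c *m K *m c^T) ord0 ord0) *
  \int[P]_w cos ((d *m X w) ord0 ord0 + phi').
Proof.
move=> cd.
have dc : d *m K *m c^T = 0.
  by apply: trmx_inj; rewrite !trmx_mul trmxK covmx_sym mulmxA cd trmx0.
transitivity (\int[P]_w (2^-1 * (cos (((c + d) *m X w) ord0 ord0 + (phi + phi')) +
   cos (((c - d) *m X w) ord0 ord0 + (phi - phi'))))).
  apply: eq_Rintegral => w _.
  have -> : ((c + d) *m X w) ord0 ord0 + (phi + phi') =
     ((c *m X w) ord0 ord0 + phi) + ((d *m X w) ord0 ord0 + phi').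
    by rewrite mulmxDl mxE; ring.
  have -> : ((c - d) *m X w) ord0 ord0 + (phi - phi') =
     ((c *m X w) ord0 ord0 + phi) - ((d *m X w) ord0 ord0 + phi').
    by rewrite mulmxBl !mxE; ring.
  by move: (_ + phi) (_ + phi') => u v; rewrite cosB cosD; field.
have i1 := integrable_cos_lin (c + d) (phi + phi').
have i2 := integrable_cos_lin (c - d) (phi - phi').
rewrite RintegralZl//; last exact: (integrableD measurableT i1 i2).
rewrite RintegralD//.
rewrite !Rintegral_cos_lin.
have -> : (c + d) *m K *m (c + d)^T = c *m K *m c^T + d *m K *m d^T.
  by rewrite linearD /= !mulmxDl !mulmxDr cd dc addr0 add0r.
have -> : (c - d) *m K *m (c - d)^T = c *m K *m c^T + d *m K *m d^T.
  rewrite linearB /= !mulmxBl !mulmxBr cd dc subr0 sub0r opprK //.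
rewrite mxE chi_add ?covmx_ge0//.
by move: (chi _) (chi _) => x y; rewrite cosB cosD; field.
Qed.

(* Independence of a X and b X, tested on cosines of linear forms of a X. *)
Lemma cos_lin_independent p q (a : 'M[R]_(p, n)) (b : 'M[R]_(q, n))
    (c : 'rV[R]_p) phi (D : set T) : a *m K *m b^T = 0 ->
  sigma_vec (fun w => b *m X w) D ->
  (\int[P]_(w in D) (cos ((c *m a *m X w) ord0 ord0 + phi) -
     \int[P]_w cos ((c *m a *m X w) ord0 ord0 + phi))%:E = 0)%E.
Proof.
move=> ab; set E := \int[P]_w _.
have iE : P.-integrable setT (fun w => E%:E).
  exact: (finite_measure_integrable_cst P E measurableT).
apply: (@fourier_null_sigma _ _ _ P _ (fun w => b *m X w) _
    (fun w => cos ((c *m a *m X w) ord0 ord0 + phi) - E)).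
  by move=> i; exact: measurable_gaussian_lin.
split=> [|d phi'].
  under eq_fun do rewrite EFinB.
  by apply: integrableB => //; exact: integrable_cos_lin.
under eq_integral do rewrite mulmxA.
have icos := integrable_cos_lin (c *m a) phi.
have icosd := integrable_cos_lin (d *m b) phi'.
have icc : P.-integrable setT (fun w => (cos ((c *m a *m X w) ord0 ord0 + phi) *
    cos ((d *m b *m X w) ord0 ord0 + phi'))%:E).
  apply: (integrable_mul_bounded icos (C := 1)).
    by apply: measurable_cos_lin => i; exact: gaussian_vector_measurable.
  by move=> w; rewrite ler_norml cos_geN1 cos_le1.
have iEc : P.-integrable setT (fun w => (E * cos ((d *m b *m X w) ord0 ord0 + phi'))%:E).
  by under eq_fun do rewrite EFinM; exact: integrableZl.
under eq_integral do rewrite mulrBl EFinB.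
rewrite integralB_EFin// !EFin_Rintegral// RintegralZl// cos_lin_uncorrelated.
  by rewrite -Rintegral_cos_lin subee.
by rewrite trmx_mul !mulmxA -(mulmxA c) -(mulmxA c) ab mulmx0 mul0mx.
Qed.

End Moments.

End GaussianVector.

(** * Sigma-algebras generated by groups of coordinates *)

Section CoordinateSigma.
Context {disp : measure_display} {T : measurableType disp} {R : realType}.

Lemma sub_measurable_lin_gen (gen : set (set T)) (q : nat) (Y : T -> 'cV[R]_q)
    (c : 'rV[R]_q) :
  (forall i, c ord0 i != 0 -> sub_measurable <<s gen>> (fun w => Y w i ord0)) ->
  sub_measurable <<s gen>> (fun w => (c *m Y w) ord0 ord0).
Proof.
move=> mY; apply/sub_measurableP; under eq_fun do rewrite mxE.
apply: measurable_sum => i.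
have [->|ci] := eqVneq (c ord0 i) 0.
  by under eq_fun do rewrite mul0r; exact: measurable_cst.
by apply: measurable_funM; [exact: measurable_cst|apply/sub_measurableP; exact: mY].
Qed.

Lemma sub_measurable_indic (gen : set (set T)) (D : set T) : <<s gen>> D ->
  sub_measurable <<s gen>> (\1_D : T -> R).
Proof.
move=> sD; apply/sub_measurableP.
exact: (@measurable_indic _ (g_sigma_algebraType gen) R setT D sD).
Qed.

Lemma sub_measurableM (gen : set (set T)) (f g : T -> R) :
  sub_measurable <<s gen>> f -> sub_measurable <<s gen>> g ->
  sub_measurable <<s gen>> (fun w => f w * g w).
Proof.
move=> /sub_measurableP mf /sub_measurableP mg.
by apply/sub_measurableP; exact: measurable_funM.
Qed.

Lemma sub_measurableB (gen : set (set T)) (f g : T -> R) :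
  sub_measurable <<s gen>> f -> sub_measurable <<s gen>> g ->
  sub_measurable <<s gen>> (fun w => f w - g w).
Proof.
move=> /sub_measurableP mf /sub_measurableP mg.
by apply/sub_measurableP; exact: measurable_funB.
Qed.

Lemma sub_measurable_sub (F G : set (set T)) (X : T -> R) : F `<=` G ->
  sub_measurable F X -> sub_measurable G X.
Proof. by move=> FG FX B mB; exact/FG/FX. Qed.

Lemma sub_measurable_lin (q : nat) (Y : T -> 'cV[R]_q) (c : 'rV[R]_q) :
  sub_measurable (sigma_vec Y) (fun w => (c *m Y w) ord0 ord0).
Proof.
apply: sub_measurable_lin_gen => i _ B mB; apply: sub_gen_smallest.
by exists i => //; exists B => //; rewrite setTI.
Qed.

Variables (n : nat) (X : T -> 'cV[R]_n).
Implicit Types S : pred 'I_n.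

Definition sigma_coords S : set (set T) :=
  <<s \bigcup_(i in [set i | S i])
        preimage_set_system [set: T] (fun w => X w i ord0) measurable >>.

Lemma sub_measurable_coord S i : S i ->
  sub_measurable (sigma_coords S) (fun w => X w i ord0).
Proof.
move=> Si B mB; apply: sub_gen_smallest.
by exists i => //; exists B => //; rewrite setTI.
Qed.

Lemma sigma_coords_sub (gen : set (set T)) S :
  (forall i, S i -> sub_measurable <<s gen>> (fun w => X w i ord0)) ->
  sigma_coords S `<=` <<s gen>>.
Proof.
move=> SX; apply: smallest_sub; first exact: smallest_sigma_algebra.
by move=> _ [i Si [B mB <-]]; rewrite setTI; exact: SX.
Qed.

Lemma sigma_coords_measurable S :
  (forall i, measurable_fun setT (fun w => X w i ord0)) ->
  sigma_coords S `<=` measurable.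
Proof.
move=> mX; apply: smallest_sub; first exact: sigma_algebra_measurable.
by move=> _ [i Si [B mB <-]]; exact: mX.
Qed.

(** A coordinate projection kept as a square matrix, so that no matrix dimension depends on S. *)
Definition mask S : 'M[R]_n := \matrix_(i, j) ((i == j) && S i)%:R.

Lemma mask_mul S (p : nat) (A : 'M[R]_(n, p)) i j :
  (mask S *m A) i j = (S i)%:R * A i j.
Proof.
rewrite mxE (bigD1 i)//= big1 ?addr0 => [|k ki]; first by rewrite mxE eqxx.
by rewrite mxE eq_sym (negbTE ki) mul0r.
Qed.

Lemma mul_mask S (p : nat) (A : 'M[R]_(p, n)) i j :
  (A *m mask S) i j = A i j * (S j)%:R.
Proof.
rewrite mxE (bigD1 j)//= big1 ?addr0 => [|k kj]; first by rewrite mxE eqxx.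
by rewrite mxE (negbTE kj) mulr0.
Qed.

Lemma tr_mask S : (mask S)^T = mask S.
Proof.
by apply/matrixP => i j; rewrite !mxE eq_sym; case: eqVneq => // ->.
Qed.

Lemma sub_measurable_mask S (c : 'rV[R]_n) :
  sub_measurable (sigma_coords S) (fun w => (c *m mask S *m X w) ord0 ord0).
Proof.
apply: sub_measurable_lin_gen => i; rewrite mul_mask.
case: (boolP (S i)) => [Si _|_]; last by rewrite mulr0 eqxx.
exact: sub_measurable_coord.
Qed.

End CoordinateSigma.

(** * Conditional independence and regression residuals *)

Section GaussianConditioning.
Context {disp : measure_display} {T : measurableType disp} {R : realType}.
Variables (P : probability T R) (n : nat) (X : T -> 'cV[R]_n).
Hypotheses (gX : gaussian_vector P X) (X0 : zero_mean P X).
Local Notation K := (covmx P X X).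
(* The coordinates inside, at the two ends of, and outside a time interval. *)
Variables inn fix_ out : pred 'I_n.
Local Notation sI := (sigma_coords X inn).
Local Notation sF := (sigma_coords X fix_).
Local Notation sO := (sigma_coords X out).

Let mX i : measurable_fun setT (fun w => X w i ord0).
Proof. by have [mX _] := gX; exact: mX. Qed.

Let integrable_indic (A : set T) : measurable A -> P.-integrable setT (fun w => (\1_A w)%:E).
Proof.
move=> mA; apply: (@integrable_bounded _ _ _ P (\1_A) 1) => //.
by move=> w; rewrite indicE; case: (_ \in _); rewrite ?normr1 ?normr0.
Qed.

Let indic_norm (A : set T) w : `|\1_A w| <= 1 :> R.
Proof. by rewrite indicE; case: (_ \in _); rewrite ?normr1 ?normr0. Qed.

Let integral_indic_sub (A C : set T) (p : T -> R) : measurable A -> measurable C ->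
  P.-integrable setT (EFin \o p) ->
  (\int[P]_(w in C) (\1_A w - p w)%:E = P (A `&` C) - \int[P]_(w in C) (p w)%:E)%E.
Proof.
move=> mA mC ip; under eq_integral do rewrite EFinB.
rewrite integralB_EFin//; last 2 first.
- exact: integrableS (integrable_indic mA).
- exact: integrableS ip.
by rewrite integral_indic// setIC.
Qed.

(** The inner rows of V X are regression residuals. Being uncorrelated with the fixed and outer
    coordinates, V X is independent of them jointly, so it adds nothing to the fixed coordinates for
    predicting an outer event; inner coordinates are functions of V X and the fixed ones. *)
Lemma cond_independent_of_residual (V B : 'M[R]_n) :
  (forall i, inn i -> row i V = row i (1%:M - B *m mask fix_)) ->
  V *m K *m mask fix_ = 0 -> V *m K *m mask out = 0 ->
  cond_independent P sF sI sO.
Proof.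
move=> VE VF VO A Bs sA sB.
have sFT : sF `<=` measurable := sigma_coords_measurable (S := fix_) mX.
have sIT : sI `<=` measurable := sigma_coords_measurable (S := inn) mX.
have sOT : sO `<=` measurable := sigma_coords_measurable (S := out) mX.
have mA : measurable A by exact: sIT.
have mB : measurable Bs by exact: sOT.
have [pA [mpA ipA pAE] bA] := cond_prob_version_exists P sFT mA.
have [pB [mpB ipB pBE] bB] := cond_prob_version_exists P sFT mB.
have mpAT := sub_measurable_measurable sFT mpA.
have mpBT := sub_measurable_measurable sFT mpB.
have npA w : `|pA w| <= 1 by have /andP[? ?] := bA w; rewrite ger0_norm.
have npB w : `|pB w| <= 1 by have /andP[? ?] := bB w; rewrite ger0_norm.
pose h w := \1_Bs w - pB w.
have mh : measurable_fun setT h by exact: measurable_funB.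
have ih : P.-integrable setT (fun w => (h w)%:E).
  by rewrite /h; under eq_fun do rewrite EFinB; apply: integrableB => //; exact: integrable_indic.
have h0F C : sF C -> (\int[P]_(w in C) (h w)%:E = 0)%E.
  move=> FC; rewrite integral_indic_sub//; last exact: sFT.
  rewrite pBE// subee//; apply: fin_num_measure.
  by apply: measurableI => //; exact: sFT.
have bcos (c : 'rV[R]_n) phi w : `|cos ((c *m X w) ord0 ord0 + phi)| <= 1.
  by rewrite ler_norml cos_geN1 cos_le1.
have mcos (c : 'rV[R]_n) phi :
    measurable_fun setT (fun w => cos ((c *m X w) ord0 ord0 + phi)).
  exact: measurable_cos_lin.
pose WF : 'M[R]_n := mask (predU fix_ out).
have VW : V *m K *m WF^T = 0.
  rewrite tr_mask; apply/matrixP => i j; rewrite mul_mask [RHS]mxE /=.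
  have /matrixP/(_ i j) := VF; have /matrixP/(_ i j) := VO; rewrite !mul_mask !mxE.
  by case: (fix_ j); case: (out j); rewrite ?mulr1 ?mulr0//= mulr1.
have sW (S : pred 'I_n) : (forall i, S i -> fix_ i || out i) ->
    sigma_coords X S `<=` sigma_vec (fun w => WF *m X w).
  move=> SW; apply: sigma_coords_sub => i /SW Wi.
  have := sub_measurable_lin (Y := fun w => WF *m X w) (delta_mx ord0 i).
  congr (sub_measurable _ _); apply/funext => w.
  by rewrite -rowE mxE mask_mul /= Wi mul1r.
have sWT : sigma_vec (fun w => WF *m X w) `<=` measurable.
  by apply: sigma_vec_measurable => i; exact: (measurable_gaussian_lin gX).
(* Independence of V X from the fixed and outer coordinates splits off the first cosine; the rest
   vanishes because h has zero integral over fixed events. *)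
have key (c1 c2 : 'rV[R]_n) phi1 phi2 :
    (\int[P]_w (h w * (cos ((c1 *m V *m X w) ord0 ord0 + phi1) *
      cos ((c2 *m mask fix_ *m X w) ord0 ord0 + phi2)))%:E = 0)%E.
  set E := \int[P]_w cos ((c1 *m V *m X w) ord0 ord0 + phi1).
  pose g w := h w * cos ((c2 *m mask fix_ *m X w) ord0 ord0 + phi2).
  have sFc : sub_measurable sF (fun w => cos ((c2 *m mask fix_ *m X w) ord0 ord0 + phi2)).
    have mc : measurable_fun setT (@cos R).
      by apply: continuous_measurable_fun; exact: continuous_cos.
    apply/sub_measurableP; apply: (measurableT_comp mc).
    apply: measurable_funD => //; apply/sub_measurableP.
    exact: sub_measurable_mask.
  have ig : P.-integrable setT (fun w => (g w)%:E).
    exact: (integrable_mul_bounded ih (mcos _ _) (bcos _ _)).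
  have g0 : (\int[P]_w (g w)%:E = 0)%E.
    exact: (integral_mul_sub_measurable sFT sFc ih ig h0F).
  have sg : sub_measurable (sigma_vec (fun w => WF *m X w)) g.
    apply: sub_measurableM; first apply: sub_measurableB.
    - by apply: sub_measurable_indic; apply: (sW out) sB => i ->; rewrite orbT.
    - by apply: sub_measurable_sub mpB; apply: sW => i ->.
    - by apply: sub_measurable_sub sFc; apply: sW => i ->.
  have iE : P.-integrable setT (fun w => E%:E).
    exact: (finite_measure_integrable_cst P E measurableT).
  have icE : P.-integrable setT (fun w => (cos ((c1 *m V *m X w) ord0 ord0 + phi1) - E)%:E).
    by under eq_fun do rewrite EFinB; apply: integrableB => //; exact: (integrable_cos_lin gX).
  have igc : P.-integrable setT (fun w => (g w * cos ((c1 *m V *m X w) ord0 ord0 + phi1))%:E).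
    exact: (integrable_mul_bounded ig (mcos _ _) (bcos _ _)).
  have igE : P.-integrable setT (fun w => (E * g w)%:E).
    by under eq_fun do rewrite EFinM; exact: integrableZl.
  have icEg : P.-integrable setT
      (fun w => ((cos ((c1 *m V *m X w) ord0 ord0 + phi1) - E) * g w)%:E).
    have -> : (fun w => ((cos ((c1 *m V *m X w) ord0 ord0 + phi1) - E) * g w)%:E) =
      (fun w => (g w * cos ((c1 *m V *m X w) ord0 ord0 + phi1))%:E - (E * g w)%:E)%E.
      by apply/funext => w; rewrite -EFinB; congr EFin; ring.
    exact: integrableB.
  have := integral_mul_sub_measurable sWT sg icE icEg
    (fun D sD => cos_lin_independent gX X0 c1 phi1 VW sD).
  have -> : (\int[P]_w ((cos ((c1 *m V *m X w) ord0 ord0 + phi1) - E) * g w)%:E =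
     \int[P]_w ((g w * cos ((c1 *m V *m X w) ord0 ord0 + phi1))%:E - (E * g w)%:E))%E.
    by apply: eq_integral => w _; rewrite -EFinB; congr EFin; ring.
  rewrite integralB_EFin//.
  have -> : (\int[P]_w (E * g w)%:E = 0)%E.
    by under eq_integral do rewrite EFinM; rewrite integralZl// g0 mule0.
  rewrite sube0 => <-; apply: eq_integral => w _; congr EFin; rewrite /g; ring.
pose Y w := col_mx V (mask fix_) *m X w.
have mY i : measurable_fun setT (fun w => Y w i ord0) by exact: (measurable_gaussian_lin gX).
have nullh : fourier_null P Y h.
  split=> // a phi.
  have aY w : (a *m Y w) ord0 ord0 = (lsubmx a *m V *m X w) ord0 ord0 +
      (rsubmx a *m mask fix_ *m X w) ord0 ord0.
    by rewrite /Y mulmxA -{1}[a]hsubmxK mul_row_col mulmxDl mxE.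
  (* Cosine of a sum, with both sines written as cosines shifted by pi / 2. *)
  transitivity (\int[P]_w ((h w * (cos ((lsubmx a *m V *m X w) ord0 ord0 + 0) *
      cos ((rsubmx a *m mask fix_ *m X w) ord0 ord0 + phi)))%:E -
      (h w * (cos ((lsubmx a *m V *m X w) ord0 ord0 + - (pi / 2)) *
      cos ((rsubmx a *m mask fix_ *m X w) ord0 ord0 + (phi - pi / 2))))%:E))%E.
    apply: eq_integral => w _; rewrite aY -EFinB; congr EFin.
    by rewrite addr0 addrA !cosBpihalf -addrA cosD; ring.
  have icc (c1 c2 : 'rV[R]_n) phi1 phi2 : P.-integrable setT
    (fun w => (h w * (cos ((c1 *m V *m X w) ord0 ord0 + phi1) *
      cos ((c2 *m mask fix_ *m X w) ord0 ord0 + phi2)))%:E).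
    apply: (integrable_mul_bounded ih (C := 1)); first by apply: measurable_funM; exact: mcos.
    by move=> w; rewrite normrM mulr_ile1.
  have i1 := icc (lsubmx a) (rsubmx a) 0 phi.
  have i2 := icc (lsubmx a) (rsubmx a) (- (pi / 2)) (phi - pi / 2).
  by rewrite (integralB_EFin measurableT i1 i2) !key subee.
have hY D : sigma_vec Y D -> (\int[P]_(w in D) (h w)%:E = 0)%E.
  exact: (fourier_null_sigma mY nullh).
have sFY : sF `<=` sigma_vec Y.
  apply: sigma_coords_sub => i Fi.
  have := sub_measurable_lin (Y := Y) (delta_mx ord0 (rshift n i)).
  congr (sub_measurable _ _); apply/funext => w.
  by rewrite -rowE mxE /Y mul_col_mx col_mxEd mask_mul Fi mul1r.
have sIY : sI `<=` sigma_vec Y.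
  apply: sigma_coords_sub => i Ii.
  have := sub_measurable_lin (Y := Y) (row_mx (delta_mx ord0 i) (row i B)).
  congr (sub_measurable _ _); apply/funext => w.
  rewrite /Y mulmxA mul_row_col -rowE VE// -row_mul linearB /= subrK row1 -rowE mxE //.
have AC C : sF C -> (\int[P]_(w in A `&` C) (pB w)%:E = P (A `&` Bs `&` C))%E.
  move=> FC; have mC : measurable C by exact: sFT.
  have sAC : sigma_vec Y (A `&` C).
    exact: (@measurableI _ (g_sigma_algebraType _) A C (sIY _ sA) (sFY _ FC)).
  have mAC : measurable (A `&` C) by exact: measurableI.
  have := hY _ sAC; rewrite integral_indic_sub//.
  have iAC : (\int[P]_(w in A `&` C) (pB w)%:E)%E \is a fin_num.
    by apply: integrable_fin_num => //; exact: integrableS ipB.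
  have PAC : P (Bs `&` (A `&` C)) \is a fin_num.
    by apply: fin_num_measure; exact: measurableI.
  rewrite -(fineK iAC) -(fineK PAC) -EFinB => -[/subr0_eq <-].
  by rewrite fineK//; congr (P _); rewrite setICA setIA.
exists pA, pB; split=> //.
have mpApB : sub_measurable sF (fun w => pA w * pB w) by exact: sub_measurableM.
split=> //.
- by apply: (integrable_mul_bounded ipA (C := 1)).
(* On a fixed event C the indicator of A may be replaced by [pA], since [pB] times the indicator of
   C is measurable for the fixed coordinates. *)
- move=> C FC; rewrite -AC// (integral_indicr P C) (integral_indicr P (A `&` C)).
  have iAp : P.-integrable setT (fun w => (\1_A w - pA w)%:E).
    by under eq_fun do rewrite EFinB; apply: integrableB => //; exact: integrable_indic.
  have nBC w : `|pB w * \1_C w| <= 1 by rewrite normrM mulr_ile1.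
  have sBC : sub_measurable sF (fun w => pB w * \1_C w).
    by apply: sub_measurableM => //; exact: sub_measurable_indic.
  have mBC := sub_measurable_measurable sFT sBC.
  have h1 : P.-integrable setT (fun w => (\1_A w * (pB w * \1_C w))%:E).
    exact: (integrable_mul_bounded (integrable_indic mA) mBC nBC).
  have h2 : P.-integrable setT (fun w => (pA w * (pB w * \1_C w))%:E).
    exact: (integrable_mul_bounded ipA mBC nBC).
  have h3 : P.-integrable setT (fun w => ((\1_A w - pA w) * (pB w * \1_C w))%:E).
    exact: (integrable_mul_bounded iAp mBC nBC).
  have := integral_mul_sub_measurable sFT sBC iAp h3.
  under eq_integral do rewrite mulrBl EFinB.
  rewrite integralB_EFin// => /(_ _) H.
  have {}H : (\int[P]_w (\1_A w * (pB w * \1_C w))%:E =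
     \int[P]_w (pA w * (pB w * \1_C w))%:E)%E.
    have E1 := integrable_fin_num measurableT h1.
    have E2 := integrable_fin_num measurableT h2.
    rewrite -(fineK E1) -(fineK E2); congr EFin; apply/eqP; rewrite -subr_eq0.
    rewrite -eqe EFinB !fineK// H// => D sD.
    rewrite integral_indic_sub//; last exact: sFT.
    rewrite pAE// subee//; apply: fin_num_measure.
    by apply: measurableI => //; exact: sFT.
  transitivity (\int[P]_w (pA w * (pB w * \1_C w))%:E)%E.
    by apply: eq_integral => w _; rewrite mulrA.
  rewrite -H; apply: eq_integral => w _; congr EFin.
  by rewrite indicI /=; ring.
Qed.

Let integrable_u (v : 'rV[R]_n) : P.-integrable setT (fun w => ((v *m X w) ord0 ord0)%:E).
Proof. exact: integrable_gaussian_lin. Qed.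

(** The form v X is independent of C and centered. The independence is used with roles exchanged:
    the centered indicator of C is Fourier-null along v X. *)
Lemma integral_uncorrelated (v : 'rV[R]_n) (C : set T) :
  v *m K *m mask fix_ = 0 -> sF C -> (\int[P]_(w in C) ((v *m X w) ord0 ord0)%:E = 0)%E.
Proof.
move=> vF sC; have sFT : sF `<=` measurable := sigma_coords_measurable (S := fix_) mX.
have mC : measurable C by exact: sFT.
have sFW : sF `<=` sigma_vec (fun w => mask fix_ *m X w).
  apply: sigma_coords_sub => i Fi.
  have := sub_measurable_lin (Y := fun w => mask fix_ *m X w) (delta_mx ord0 i).
  congr (sub_measurable _ _); apply/funext => w.
  by rewrite -rowE mxE mask_mul Fi mul1r.
have vW : v *m K *m (mask fix_ : 'M[R]_n)^T = 0 by rewrite tr_mask.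
pose pC := fine (P C).
have PC : P C = pC%:E by rewrite fineK//; exact: fin_num_measure.
pose h w := \1_C w - pC.
have ic (r : R) : P.-integrable setT (fun w => r%:E).
  exact: (finite_measure_integrable_cst P r measurableT).
have ih : P.-integrable setT (fun w => (h w)%:E).
  by rewrite /h; under eq_fun do rewrite EFinB; apply: integrableB => //; exact: integrable_indic.
have mv i : measurable_fun setT (fun w => (v *m X w) i ord0).
  exact: (measurable_gaussian_lin gX).
have nullh : fourier_null P (fun w => v *m X w) h.
  split=> // c phi.
  have icos := integrable_cos_lin gX (c *m v) phi.
  set E := \int[P]_w cos ((c *m v *m X w) ord0 ord0 + phi).
  have H := cos_lin_independent gX X0 c phi vW (sFW _ sC).
  have i1 : P.-integrable setT (fun w => (cos ((c *m v *m X w) ord0 ord0 + phi) * \1_C w)%:E).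
    by apply: (integrable_mul_bounded icos (C := 1)) => //; exact: measurable_indic.
  have i2 : P.-integrable setT (fun w => (E * \1_C w)%:E).
    under eq_fun do rewrite EFinM.
    by apply: integrableZl => //; exact: integrable_indic.
  have i3 : P.-integrable setT (fun w => (pC * cos ((c *m v *m X w) ord0 ord0 + phi))%:E).
    by under eq_fun do rewrite EFinM; exact: integrableZl.
  have H1 : (\int[P]_w (cos ((c *m v *m X w) ord0 ord0 + phi) * \1_C w)%:E = (pC * E)%:E)%E.
    have : (\int[P]_w ((cos ((c *m v *m X w) ord0 ord0 + phi) * \1_C w)%:E -
       (E * \1_C w)%:E) = 0)%E.
      by rewrite -[RHS]H (integral_indicr P C); apply: eq_integral => w _; rewrite -EFinB mulrBl.
    have E2 : (\int[P]_w (E * \1_C w)%:E = (pC * E)%:E)%E.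
      under eq_integral do rewrite EFinM.
      rewrite integralZl//; last exact: integrable_indic.
      rewrite integral_indic// setIT.
      by transitivity (E%:E * pC%:E)%E; [congr (_ * _)%E; exact: PC|rewrite -EFinM mulrC].
    rewrite integralB_EFin// E2 EFin_Rintegral// -EFinB => -[/subr0_eq ->].
    by [].
  under eq_integral do rewrite mulmxA.
  have -> : (\int[P]_w (h w * cos ((c *m v *m X w) ord0 ord0 + phi))%:E =
     \int[P]_w ((cos ((c *m v *m X w) ord0 ord0 + phi) * \1_C w)%:E -
       (pC * cos ((c *m v *m X w) ord0 ord0 + phi))%:E))%E.
    by apply: eq_integral => w _; rewrite -EFinB /h; congr EFin; ring.
  rewrite integralB_EFin// H1.
  under [X in (_ - X)%E]eq_integral do rewrite EFinM.
  by rewrite integralZl// EFin_Rintegral// -/E -EFinM subee.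
have su : sub_measurable (sigma_vec (fun w => v *m X w)) (fun w => (v *m X w) ord0 ord0).
  have := sub_measurable_lin (Y := fun w => v *m X w) 1%:M.
  by congr (sub_measurable _ _); apply/funext => w; rewrite mul1mx.
have iu := integrable_u v.
have iu1 : P.-integrable setT (fun w => ((v *m X w) ord0 ord0 * \1_C w)%:E).
  by apply: (integrable_mul_bounded iu (C := 1)) => //; exact: measurable_indic.
have iu2 : P.-integrable setT (fun w => (pC * (v *m X w) ord0 ord0)%:E).
  by under eq_fun do rewrite EFinM; exact: integrableZl.
have E0 : (\int[P]_w ((v *m X w) ord0 ord0)%:E = 0)%E.
  by have := zero_mean_lin gX X0 v ord0; rewrite unlock.
have hE : (fun w => (h w * (v *m X w) ord0 ord0)%:E) =
    (fun w => ((v *m X w) ord0 ord0 * \1_C w)%:E - (pC * (v *m X w) ord0 ord0)%:E)%E.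
  by apply/funext => w; rewrite -EFinB /h; congr EFin; ring.
have ihu : P.-integrable setT (fun w => (h w * (v *m X w) ord0 ord0)%:E).
  by rewrite hE; exact: integrableB.
have := integral_mul_sub_measurable (sigma_vec_measurable mv) su ih ihu
  (fun D sD => fourier_null_sigma mv nullh sD).
rewrite hE integralB_EFin//.
have -> : (\int[P]_w (pC * (v *m X w) ord0 ord0)%:E = 0)%E.
  by under eq_integral do rewrite EFinM; rewrite integralZl// E0 mule0.
by rewrite sube0 (integral_indicr P C).
Qed.

(** It suffices that the residual u has zero integral over every outer event B, since then u is
    orthogonal to the outer coordinate j. *)
Lemma residual_of_cond_independent (i j : 'I_n) (f : 'rV[R]_n) :
  inn i -> out j -> cond_independent P sF sI sO ->
  (delta_mx ord0 i - f *m mask fix_) *m K *m mask fix_ = 0 ->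
  ((delta_mx ord0 i - f *m mask fix_) *m K) ord0 j = 0.
Proof.
move=> Ii Oj ci; set v := _ - _ => vF.
have sFT : sF `<=` measurable := sigma_coords_measurable (S := fix_) mX.
have sIT : sI `<=` measurable := sigma_coords_measurable (S := inn) mX.
have sOT : sO `<=` measurable := sigma_coords_measurable (S := out) mX.
pose u w := (v *m X w) ord0 ord0.
have iu : P.-integrable setT (fun w => (u w)%:E) by exact: integrable_u.
have uC C : sF C -> (\int[P]_(w in C) (u w)%:E = 0)%E by exact: integral_uncorrelated.
have uE w : u w = X w i ord0 - (f *m mask fix_ *m X w) ord0 ord0.
  by rewrite /u mulmxBl mxE [X in _ + X]mxE -rowE [X in X - _]mxE.
have sT0 : sI setT by rewrite -setC0; apply: sigma_algebraC; exact: sigma_algebra0.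
have uB B : sO B -> (\int[P]_(w in B) (u w)%:E = 0)%E.
  move=> sB; have mB := sOT _ sB.
  (* The hypothesis yields a version for B that may change with A; one is fixed here, and almost
     sure uniqueness identifies the others with it. *)
  have [_ [qB0 [_ vqB0 _]]] := ci setT B sT0 sB.
  have [qB vqB bqB] := cond_prob_version_clip sFT mB vqB0.
  have [mqB iqB qBE] := vqB.
  have mqBT := sub_measurable_measurable sFT mqB.
  have nqB w : `|qB w| <= 1 by have /andP[? ?] := bqB w; rewrite ger0_norm.
  pose h w := \1_B w - qB w.
  have mh : measurable_fun setT h by exact: measurable_funB.
  have nh w : `|h w| <= 1.
    have /andP[? ?] := bqB w; rewrite /h indicE ler_norml.
    by case: (_ \in _) => /=; apply/andP; split; lra.
  have ih : P.-integrable setT (fun w => (h w)%:E).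
    exact: (@integrable_bounded _ _ _ P h 1).
  have hF C : sF C -> (\int[P]_(w in C) (h w)%:E = 0)%E.
    move=> FC; rewrite integral_indic_sub//; last exact: sFT.
    rewrite qBE// subee//; apply: fin_num_measure.
    by apply: measurableI => //; exact: sFT.
  have hI A : sI A -> (\int[P]_(w in A) (h w)%:E = 0)%E.
    move=> sA; have mA := sIT _ sA.
    have [pA [pB [vpA vpB [mpAB ipAB pABE]]]] := ci A B sA sB.
    have [mpA ipA pAE] := vpA; have [mpB ipB pBE] := vpB.
    have mpBT := sub_measurable_measurable sFT mpB.
    rewrite integral_indic_sub//.
    have -> : (\int[P]_(w in A) (qB w)%:E = \int[P]_(w in A) (pB w)%:E)%E.
      by apply: integral_ae_eqr => //; exact: cond_prob_version_unique vqB vpB.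
    have iAp : P.-integrable setT (fun w => (\1_A w - pA w)%:E).
      by under eq_fun do rewrite EFinB; apply: integrableB => //; exact: integrable_indic.
    have i1 : P.-integrable setT (fun w => (pB w * \1_A w)%:E).
      by apply: (integrable_mul_bounded ipB (C := 1)) => //; exact: measurable_indic.
    have hE : (fun w => ((\1_A w - pA w) * pB w)%:E) =
        (fun w => (pB w * \1_A w)%:E - (pA w * pB w)%:E)%E.
      by apply/funext => w; rewrite -EFinB; congr EFin; ring.
    have i2 : P.-integrable setT (fun w => ((\1_A w - pA w) * pB w)%:E).
      by rewrite hE; exact: integrableB.
    have H : (\int[P]_w ((\1_A w - pA w) * pB w)%:E = 0)%E.
      apply: (integral_mul_sub_measurable sFT mpB iAp i2) => D sD.
      rewrite integral_indic_sub//; last exact: sFT.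
      rewrite pAE// subee//; apply: fin_num_measure.
      by apply: measurableI => //; exact: sFT.
    move: H; rewrite hE integralB_EFin//.
    have sFT0 : sF setT by rewrite -setC0; apply: sigma_algebraC; exact: sigma_algebra0.
    rewrite (pABE setT sFT0) setIT (integral_indicr P A) (setIC B A).
    have PAB : P (A `&` B) \is a fin_num by apply: fin_num_measure; exact: measurableI.
    rewrite (EFin_Rintegral i1) -(fineK PAB) -!EFinB => -[/subr0_eq ->].
    by rewrite subrr.
  have ihX : P.-integrable setT (fun w => (h w * X w i ord0)%:E).
    have := integrable_mul_bounded (integrable_gaussian_coord gX i) mh nh.
    by under eq_fun do rewrite mulrC.
  have EhX : (\int[P]_w (h w * X w i ord0)%:E = 0)%E.
    have mXi : sub_measurable sI (fun w => X w i ord0) by exact: sub_measurable_coord.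
    exact: (integral_mul_sub_measurable sIT mXi ih ihX hI).
  have sFf := sub_measurable_mask (X := X) (S := fix_) f.
  have ihf : P.-integrable setT (fun w => (h w * (f *m mask fix_ *m X w) ord0 ord0)%:E).
    have := integrable_mul_bounded (integrable_u (f *m mask fix_)) mh nh.
    by under eq_fun do rewrite mulrC.
  have Ehf : (\int[P]_w (h w * (f *m mask fix_ *m X w) ord0 ord0)%:E = 0)%E.
    exact: (integral_mul_sub_measurable sFT sFf ih ihf hF).
  have iuq : P.-integrable setT (fun w => (u w * qB w)%:E).
    exact: (integrable_mul_bounded iu mqBT nqB).
  have Euq : (\int[P]_w (u w * qB w)%:E = 0)%E.
    exact: (integral_mul_sub_measurable sFT mqB iu iuq uC).
  have iuB : P.-integrable setT (fun w => (u w * \1_B w)%:E).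
    by apply: (integrable_mul_bounded iu (C := 1)) => //; exact: measurable_indic.
  rewrite (integral_indicr P B).
  (* In this decomposition h has zero integral over inner and over fixed events, and u over fixed
     events, so each term integrates to zero. *)
  have -> : (fun w => (u w * \1_B w)%:E) = (fun w => ((h w * X w i ord0)%:E -
      (h w * (f *m mask fix_ *m X w) ord0 ord0)%:E) + (u w * qB w)%:E)%E.
    apply/funext => w; rewrite -EFinB -EFinD; congr EFin.
    by rewrite -mulrBr -uE /h; ring.
  rewrite integralD//; last exact: integrableB.
  by rewrite integralB_EFin// EhX Ehf Euq subee// add0e.
have mXj : sub_measurable sO (fun w => X w j ord0) by exact: sub_measurable_coord.
have iuX : P.-integrable setT (fun w => (u w * X w j ord0)%:E).
  have := integrable_gaussian_linM gX v 1%:M ord0 j.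
  by under eq_fun do rewrite mul1mx.
have EuX := integral_mul_sub_measurable sOT mXj iu iuX uB.
have := covmx_lin gX X0 v (1%:M : 'M[R]_n).
rewrite trmx1 mulmx1 => <-; rewrite covmx_Rintegral; [|exact: zero_mean_lin..].
under eq_Rintegral do rewrite mul1mx.
by rewrite /Rintegral EuX.
Qed.

End GaussianConditioning.

(** * Precision matrices *)

Section PositiveDefinite.
Context {R : realType}.

Lemma sum_row_sqr (n : nat) (v : 'rV[R]_n) :
  (v *m v^T) ord0 ord0 = \sum_i v ord0 i ^+ 2.
Proof. by rewrite mxE; apply: eq_bigr => i _; rewrite mxE expr2. Qed.

Lemma posdefmxP (d : nat) (A : 'M[R]_d) : posdefmx A <->
  A^T = A /\ forall v : 'rV[R]_d, v != 0 -> 0 < (v *m A *m v^T) ord0 ord0.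
Proof.
split=> -[As pA]; split=> // v v0.
- by have := pA v^T; rewrite trmxK; apply; rewrite trmx_eq0.
- by have := pA v^T; rewrite trmxK; apply; rewrite trmx_eq0.
Qed.

Lemma posdefmx_ge0 (d : nat) (A : 'M[R]_d) (v : 'rV[R]_d) : posdefmx A ->
  0 <= (v *m A *m v^T) ord0 ord0.
Proof.
move=> /posdefmxP[_ pA]; have [->|/pA/ltW//] := eqVneq v 0.
by rewrite !mul0mx mxE.
Qed.

Lemma posdefmx_unit (d : nat) (A : 'M[R]_d) : posdefmx A -> A \in unitmx.
Proof.
move=> /posdefmxP[_ pA]; rewrite unitmxE unitfE; apply/det0P => -[v v0 vA].
by have := pA _ v0; rewrite vA mul0mx mxE ltxx.
Qed.

Lemma posdefmx_congr (d n : nat) (A : 'M[R]_n) (L : 'M[R]_(d, n)) :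
  posdefmx A -> (forall v : 'rV[R]_d, v *m L = 0 -> v = 0) ->
  posdefmx (L *m A *m L^T).
Proof.
move=> /posdefmxP[As pA] L0; apply/posdefmxP; split.
  by rewrite !trmx_mul trmxK As mulmxA.
move=> v v0; have vL : v *m L != 0 by apply: contra_neq v0 => /L0.
by have := pA _ vL; rewrite trmx_mul !mulmxA.
Qed.

Lemma posdefmx_inv (d : nat) (A : 'M[R]_d) : posdefmx A -> posdefmx (invmx A).
Proof.
move=> pA; have uA := posdefmx_unit pA; have [As _] := pA.
have -> : invmx A = invmx A *m A *m (invmx A)^T.
  by rewrite trmx_inv As -mulmxA mulmxV// mulmx1.
apply: posdefmx_congr => // v vA.
by rewrite -[v](mulmxKV uA) vA mul0mx.
Qed.

Lemma posdefmxD (d : nat) (A B : 'M[R]_d) : posdefmx A -> B^T = B ->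
  (forall v : 'rV[R]_d, 0 <= (v *m B *m v^T) ord0 ord0) -> posdefmx (A + B).
Proof.
move=> /posdefmxP[As pA] Bs pB; apply/posdefmxP; split; first by rewrite linearD /= As Bs.
by move=> v v0; rewrite mulmxDr mulmxDl mxE ltr_pwDl// pA.
Qed.

Lemma congr_ge0 (d n : nat) (A : 'M[R]_n) (L : 'M[R]_(d, n)) (v : 'rV[R]_d) :
  posdefmx A -> 0 <= (v *m (L *m A *m L^T) *m v^T) ord0 ord0.
Proof. by move=> pA; have := posdefmx_ge0 (v *m L) pA; rewrite trmx_mul !mulmxA. Qed.

Lemma posdefmx_of_unit (n : nat) (A : 'M[R]_n) : A^T = A -> A \in unitmx ->
  (forall v : 'rV[R]_n, 0 <= (v *m A *m v^T) ord0 ord0) -> posdefmx A.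
Proof.
move=> As uA pA; apply/posdefmxP; split=> // v v0.
rewrite lt_neqAle pA andbT; apply: contra_neq v0 => /esym vAv.
suff vA : v *m A = 0 by rewrite -[v](mulmxK uA) vA mul0mx.
(* Cauchy-Schwarz: 0 <= Q(v - t w) for all t forces v A w^T = 0. *)
have vAw (w : 'rV[R]_n) : (v *m A *m w^T) ord0 ord0 = 0.
  set b := (v *m A *m w^T) ord0 ord0; set c := (w *m A *m w^T) ord0 ord0.
  have wAv : (w *m A *m v^T) ord0 ord0 = b.
    have -> : w *m A *m v^T = (v *m A *m w^T)^T by rewrite !trmx_mul trmxK As mulmxA.
    by rewrite mxE.
  have Q t : 0 <= (2 * b) * t + c * t ^+ 2.
    have E (M1 M2 M3 M4 : 'M[R]_1) : (M1 + t *: M2 + (t *: M3 + t *: (t *: M4))) ord0 ord0 =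
        M1 ord0 ord0 + t * M2 ord0 ord0 + (t * M3 ord0 ord0 + t * (t * M4 ord0 ord0)).
      by rewrite !mxE.
    have := pA (v + t *: w).
    rewrite linearD /= linearZ /= !mulmxDl !mulmxDr -!scalemxAl -!scalemxAr.
    by rewrite E -/b -/c wAv vAv; congr (0 <= _); ring.
  have c0 : 0 <= c by exact: pA.
  have [->//|b0] := eqVneq b 0.
  (* The minimizer - b / c is modified to c + 1, which cannot vanish. *)
  have := Q (- b / (c + 1)).
  have c1 : 0 < c + 1 by lra.
  have -> : 2 * b * (- b / (c + 1)) + c * (- b / (c + 1)) ^+ 2 =
    - (b ^+ 2 * (c + 2) / (c + 1) ^+ 2) by field; rewrite gt_eqF.
  rewrite oppr_ge0 leNgt divr_gt0// ?exprn_gt0// mulr_gt0 ?exprn_even_gt0//; lra.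
apply/rowP => i; have := vAw (delta_mx ord0 i).
by rewrite trmx_delta -colE !mxE.
Qed.

End PositiveDefinite.

(** * Vanishing precision blocks and uncorrelated residuals *)

Section Masks.
Context {R : realType} {n : nat}.
Implicit Types S : pred 'I_n.

Lemma mask_idem S : mask S *m mask S = mask S :> 'M[R]_n.
Proof.
apply/matrixP => i j; rewrite mask_mul !mxE; case: eqVneq => [_|_] /=; last by rewrite mulr0.
by rewrite -natrM mulnb andbb.
Qed.

Lemma mask_disj S S' : (forall i, S i -> ~~ S' i) -> mask S *m mask S' = 0 :> 'M[R]_n.
Proof.
move=> SS'; apply/matrixP => i j; rewrite mask_mul !mxE.
case: eqVneq => [_|_] /=; last by rewrite mulr0.
by case: (boolP (S i)) => [/SS'/negbTE ->|_]; rewrite ?mulr0 ?mul0r.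
Qed.

(** Completing by the identity off S gives a full-size substitute for inverting the block of C on S.
    A left kernel vector annihilates both nonnegative forms, hence vanishes on S and off S. *)
Lemma mask_completion_unit (C : 'M[R]_n) S :
  (forall v : 'rV[R]_n, 0 <= (v *m C *m v^T) ord0 ord0) ->
  (forall v : 'rV[R]_n, (v *m C *m v^T) ord0 ord0 = 0 -> v *m mask S = 0) ->
  C + (1%:M - mask S) \in unitmx.
Proof.
move=> C0 CS; rewrite unitmxE unitfE; apply/det0P => -[v v0 vW].
have vMv : (v *m (1%:M - mask S) *m v^T) ord0 ord0 = \sum_i (~~ S i)%:R * v ord0 i ^+ 2.
  rewrite mxE; apply: eq_bigr => i _; rewrite mulmxBr mulmx1 !mxE.
  have := mul_mask S v ord0 i; rewrite mxE => ->.
  by case: (S i) => /=; ring.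
have sum0 : (v *m C *m v^T) ord0 ord0 + (v *m (1%:M - mask S) *m v^T) ord0 ord0 = 0.
  transitivity ((v *m C *m v^T + v *m (1%:M - mask S) *m v^T) ord0 ord0).
    by rewrite [RHS]mxE.
  by rewrite -mulmxDl -mulmxDr vW mul0mx mxE.
have vM0 : 0 <= (v *m (1%:M - mask S) *m v^T) ord0 ord0.
  by rewrite vMv; apply: sumr_ge0 => i _; rewrite mulr_ge0// ?sqr_ge0.
have vC : (v *m C *m v^T) ord0 ord0 = 0.
  by apply/eqP; rewrite eq_le C0 andbT -sum0 lerDl.
have vS := CS _ vC.
have vM : (v *m (1%:M - mask S) *m v^T) ord0 ord0 = 0 by rewrite vC add0r in sum0.
move: vM; rewrite mulmxBr mulmx1 vS subr0 sum_row_sqr => /eqP.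
rewrite psumr_eq0; last by move=> i _; exact: sqr_ge0.
move=> /allP v2; move/eqP: v0; apply; apply/rowP => i; rewrite mxE.
by have := v2 i (mem_index_enum i); rewrite /= sqrf_eq0 => /eqP.
Qed.

Variable K : 'M[R]_n.
Hypothesis pK : posdefmx K.
Variables inn fix_ out : pred 'I_n.
Hypothesis part1 : forall i, inn i -> ~~ fix_ i /\ ~~ out i.
Hypothesis part2 : forall i, fix_ i -> ~~ out i.
Hypothesis part3 : forall i, [|| inn i, fix_ i | out i].
Local Notation Mi := (mask inn : 'M[R]_n).
Local Notation Mf := (mask fix_ : 'M[R]_n).
Local Notation Mo := (mask out : 'M[R]_n).

Let if0 : Mi *m Mf = 0. Proof. by apply: mask_disj => i /part1[]. Qed.
Let io0 : Mi *m Mo = 0. Proof. by apply: mask_disj => i /part1[]. Qed.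
Let fo0 : Mf *m Mo = 0. Proof. exact: mask_disj. Qed.
Let fi0 : Mf *m Mi = 0.
Proof. by apply: mask_disj => i Fi; apply: contraTN Fi => /part1[]. Qed.

Let mask_sum : Mi + Mf + Mo = 1%:M.
Proof.
apply/matrixP => i j; rewrite !mxE; case: eqVneq => [_|_] /=; last by rewrite !addr0.
have := part3 i.
case: (boolP (inn i)) => [/part1[/negbTE -> /negbTE ->]|_] /=; first by rewrite !addr0.
by case: (boolP (fix_ i)) => [/part2/negbTE -> _|_ /= ->] /=; rewrite ?addr0 ?add0r.
Qed.

(** With V the residual operator and Nn = V K V', the correlations of the residual give V = Nn K^-1.
    The outer columns of V are zero and Nn is invertible on the inner block, so the inner-outer
    block of K^-1 is zero. *)
Lemma precision_zero_of_residual :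
  (forall (i j : 'I_n) (f : 'rV[R]_n), inn i -> out j ->
    (delta_mx ord0 i - f *m Mf) *m K *m Mf = 0 ->
    ((delta_mx ord0 i - f *m Mf) *m K) ord0 j = 0) ->
  forall i j, inn i -> out j -> invmx K i j = 0.
Proof.
move=> res.
have uK := posdefmx_unit pK.
have [/eqP Ks _] := pK.
pose W := Mf *m K *m Mf + (1%:M - Mf).
have uW : W \in unitmx.
  apply: mask_completion_unit => v.
    by have := congr_ge0 Mf v pK; rewrite tr_mask.
  have /posdefmxP[_ pK'] := pK.
  have h := pK' (v *m Mf); rewrite trmx_mul tr_mask !mulmxA in h => vK; rewrite !mulmxA in vK.
  by apply/eqP; apply: contraT => /h; rewrite vK ltxx.
pose B := K *m Mf *m invmx W.
(* The normal equations for regression on the fixed coordinates. *)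
have BK : B *m Mf *m K *m Mf = K *m Mf.
  have WMf : W *m Mf = Mf *m K *m Mf.
    by rewrite mulmxDl mulmxBl mul1mx mask_idem subrr addr0 -mulmxA mask_idem.
  by rewrite -!mulmxA (mulmxA Mf K) -WMf /B !mulmxA mulmxKV// -mulmxA mask_idem.
pose V := Mi *m (1%:M - B *m Mf).
have VF : V *m K *m Mf = 0.
  by rewrite /V -(mulmxA Mi) -(mulmxA Mi) !mulmxBl mul1mx BK subrr mulmx0.
have VO : V *m K *m Mo = 0.
  apply/matrixP => i j; rewrite mul_mask [RHS]mxE.
  case: (boolP (out j)) => [Oj|_]; last by rewrite mulr0.
  rewrite mulr1 -mulmxA mask_mul; case: (boolP (inn i)) => [Ii|_]; last by rewrite mul0r.
  have rowE' : row i (1%:M - B *m Mf) = delta_mx ord0 i - row i B *m Mf.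
    by rewrite linearB /= row1 row_mul.
  have := res i j (row i B) Ii Oj; rewrite -rowE' -!row_mul => h.
  rewrite mul1r; have := h _; rewrite mxE; apply.
  by rewrite !mulmxBl mul1mx BK subrr; apply/rowP => k; rewrite !mxE.
have VMo : V *m Mo = 0 by rewrite /V -mulmxA mulmxBl mul1mx -mulmxA fo0 mulmx0 subr0.
have VMi : V *m Mi = Mi by rewrite /V -mulmxA mulmxBl mul1mx -mulmxA fi0 mulmx0 subr0 mask_idem.
have VT : V^T = (1%:M - Mf *m B^T) *m Mi.
  by rewrite /V trmx_mul tr_mask linearB /= trmx1 trmx_mul tr_mask.
pose Nn := V *m K *m V^T.
have NE : Nn = V *m K *m Mi.
  by rewrite /Nn VT mulmxA mulmxBr mulmx1 (mulmxA (V *m K)) VF mul0mx subr0.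
have VE : V = Nn *m invmx K.
  rewrite NE; have : V *m K = V *m K *m Mi.
    by rewrite -[LHS]mulmx1 -mask_sum !mulmxDr VF VO !addr0.
  by move=> <-; rewrite mulmxK.
have uN : Nn + (1%:M - Mi) \in unitmx.
  apply: mask_completion_unit => v; first exact: congr_ge0.
  have /posdefmxP[_ pK'] := pK.
  have vNE : v *m V *m K *m (v *m V)^T = v *m Nn *m v^T.
    by rewrite /Nn trmx_mul !mulmxA.
  move=> vN; have vV : v *m V = 0.
    by apply/eqP; apply: contraT => /pK'; rewrite vNE vN ltxx.
  by rewrite -VMi mulmxA vV mul0mx.
have NMi : Nn *m Mi = Nn by rewrite NE -mulmxA mask_idem.
have : (Nn + (1%:M - Mi)) *m (Mi *m invmx K *m Mo) = 0.
  rewrite mulmxDl !mulmxA NMi -VE VMo add0r mulmxBl mul1mx mask_idem subrr.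
  by rewrite !mul0mx.
move=> /(congr1 (mulmx (invmx (Nn + (1%:M - Mi))))).
rewrite mulKmx// mulmx0 => /matrixP z i j Ii Oj.
by have := z i j; rewrite mul_mask mask_mul Ii Oj mul1r mulr1 [RHS]mxE.
Qed.

(** V consists of the inner rows of K^-1, normalized by the inverse of their inner block. Its outer
    columns vanish by hypothesis, and V K is supported on the inner columns. *)
Lemma residual_of_precision_zero :
  (forall i j, inn i -> out j -> invmx K i j = 0) ->
  exists V B : 'M[R]_n,
    [/\ forall i, inn i -> row i V = row i (1%:M - B *m Mf),
        V *m K *m Mf = 0 & V *m K *m Mo = 0].
Proof.
move=> z; set A := invmx K.
have uK := posdefmx_unit pK; have pA : posdefmx A := posdefmx_inv pK.
pose W := Mi *m A *m Mi + (1%:M - Mi).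
have uW : W \in unitmx.
  apply: mask_completion_unit => v.
    by have := congr_ge0 Mi v pA; rewrite tr_mask.
  have /posdefmxP[_ pA'] := pA.
  have h := pA' (v *m Mi); rewrite trmx_mul tr_mask !mulmxA in h => vK; rewrite !mulmxA in vK.
  by apply/eqP; apply: contraT => /h; rewrite vK ltxx.
have MAo : Mi *m A *m Mo = 0.
  apply/matrixP => i j; rewrite mul_mask mask_mul [RHS]mxE.
  case: (boolP (inn i)) => Ii; last by rewrite !mul0r.
  case: (boolP (out j)) => Oj; last by rewrite mulr0.
  by rewrite z// mulr0 mul0r.
have WMi : W *m Mi = Mi *m A *m Mi.
  by rewrite mulmxDl mulmxBl mul1mx mask_idem subrr addr0 -mulmxA mask_idem.
pose V := invmx W *m Mi *m A.
pose B := - (invmx W *m Mi *m A *m Mf).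
have VK : V *m K = invmx W *m Mi by rewrite /V mulmxKV.
have VE : V = Mi - B *m Mf.
  have -> : B *m Mf = - (V *m Mf) by rewrite /B mulNmx -(mulmxA _ Mf) mask_idem.
  have VMi : V *m Mi = Mi.
    by rewrite /V -(mulmxA (invmx W)) -(mulmxA (invmx W)) -WMi mulKmx.
  have VMo : V *m Mo = 0.
    by rewrite /V -(mulmxA (invmx W)) -(mulmxA (invmx W)) MAo mulmx0.
  by rewrite opprK -{1}[V]mulmx1 -mask_sum !mulmxDr VMi VMo addr0.
exists V, B; split.
- by move=> i Ii; rewrite VE !linearB /=; congr (_ - _); apply/rowP => j; rewrite !mxE Ii andbT.
- by rewrite VK -mulmxA if0 mulmx0.
- by rewrite VK -mulmxA io0 mulmx0.
Qed.

End Masks.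

(** * The parameters of the model *)

Section MarkovParameterIdentities.
Context {R : realType} {d : nat}.
Variables (N : nat) (Mt M : nat -> 'M[R]_d).
Hypothesis pM : forall k, (1 <= k <= N)%N -> posdefmx (M k).
Local Notation Pk := (MNcond N Mt).
Local Notation Ck := (CNcond N Mt M).

Lemma MNcond_last : Pk N = 1%:M.
Proof. by rewrite /MNcond subnn big_geq. Qed.

Lemma MNcond_step k : (k < N)%N -> Pk k = Pk k.+1 *m Mt k.+1.
Proof.
move=> kN; rewrite /MNcond -(subnSK kN) big_nat_recr//=.
by rewrite subKn.
Qed.

Lemma CNcond_step k : (k < N)%N ->
  Ck k = Ck k.+1 + Pk k.+1 *m M k.+1 *m (Pk k.+1)^T.
Proof. by move=> kN; rewrite /CNcond big_ltn// addrC. Qed.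

Lemma CNcond_pred_last k : k.+1 = N -> Ck k = M N.
Proof.
move=> kN; rewrite CNcond_step -?kN// {1}/CNcond big_geq// add0r -?kN.
by rewrite kN MNcond_last mul1mx trmx1 mulmx1.
Qed.

Lemma CNcond_posdef k : (k < N)%N -> posdefmx (Ck k).
Proof.
move=> kN; have [i iE] : exists i, (k + i).+1 = N by exists (N - k.+1)%N; lia.
elim: i k kN iE => [|i IH] k kN iE.
  by rewrite (@CNcond_pred_last k)//; [apply: pM; lia|lia].
rewrite CNcond_step//; have pM' : posdefmx (M k.+1) by apply: pM; lia.
apply: posdefmxD; first by apply: IH; lia.
- by have [Ms _] := pM'; rewrite !trmx_mul trmxK Ms mulmxA.
- by move=> v; exact: congr_ge0.
Qed.

Local Notation S k := (invmx (M k)).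

Definition Ginv k : 'M[R]_d := S k + (Pk k)^T *m invmx (Ck k) *m Pk k.

Lemma Ginv_posdef k : (1 <= k < N)%N -> posdefmx (Ginv k).
Proof.
move=> kN; have pC : posdefmx (invmx (Ck k)) by apply/posdefmx_inv/CNcond_posdef; lia.
have pS : posdefmx (S k) by apply/posdefmx_inv/pM; lia.
apply: posdefmxD => //.
- by have [Cs _] := pC; rewrite !trmx_mul trmxK Cs mulmxA.
- by move=> v; have := congr_ge0 (Pk k)^T v pC; rewrite trmxK.
Qed.

Variables Gp GN G : nat -> 'M[R]_d.
Hypothesis GpE : forall k, (1 <= k < N)%N -> Gp k = Mt k - GN k *m Pk k.-1.
Hypothesis GNE : forall k, (1 <= k < N)%N -> GN k = G k *m (Pk k)^T *m invmx (Ck k).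
Hypothesis GE : forall k, (1 <= k < N)%N -> G k = invmx (Ginv k).

Lemma invG k : (1 <= k < N)%N -> invmx (G k) = Ginv k.
Proof. by move=> kN; rewrite GE// invmxK. Qed.

Lemma Ginv_G k : (1 <= k < N)%N -> Ginv k *m G k = 1%:M.
Proof. by move=> kN; rewrite GE// mulmxV// posdefmx_unit//; exact: Ginv_posdef. Qed.

Lemma G_Ginv k : (1 <= k < N)%N -> G k *m Ginv k = 1%:M.
Proof. by move=> kN; rewrite GE// mulVmx// posdefmx_unit//; exact: Ginv_posdef. Qed.

Lemma Ginv_GN k : (1 <= k < N)%N -> Ginv k *m GN k = (Pk k)^T *m invmx (Ck k).
Proof. by move=> kN; rewrite GNE// !mulmxA Ginv_G// mul1mx. Qed.

(** The rank correction in [Ginv] cancels against the one in [Gp], because M_{N|k-1} = M_{N|k}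
    M_{k,k-1}. *)
Lemma Ginv_Gp k : (1 <= k < N)%N -> Ginv k *m Gp k = S k *m Mt k.
Proof.
move=> kN; rewrite GpE// mulmxBr mulmxA Ginv_GN// (@MNcond_step k.-1); last lia.
rewrite prednK; last lia.
by rewrite mulmxA -mulmxBl /Ginv addrK.
Qed.

Lemma tr_Gp_Ginv k : (1 <= k < N)%N -> (Gp k)^T *m Ginv k = (Mt k)^T *m S k.
Proof.
move=> kN; have [Gs _] := Ginv_posdef kN.
have [Ss _] : posdefmx (S k) by apply/posdefmx_inv/pM; lia.
by rewrite -{1}Gs -trmx_mul Ginv_Gp// trmx_mul Ss.
Qed.

(* Push-through identity: (S + P' C^-1 P) S^-1 P' = P' C^-1 (C + P S^-1 P'). *)
Lemma SG_push k : (k.+1 < N)%N ->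
  S k.+1 *m G k.+1 *m (Pk k.+1)^T *m invmx (Ck k.+1) = (Pk k.+1)^T *m invmx (Ck k).
Proof.
move=> kN; have uM : M k.+1 \in unitmx by apply/posdefmx_unit/pM; lia.
have uC : Ck k.+1 \in unitmx by apply/posdefmx_unit/CNcond_posdef; lia.
have uC' : Ck k \in unitmx by apply/posdefmx_unit/CNcond_posdef; lia.
have push : Ginv k.+1 *m M k.+1 *m (Pk k.+1)^T = (Pk k.+1)^T *m invmx (Ck k.+1) *m Ck k.
  rewrite (@CNcond_step k); last lia.
  rewrite mulmxDr mulmxKV// /Ginv !mulmxDl mulVmx// mul1mx.
  by rewrite !mulmxA.
have push' : S k.+1 *m G k.+1 *m (Pk k.+1)^T *m invmx (Ck k.+1) *m Ck k = (Pk k.+1)^T.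
  rewrite -(mulmxA _ _ (Ck k)) -(mulmxA _ (Pk k.+1)^T) (mulmxA (Pk k.+1)^T) -push.
  by rewrite !mulmxA -(mulmxA (S k.+1)) G_Ginv ?mulmx1 ?mulVmx ?mul1mx//; lia.
by rewrite -[LHS](mulmxK uC') push'.
Qed.

(** Transported by M_{N|k} = M_{N|k+1} M_{k+1,k}, this is the push-through identity [SG_push]. *)
Lemma GN_step k : (1 <= k)%N -> (k.+1 < N)%N ->
  Ginv k *m GN k = (Gp k.+1)^T *m Ginv k.+1 *m GN k.+1.
Proof.
move=> k1 kN; rewrite Ginv_GN; last lia.
rewrite tr_Gp_Ginv; last lia.
rewrite GNE; last lia.
rewrite (@MNcond_step k); last lia.
by rewrite trmx_mul -(mulmxA (Mt k.+1)^T (Pk k.+1)^T) -SG_push// !mulmxA.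
Qed.

(** Both sides are the diagonal block k of the precision matrix, computed from the model and from
    the Markov parameters. *)
Lemma Gp_step k : (1 <= k)%N -> (k.+1 < N)%N ->
  Ginv k + (Gp k.+1)^T *m Ginv k.+1 *m Gp k.+1 =
  S k + (Mt k.+1)^T *m S k.+1 *m Mt k.+1.
Proof.
move=> k1 kN; rewrite tr_Gp_Ginv; last lia.
have -> : Gp k.+1 = G k.+1 *m S k.+1 *m Mt k.+1.
  by rewrite -[LHS]mul1mx -(@G_Ginv k.+1) -?mulmxA ?Ginv_Gp//; lia.
rewrite {1}/Ginv (@MNcond_step k); last lia.
rewrite trmx_mul -(mulmxA (Mt k.+1)^T (Pk k.+1)^T) -SG_push// -addrA; congr (_ + _).
rewrite -!mulmxA -mulmxDr; congr (_ *m _); rewrite !mulmxA -mulmxDl; congr (_ *m _).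
have -> : S k.+1 *m G k.+1 *m (Pk k.+1)^T *m invmx (Ck k.+1) *m Pk k.+1 =
    S k.+1 *m G k.+1 *m ((Pk k.+1)^T *m invmx (Ck k.+1) *m Pk k.+1) by rewrite !mulmxA.
by rewrite -mulmxDr addrC -/(Ginv _) -mulmxA G_Ginv ?mulmx1//; lia.
Qed.

Lemma Ginv_pred_last k : (1 <= k)%N -> k.+1 = N ->
  Ginv k = S k + (Mt N)^T *m S N *m Mt N.
Proof.
move=> k1 kN; rewrite /Ginv CNcond_pred_last// MNcond_step -?kN//.
by rewrite kN MNcond_last mul1mx.
Qed.

(** At k = N - 1 the coupling to x_N is that of neighbours, and it remains in the precision
    matrix. *)
Lemma GN_pred_last k : (1 <= k)%N -> k.+1 = N ->
  Ginv k *m GN k = (Mt N)^T *m S N.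
Proof.
move=> k1 kN; rewrite Ginv_GN; last lia.
by rewrite CNcond_pred_last// MNcond_step -?kN// kN MNcond_last mul1mx.
Qed.

End MarkovParameterIdentities.

(** * Cyclic block tridiagonal precision matrices *)

Section CyclicTridiagonal.
Context {R : realType} {N d n : nat}.
Variables (E : nat -> 'M[R]_(d, n)) (K : 'M[R]_n).
Hypothesis EE : forall j k, (j <= N)%N -> (k <= N)%N ->
  E j *m (E k)^T = (j == k)%:R%:M.
Hypothesis EC : \sum_(k < N.+1) (E k)^T *m E k = 1%:M.
Hypothesis pK : posdefmx K.
Local Notation A := (invmx K).

Lemma block_ext (a b : 'M[R]_(d, n)) :
  (forall j, (j <= N)%N -> a *m (E j)^T = b *m (E j)^T) -> a = b.
Proof.
move=> ab; rewrite -[a]mulmx1 -[b]mulmx1 -EC !mulmx_sumr.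
by apply: eq_bigr => j _; rewrite !mulmxA ab// -ltnS.
Qed.

Lemma block_sum (a : 'M[R]_(d, n)) : a = \sum_(k < N.+1) (a *m (E k)^T) *m E k.
Proof. by rewrite -{1}[a]mulmx1 -EC mulmx_sumr; apply: eq_bigr => k _; rewrite mulmxA. Qed.

(* The rows 0 and N of the precision matrix are not constrained: the corner block *)
(* (0, N) makes the band cyclic.                                                  *)
Definition cyclic_tridiagonal := forall k j, (0 < k < N)%N -> (j <= N)%N ->
  j != k -> j.+1 != k -> j != k.+1 -> E k *m A *m (E j)^T = 0.

(** The rows expressing e_k linearly through the stacked vector when the dynamic equation holds. *)
Definition model_row (Gp GN : nat -> 'M[R]_d) k :=
  E k - Gp k *m E k.-1 - GN k *m E N.

(** The normalized residual r_k = G_k^-1 L_k is uncorrelated with the blocks before k and with block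
    N, and its correlation with block k is the identity. Beyond k its correlations are those of
    G_{k+1,k}' r_{k+1}, so the difference of the two times K is E_k, and it is the row k of the
    precision matrix. *)
Lemma tridiagonal_of_model (Gp GN G : nat -> 'M[R]_d) :
  let L := model_row Gp GN in
  (forall k, (0 < k < N)%N -> [/\ L k *m K *m (E 0)^T = 0,
      L k *m K *m (E N)^T = 0, L k *m K *m (L k)^T = G k & G k \in unitmx]) ->
  (forall j k, (0 < j)%N -> (j < k < N)%N -> L k *m K *m (L j)^T = 0) ->
  (forall j k, (0 < j)%N -> (j < k < N)%N -> L j *m K *m (L k)^T = 0) ->
  (forall k, (0 < k)%N -> (k.+1 < N)%N ->
    invmx (G k) *m GN k = (Gp k.+1)^T *m invmx (G k.+1) *m GN k.+1) ->
  cyclic_tridiagonal.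
Proof.
move=> L HL Lkj Ljk GNs.
have uK := posdefmx_unit pK.
have Etr j (a : 'M[R]_(d, n)) : (0 < j < N)%N -> a *m K *m (E j)^T =
    a *m K *m (L j)^T + a *m K *m (E j.-1)^T *m (Gp j)^T + a *m K *m (E N)^T *m (GN j)^T.
  move=> jN; have {1}-> : E j = L j + Gp j *m E j.-1 + GN j *m E N.
    by rewrite /L /model_row addrAC !subrK.
  have D (x y : 'M[R]_(d, n)) : (x + y)^T = x^T + y^T by exact: linearD.
  by rewrite !D !mulmxDr !trmx_mul !mulmxA.
have LE0 k j : (0 < k < N)%N -> (j < k)%N -> L k *m K *m (E j)^T = 0.
  move=> kN; elim: j => [|j IH] jk; first by have [] := HL k kN.
  rewrite Etr; last lia.
  rewrite /= IH; last lia.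
  by have [_ -> _ _] := HL k kN; rewrite !mul0mx !addr0 Lkj//; lia.
have LEk k : (0 < k < N)%N -> L k *m K *m (E k)^T = G k.
  move=> kN; rewrite Etr// LE0//; last lia.
  by have [_ -> -> _] := HL k kN; rewrite !mul0mx !addr0.
have LEs k j : (0 < k)%N -> (k < j < N)%N ->
    L k *m K *m (E j)^T = L k *m K *m (E j.-1)^T *m (Gp j)^T.
  move=> k0 kjN; rewrite Etr; last lia.
  rewrite Ljk//; have [_ -> _ _] := HL k ltac:(lia).
  by rewrite mul0mx addr0 add0r.
pose r k := invmx (G k) *m L k.
have rE0 k j : (0 < k < N)%N -> (j < k)%N -> r k *m K *m (E j)^T = 0.
  by move=> kN jk; rewrite /r -!mulmxA (mulmxA (L k)) LE0// mulmx0.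
have rEN k : (0 < k < N)%N -> r k *m K *m (E N)^T = 0.
  by move=> kN; rewrite /r -!mulmxA (mulmxA (L k)); have [_ -> _ _] := HL k kN; rewrite mulmx0.
have rEk k : (0 < k < N)%N -> r k *m K *m (E k)^T = 1%:M.
  move=> kN; rewrite /r -!mulmxA (mulmxA (L k)) LEk//.
  by have [_ _ _ uG] := HL k kN; rewrite mulVmx.
have rEs k j : (0 < k)%N -> (k < j < N)%N ->
    r k *m K *m (E j)^T = r k *m K *m (E j.-1)^T *m (Gp j)^T.
  by move=> k0 kjN; rewrite /r -!mulmxA !(mulmxA (L k)) LEs// !mulmxA.
(* Both sides satisfy the recursion [rEs] in j and equal G_{k+1,k}' at j = k + 1. *)
have rE k j : (0 < k)%N -> (k < j < N)%N ->
    r k *m K *m (E j)^T = (Gp k.+1)^T *m (r k.+1 *m K *m (E j)^T).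
  move=> k0; elim: j => [|j IH] kjN; first lia.
  rewrite rEs//=; have [jk|jk] := eqVneq j k.
    by rewrite jk rEk ?mul1mx ?rEk ?mulmx1//; lia.
  by rewrite IH ?(@rEs k.+1 j.+1) ?mulmxA//=; lia.
(* b k is the k-th row of invmx K; in it, GNs cancels the block (k, N). *)
pose b k := if k.+1 == N then r k else r k - (Gp k.+1)^T *m r k.+1.
have bE k : (0 < k < N)%N -> b k = E k *m A.
  move=> kN; apply: (can_inj (mulmxK uK)); rewrite mulmxKV//.
  apply: block_ext => j jN; rewrite EE//; last lia.
  have rj : r k *m K *m (E j)^T = if j == k then 1%:M else
      if (k < j < N)%N then (Gp k.+1)^T *m (r k.+1 *m K *m (E j)^T) else 0.
    case: eqVneq => [->|jk]; first exact: rEk.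
    case: ifP => [kj|/negbT kj]; first by apply: rE => //; lia.
    have [->|jN'] := eqVneq j N; first exact: rEN.
    by apply: rE0 => //; lia.
  rewrite /b; case: eqVneq => [kN1|kN1].
    rewrite rj eq_sym; case: eqVneq => // jk; rewrite ifF; last lia.
    by rewrite (_ : 0%:R%:M = 0)// -scalemx1 scale0r.
  rewrite !mulmxBl rj -!(mulmxA (Gp k.+1)^T) eq_sym.
  case: eqVneq => [<-|jk]; first by rewrite rE0 ?mulmx0 ?subr0//; lia.
  rewrite (_ : 0%:R%:M = 0); last by rewrite -scalemx1 scale0r.
  case: ifP => [kj|/negbT kj]; first by rewrite subrr.
  have [->|jN'] := eqVneq j N; first by rewrite rEN ?mulmx0 ?subr0//; lia.
  by rewrite rE0 ?mulmx0 ?subr0//; lia.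
have EE0 j k : (j <= N)%N -> (k <= N)%N -> j != k -> E j *m (E k)^T = 0.
  by move=> jN kN jk; rewrite EE// (negbTE jk) -scalemx1 scale0r.
(* Away from k - 1 and k the row L_k only meets the column N. *)
have LEj k j : (0 < k < N)%N -> (j <= N)%N -> j != k -> j.+1 != k ->
    L k *m (E j)^T = if j == N then - GN k else 0.
  move=> kN jN jk jk1; rewrite /L /model_row !mulmxBl -!mulmxA.
  rewrite (EE0 k j)//; try lia.
  rewrite (EE0 k.-1 j); try lia.
  rewrite mulmx0 subr0 sub0r; case: eqVneq => [->|jN'].
    by rewrite EE// eqxx mulmx1.
  by rewrite EE0// ?mulmx0 ?oppr0//; lia.
move=> k j kN jN jk jk1 jk2; rewrite -bE// /b; case: eqVneq => [kN1|kN1].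
  rewrite /r -mulmxA LEj// ifF ?mulmx0//; lia.
rewrite mulmxBl /r -!mulmxA LEj// LEj; try lia.
case: eqVneq => _; last by rewrite !mulmx0 subrr.
by rewrite !mulmxN mulmxA -GNs ?subrr//; lia.
Qed.

(** Block elimination gives positive definite pivots S_k, which serve as M_k^-1. The parameter
    identities then express the normalized residuals through the rows of the precision matrix, and
    orthogonality follows from the last index downward. *)
Lemma model_of_tridiagonal : (0 < N)%N -> cyclic_tridiagonal ->
  exists Mt M : nat -> 'M[R]_d,
    (forall k, (1 <= k <= N)%N -> posdefmx (M k)) /\
    forall Gp GN G : nat -> 'M[R]_d,
      (forall k, (1 <= k < N)%N -> Gp k = Mt k - GN k *m MNcond N Mt k.-1) ->
      (forall k, (1 <= k < N)%N ->
        GN k = G k *m (MNcond N Mt k)^T *m invmx (CNcond N Mt M k)) ->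
      (forall k, (1 <= k < N)%N -> G k = invmx (Ginv N Mt M k)) ->
      forall k, (0 < k < N)%N ->
        [/\ forall j, (j < k)%N -> model_row Gp GN k *m K *m (E j)^T = 0,
            model_row Gp GN k *m K *m (E N)^T = 0
          & model_row Gp GN k *m K *m (E k)^T = G k].
Proof.
move=> N0 tri.
have uK := posdefmx_unit pK; have pA : posdefmx A := posdefmx_inv pK.
have [As _] := pA.
pose B k j := E k *m A *m (E j)^T.
have BT k j : (B k j)^T = B j k by rewrite /B !trmx_mul trmxK As mulmxA.
(* S k is the k-th diagonal block left by eliminating the blocks N, ..., k + 1    *)
(* from invmx K; the parameters are M_k = S_k^-1 and M_{k,k-1} = - S_k^-1 B_{k,k-1}. *)
pose Srev := fix Srev i := if i is i'.+1 then
    B (N - i'.+1)%N (N - i'.+1)%N -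
      B (N - i'.+1)%N (N - i')%N *m invmx (Srev i') *m B (N - i')%N (N - i'.+1)%N
  else B N N.
pose S k := Srev (N - k)%N.
have SN : S N = B N N by rewrite /S subnn.
have Sstep k : (k < N)%N -> S k = B k k - B k k.+1 *m invmx (S k.+1) *m B k.+1 k.
  by move=> kN; rewrite /S -{1}(subnSK kN) /= (subnSK kN) !subKn//; lia.
have tri0 k j : (0 < k < N)%N -> (j <= N)%N -> j != k -> j.+1 != k -> j != k.+1 ->
    B k j = 0 /\ B j k = 0.
  by move=> *; have h : B k j = 0 by [exact: tri]; rewrite -(BT k j) h trmx0.
(* Expanding c into blocks gives S_k = c A c', and the identity block of c at k excludes a left
   kernel. *)
have pd_of k (c : 'M[R]_(d, n)) : (k <= N)%N ->
    (forall j, (k < j <= N)%N -> c *m A *m (E j)^T = 0) ->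
    c *m A *m (E k)^T = S k -> c *m (E k)^T = 1%:M ->
    (forall j, (j < k)%N -> c *m (E j)^T = 0) -> posdefmx (S k).
  move=> kN cj ck ck1 cj0.
  have -> : S k = c *m A *m c^T.
    rewrite {2}(block_sum c) linear_sum /= mulmx_sumr.
    have kN' : (k < N.+1)%N by rewrite ltnS.
    rewrite (bigD1 (Ordinal kN'))//= trmx_mul mulmxA ck ck1 trmx1 mulmx1.
    rewrite big1 ?addr0// => j jk; rewrite trmx_mul mulmxA.
    have [jk'|jk'] := ltnP j k; first by rewrite cj0// trmx0 mulmx0.
    have jk2 : (j : nat) != k by apply: contra jk => /eqP h; apply/eqP/val_inj.
    have jN := ltn_ord j.
    by rewrite cj ?mul0mx//; lia.
  apply: posdefmx_congr => // v vc.
  by rewrite -[v]mulmx1 -ck1 mulmxA vc mul0mx.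
(* Here c is E_k corrected by later blocks so that c A has no block beyond k. Column 0 is excluded
   from the third clause because the corner (0, N) may fill it during elimination. *)
have Sspec k : (1 <= k <= N)%N -> exists c : 'M[R]_(d, n),
    [/\ forall j, (k < j <= N)%N -> c *m A *m (E j)^T = 0,
        c *m A *m (E k)^T = S k,
        forall j, (1 <= j < k)%N -> c *m A *m (E j)^T = B k j,
        c *m (E k)^T = 1%:M & forall j, (j < k)%N -> c *m (E j)^T = 0].
  move=> kN; have [i iE] : exists i, (k + i)%N = N by exists (N - k)%N; lia.
  elim: i k kN iE => [|i IH] k kN iE.
    have -> : k = N by lia.
    exists (E N); split=> //; first by move=> j; lia.
    - by rewrite EE// eqxx.
    - move=> j jN; rewrite EE//; last lia.
      by rewrite gtn_eqF// -scalemx1 scale0r.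
  have [||c [cj ck cjk ck1 cj0]] := IH k.+1; [lia|lia|].
  have pS : posdefmx (S k.+1) by apply: (pd_of k.+1 c) => //; lia.
  have uS := posdefmx_unit pS.
  exists (E k - B k k.+1 *m invmx (S k.+1) *m c); split.
  - move=> j kj; rewrite !mulmxBl -!(mulmxA _ c) -(mulmxA _ (c *m A)).
    have [->|jk] := eqVneq j k.+1; first by rewrite ck mulmxKV// subrr.
    rewrite cj ?mulmx0 ?subr0; last lia.
    by have [|||||h _] := tri0 k j; [lia..|exact: h].
  - rewrite !mulmxBl -!(mulmxA _ c) -(mulmxA _ (c *m A)) cjk; last lia.
    by rewrite (@Sstep k)//; lia.
  - move=> j jk; rewrite !mulmxBl -!(mulmxA _ c) -(mulmxA _ (c *m A)) cjk; last lia.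
    have [_ ->] : B j k.+1 = 0 /\ B k.+1 j = 0 by apply: tri0; lia.
    by rewrite mulmx0 subr0.
  - rewrite mulmxBl -(mulmxA _ c) cj0 ?mulmx0 ?subr0; last lia.
    by rewrite EE ?eqxx//; lia.
  - move=> j jk; rewrite mulmxBl -(mulmxA _ c) cj0 ?mulmx0 ?subr0; last lia.
    by rewrite EE ?gtn_eqF//; [rewrite -scalemx1 scale0r|lia|lia].
have Spd k : (1 <= k <= N)%N -> posdefmx (S k).
  move=> kN; have [c [cj ck _ ck1 cj0]] := Sspec k kN.
  by apply: (pd_of k c) => //; lia.
exists (fun k => - invmx (S k) *m B k k.-1), (fun k => invmx (S k)).
set Mt := fun k => _; set M := fun k => _.
have pM k : (1 <= k <= N)%N -> posdefmx (M k) by move=> kN; exact/posdefmx_inv/Spd.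
split=> // Gp GN G GpE GNE GE.
have SM k : invmx (M k) = S k by rewrite /M invmxK.
have SMt k : (1 <= k <= N)%N -> S k *m Mt k = - B k k.-1.
  move=> kN; have uS := posdefmx_unit (Spd k kN).
  by rewrite /Mt /= mulmxA mulmxN mulmxV// mulNmx mul1mx.
have MtS k : (1 <= k <= N)%N -> (Mt k)^T *m S k = - B k.-1 k.
  move=> kN; have [Ss _] := Spd k kN.
  by rewrite -{1}Ss -trmx_mul SMt// linearN /= BT.
have Bkk k : (1 <= k < N)%N -> S k + (Mt k.+1)^T *m S k.+1 *m Mt k.+1 = B k k.
  move=> kN; rewrite MtS; last lia.
  rewrite /= (@Sstep k); last lia.
  rewrite /Mt /=; set Y := invmx (S k.+1).
  by rewrite !mulNmx mulmxN opprK mulmxA subrK.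
pose L := model_row Gp GN.
pose r k := Ginv N Mt M k *m L k.
have rE k : r k = Ginv N Mt M k *m E k - Ginv N Mt M k *m Gp k *m E k.-1
    - Ginv N Mt M k *m GN k *m E N.
  by rewrite /r /L /model_row !mulmxBr !mulmxA.
have EA k : (0 < k < N)%N ->
    E k *m A = B k k *m E k + B k k.-1 *m E k.-1 + B k k.+1 *m E k.+1.
  move=> kN; apply: block_ext => j jN; rewrite !mulmxDl -!(mulmxA (B _ _)).
  have EEif i : (i <= N)%N -> E i *m (E j)^T = if i == j then 1%:M else 0.
    by move=> iN; rewrite EE//; case: eqVneq => // _; rewrite -scalemx1 scale0r.
  rewrite !EEif; try lia.
  have [<-|jk] := eqVneq k j.
    by rewrite !ifF ?mulmx0 ?addr0 ?mulmx1//; lia.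
  have [<-|jk1] := eqVneq k.-1 j.
    by rewrite !ifF ?mulmx0 ?addr0 ?add0r ?mulmx1//; lia.
  have [<-|jk2] := eqVneq k.+1 j; first by rewrite !mulmx0 !add0r mulmx1.
  by rewrite !mulmx0 !addr0; apply: tri => //; lia.
have rlast k : (0 < k)%N -> k.+1 = N -> r k = E k *m A.
  move=> k0 kN; rewrite rE (Ginv_Gp pM GpE GNE GE); last lia.
  rewrite (GN_pred_last pM GNE GE)// (Ginv_pred_last Mt M)// !SM.
  rewrite EA; last lia.
  rewrite -Bkk; last lia.
  rewrite SMt; last lia.
  rewrite -kN MtS; last lia.
  by rewrite /= !mulNmx !opprK.
(* Columns are compared: k by [Gp_step], N by [GN_step], k - 1 by [Ginv_Gp], while the column k + 1
   cancels by [tr_Gp_Ginv]. *)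
have rstep k : (0 < k)%N -> (k.+1 < N)%N ->
    r k = E k *m A + (Gp k.+1)^T *m r k.+1.
  move=> k0 kN; rewrite (rE k.+1) !mulmxBr !mulmxA -(GN_step pM GpE GNE GE)//.
  rewrite rE (Ginv_Gp pM GpE GNE GE); last lia.
  rewrite EA; last lia.
  have := Gp_step pM GpE GNE GE k0 kN; rewrite !SM Bkk; last lia.
  rewrite (tr_Gp_Ginv pM GpE GNE GE); last lia.
  rewrite !SM (MtS k.+1); last lia.
  move=> <-; rewrite (SMt k); last lia.
  have z (a b c x y : 'M[R]_(d, n)) : a - - b - y = a - x + b + c + (- c - - x - y).
    by apply/matrixP => i j; rewrite !mxE; ring.
  by rewrite [X in _ = X + _ + _ + _]mulmxDl !mulNmx; exact: z.
(* Multiplied by K, [rstep] reads r_k K = E_k + G_{k+1,k}' r_{k+1} K, which drives a downward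
   induction. *)
have rK k : (0 < k < N)%N -> [/\ forall j, (j < k)%N -> r k *m K *m (E j)^T = 0,
    r k *m K *m (E N)^T = 0 & r k *m K *m (E k)^T = 1%:M].
  move=> kN; have [i iE] : exists i, (k + i).+1 = N by exists (N - k.+1)%N; lia.
  elim: i k kN iE => [|i IH] k kN iE.
    rewrite rlast; [|lia|lia].
    rewrite mulmxKV//; split.
    - by move=> j jk; rewrite EE ?gtn_eqF//; [rewrite -scalemx1 scale0r|lia|lia].
    - by rewrite EE ?ltn_eqF//; [rewrite -scalemx1 scale0r|lia|lia].
    - by rewrite EE ?eqxx//; lia.
  rewrite rstep; [|lia|lia].
  have [||h1 h2 h3] := IH k.+1; [lia|lia|].
  rewrite mulmxDl mulmxKV//; split.
  - move=> j jk; rewrite mulmxDl -!(mulmxA (Gp k.+1)^T) h1 ?mulmx0 ?addr0; last lia.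
    by rewrite EE ?gtn_eqF//; [rewrite -scalemx1 scale0r|lia|lia].
  - rewrite mulmxDl -!(mulmxA (Gp k.+1)^T) h2 ?mulmx0 ?addr0.
    by rewrite EE ?ltn_eqF//; [rewrite -scalemx1 scale0r|lia|lia].
  - rewrite mulmxDl -!(mulmxA (Gp k.+1)^T) h1 ?mulmx0 ?addr0//.
    by rewrite EE ?eqxx//; lia.
move=> k kN; have LE : L k = G k *m r k.
  by rewrite /r mulmxA (G_Ginv pM GE)// mul1mx.
have [h1 h2 h3] := rK k kN; rewrite -/(L k) LE.
split.
- by move=> j jk; rewrite -!(mulmxA (G k)) h1// mulmx0.
- by rewrite -!(mulmxA (G k)) h2 mulmx0.
- by rewrite -!(mulmxA (G k)) h3 mulmx1.
Qed.

End CyclicTridiagonal.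
Arguments model_row {R} N {d n} E Gp GN k.
Arguments cyclic_tridiagonal {R} N {d n} E K.

(** * Block selectors of the stacked vector *)

Section Blocks.
Context {R : realType} {d N : nat}.
Local Notation n := (\sum_(k < N.+1) d)%N.

Definition pos (k : nat) (i : 'I_d) : 'I_n :=
  @tagnat.Rank N.+1 (fun=> d) (inord k) i.

(** A natural index keeps arithmetic on k free of ordinals; [inord] sends k > N to block 0, whence
    the bounds in the lemmas on blocks. *)
Definition sel (k : nat) : 'M[R]_(d, n) :=
  @submxcol R N.+1 (fun=> d) n 1%:M (inord k).

Lemma sel_mul (k p : nat) (a : 'M[R]_(n, p)) i j : (sel k *m a) i j = a (pos k i) j.
Proof. by rewrite /sel submxcol_mul mul1mx mxE. Qed.

Lemma mul_tr_sel (k p : nat) (a : 'M[R]_(p, n)) i j :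
  (a *m (sel k)^T) i j = a i (pos k j).
Proof. by rewrite -{1}[a]trmxK -trmx_mul [LHS]mxE sel_mul [LHS]mxE. Qed.

Lemma sel_tr_sel j k : (j <= N)%N -> (k <= N)%N ->
  sel j *m (sel k)^T = (j == k)%:R%:M.
Proof.
move=> jN kN; apply/matrixP => i i0; rewrite mul_tr_sel. rewrite -[sel j]mulmx1 sel_mul !mxE.
rewrite -val_eqE /= tagnat.eq_Rank -val_eqE /= !inordK// val_eqE.
by case: (j == k) => //=; rewrite mul0rn.
Qed.

Lemma sum_tr_sel_sel : \sum_(k < N.+1) (sel k)^T *m sel k = 1%:M.
Proof.
pose rs (k : 'I_N.+1) : 'M[R]_(n, d) := @submxrow R N.+1 (fun=> d) n 1%:M k.
pose cs (k : 'I_N.+1) : 'M[R]_(d, n) := @submxcol R N.+1 (fun=> d) n 1%:M k.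
have := mul_mxrow_mxcol rs cs.
rewrite /rs /cs submxrowK submxcolK mulmx1 => ->.
by apply: eq_bigr => k _; rewrite /sel inord_val tr_submxcol trmx1.
Qed.

Lemma pos_sig (s : 'I_n) : pos (tagnat.sig1 s) (tagnat.sig2 s) = s.
Proof. by rewrite /pos inord_val tagnat.sig2K. Qed.

Lemma sig_pos k i : (k <= N)%N -> tagnat.sig1 (pos k i) = k :> nat.
Proof. by move=> kN; rewrite /pos tagnat.Rank1K inordK. Qed.

End Blocks.
Arguments sel {R d N}.

(** * Reciprocity as a zero pattern of the precision matrix *)

Section SequenceBlocks.
Context {disp : measure_display} {T : measurableType disp} {R : realType}.
Variable P : probability T R.
Context {d N : nat}.
Implicit Type x : nat -> T -> 'cV[R]_d.

Lemma sel_stack x k w : (k <= N)%N -> sel k *m stack N x w = x k w.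
Proof.
move=> kN; rewrite /sel submxcol_mul mul1mx /stack.
by rewrite (@mxcolK _ N.+1 (fun=> d)) inordK.
Qed.

Lemma stack_pos x k w i : (k <= N)%N -> stack N x w (pos k i) ord0 = x k w i ord0.
Proof. by move=> kN; rewrite -(sel_stack x w kN) sel_mul. Qed.

Lemma sigma_of_stack x (S : set nat) (p : pred nat) :
  (forall k, S k <-> p k) -> (forall k, p k -> (k <= N)%N) ->
  sigma_of x S = sigma_coords (stack N x) (fun s => p (tagnat.sig1 s)).
Proof.
move=> Sp pN; rewrite /sigma_of /sigma_coords; congr <<s _ >>.
apply/seteqP; split => [B [k /Sp pk [i _ Bi]]|B [s /= ps Bs]].
  exists (pos k i); first by rewrite /= sig_pos//; exact: pN.
  by under [fun w => _]eq_fun do rewrite stack_pos ?pN//.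
exists (tagnat.sig1 s : nat); first exact/Sp.
exists (tagnat.sig2 s) => //; move: Bs; rewrite -{1}[s]pos_sig.
by under [fun w => _]eq_fun do rewrite stack_pos ?pN//.
Qed.

(** One direction uses only the intervals [k-1, k+1], whose interior is k alone. Conversely, an
    index strictly inside an interval is neither equal nor adjacent to one outside it, and differs
    from 0 and N. *)
Lemma reciprocal_tridiagonal x : ZMNG P N x ->
  let K := covmx P (stack N x) (stack N x) in
  posdefmx K /\ (reciprocal P N x <-> cyclic_tridiagonal N sel K).
Proof.
move=> [gX X0 uK] K.
have pK : posdefmx K.
  apply: posdefmx_of_unit => //; first exact: covmx_sym.
  by move=> v; exact: covmx_ge0.
split => //.
pose b (s : 'I_(\sum_(k < N.+1) d)) : nat := tagnat.sig1 s.
have bN s : (b s <= N)%N by rewrite -ltnS; exact: ltn_ord.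
pose fp k1 k2 (k : nat) := (k == k1) || (k == k2).
pose ip k1 k2 (k : nat) := (k1 < k < k2)%N.
pose op k1 k2 (k : nat) := (k < k1)%N || (k2 < k <= N)%N.
have recE : reciprocal P N x <-> forall k1 k2, (k1 < k2)%N -> (k2 <= N)%N ->
    cond_independent P (sigma_coords (stack N x) (fun s => fp k1 k2 (b s)))
      (sigma_coords (stack N x) (fun s => ip k1 k2 (b s)))
      (sigma_coords (stack N x) (fun s => op k1 k2 (b s))).
  have E k1 k2 : (k1 < k2)%N -> (k2 <= N)%N ->
    [/\ sigma_of x [set k1; k2] =
         sigma_coords (stack N x) (fun s => fp k1 k2 (b s)),
       sigma_of x [set k | (k1 < k < k2)%N] =
         sigma_coords (stack N x) (fun s => ip k1 k2 (b s))
     & sigma_of x [set k | (k < k1)%N \/ (k2 < k <= N)%N] =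
         sigma_coords (stack N x) (fun s => op k1 k2 (b s))].
    move=> k12 k2N; split.
    - refine (@sigma_of_stack x _ (fp k1 k2) _ _) => k; last by move=> /orP[] /eqP ->; lia.
      split=> [[->|->]|/orP[] /eqP ->]; rewrite /fp ?eqxx ?orbT//; first by left.
      by right.
    - refine (@sigma_of_stack x _ (ip k1 k2) _ _) => k /=; rewrite /ip; lia.
    - refine (@sigma_of_stack x _ (op k1 k2) _ _) => k /=; rewrite /op; last lia.
      by split => /orP.
  split=> h k1 k2 k12 k2N; have [e1 e2 e3] := E k1 k2 k12 k2N.
    by rewrite -e1 -e2 -e3; exact: h.
  by rewrite e1 e2 e3; exact: h.
rewrite recE; split.
- move=> rec k j kN jN jk jk1 jk2; apply/matrixP => i i'.
  rewrite mul_tr_sel sel_mul [RHS]mxE.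
  have k12 : (k.-1 < k.+1)%N by lia.
  have k2N : (k.+1 <= N)%N by lia.
  apply: (@precision_zero_of_residual _ _ _ pK (fun s => ip k.-1 k.+1 (b s))
    (fun s => fp k.-1 k.+1 (b s)) (fun s => op k.-1 k.+1 (b s))) ; rewrite /ip /fp /op.
  + by move=> s; have := bN s; lia.
  + by move=> s; have := bN s; lia.
  + by move=> s; have := bN s; lia.
  + move=> s t f si to.
    exact: (residual_of_cond_independent gX X0 si to (rec _ _ k12 k2N)).
  + by rewrite /b sig_pos; lia.
  + by rewrite /b sig_pos//; lia.
- move=> tri k1 k2 k12 k2N.
  have z s t : ip k1 k2 (b s) -> op k1 k2 (b t) -> invmx K s t = 0.
    rewrite /ip /op => si to; rewrite -(pos_sig s) -(pos_sig t).
    have := bN s; have := bN t => tN sN.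
    have := tri (b s) (b t) ltac:(lia) tN ltac:(lia) ltac:(lia) ltac:(lia).
    move=> /matrixP /(_ (tagnat.sig2 s) (tagnat.sig2 t)).
    by rewrite mul_tr_sel sel_mul mxE.
  have [|||V [B [h1 h2 h3]]] := @residual_of_precision_zero _ _ _ pK
    (fun s => ip k1 k2 (b s)) (fun s => fp k1 k2 (b s)) (fun s => op k1 k2 (b s)) _ _ _ z.
  + by move=> s; have := bN s; rewrite /ip /fp /op; lia.
  + by move=> s; have := bN s; rewrite /ip /fp /op; lia.
  + by move=> s; have := bN s; rewrite /ip /fp /op; lia.
  + exact: (cond_independent_of_residual gX X0 h1 h2 h3).
Qed.

End SequenceBlocks.

(** * Completion of the interior residuals to a white sequence *)

Section WhiteRows.
Context {R : realType} {N d n : nat}.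
Variables (E : nat -> 'M[R]_(d, n)) (K : 'M[R]_n).
Hypothesis EE : forall j k, (j <= N)%N -> (k <= N)%N ->
  E j *m (E k)^T = (j == k)%:R%:M.
Hypothesis pK : posdefmx K.

(** Interior residuals are orthogonal to all earlier blocks and to block N, hence to one another and
    to both ends; only E_N must be made orthogonal to E_0. Each covariance is nonsingular because
    L_k has an identity block at k. *)
Lemma white_rows_of_model (Gp GN G : nat -> 'M[R]_d) :
  (forall k, (0 < k < N)%N ->
    [/\ forall j, (j < k)%N -> model_row N E Gp GN k *m K *m (E j)^T = 0,
        model_row N E Gp GN k *m K *m (E N)^T = 0
      & model_row N E Gp GN k *m K *m (E k)^T = G k]) ->
  exists (L : nat -> 'M[R]_(d, n)) (GN0 : 'M[R]_d),
    [/\ L 0 = E 0, L N = E N - GN0 *m E 0,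
        forall k, (0 < k < N)%N ->
          L k = model_row N E Gp GN k /\ L k *m K *m (L k)^T = G k,
        forall j k, (j <= N)%N -> (k <= N)%N -> j != k -> L j *m K *m (L k)^T = 0
      & forall k, (k <= N)%N -> L k *m K *m (L k)^T \in unitmx].
Proof.
move=> H; have [Ks _] := pK.
have D (a b : 'M[R]_(d, n)) : (a - b)^T = a^T - b^T by exact: linearB.
have EE0 j k : (j <= N)%N -> (k <= N)%N -> j != k -> E j *m (E k)^T = 0.
  by move=> jN kN jk; rewrite EE// (negbTE jk) -scalemx1 scale0r.
have unitL (l : 'M[R]_(d, n)) k : l *m (E k)^T = 1%:M -> l *m K *m l^T \in unitmx.
  move=> lE; apply/posdefmx_unit/posdefmx_congr => // v vl.
  by rewrite -[v]mulmx1 -lE mulmxA vl mul0mx.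
have EE1 k : (k <= N)%N -> E k *m (E k)^T = 1%:M by move=> kN; rewrite EE// eqxx.
(* The regression coefficient of x_N on x_0; for N = 0 it must be 0, since L_0 and L_N are then the
   same row. *)
pose GN0 := if N == 0 then 0 else E N *m K *m (E 0)^T *m invmx (E 0 *m K *m (E 0)^T).
pose L k := if k == 0 then E 0 else if k == N then E N - GN0 *m E 0
  else model_row N E Gp GN k.
have LN : L N = E N - GN0 *m E 0.
  rewrite /L; case: ifP => [/eqP N0|]; last by rewrite eqxx.
  by rewrite /GN0 N0 eqxx mul0mx subr0.
have Lk k : (0 < k < N)%N -> L k = model_row N E Gp GN k.
  by move=> kN; rewrite /L !ifF//; lia.
have LKL k : (0 < k < N)%N -> L k *m K *m (L k)^T = G k.
  move=> kN; rewrite Lk//; have [h1 h2 h3] := H k kN.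
  rewrite {2}/model_row !D !trmx_mul !mulmxBr !mulmxA (h1 k.-1) ?h2 ?h3; last lia.
  by rewrite !mul0mx !subr0.
have Llt j k : (j < k)%N -> (k <= N)%N -> L k *m K *m (L j)^T = 0.
  move=> jk kN; have [kN'|kN'] := eqVneq k N.
    have N0 : N != 0 by lia.
    have [->|j0] := eqVneq j 0.
      rewrite kN' LN /L eqxx /GN0 (negbTE N0) !mulmxBl.
      set c := E N *m K *m _; set a := E 0 *m K *m _.
      rewrite -(mulmxA _ (E 0)) -(mulmxA _ (E 0 *m K)) -/a mulmxKV ?subrr//.
      by apply: (unitL _ 0); rewrite EE1.
    have [h1 h2 _] := H j ltac:(lia).
    apply: trmx_inj; rewrite !trmx_mul trmxK Ks trmx0 mulmxA Lk; last lia.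
    rewrite kN' LN D trmx_mul mulmxBr h2 mulmxA h1; last lia.
    by rewrite mul0mx subrr.
  have [h1 h2 _] := H k ltac:(lia).
  rewrite (Lk k); last lia.
  have [->|j0] := eqVneq j 0; first by rewrite /L eqxx h1//; lia.
  rewrite Lk; last lia.
  rewrite {2}/model_row !D !trmx_mul !mulmxBr !mulmxA h2 !h1; try lia.
  by rewrite !mul0mx !subrr.
exists L, GN0; split => //.
- by move=> k kN; split; [exact: Lk|exact: LKL].
- move=> j k jN kN jk; have [lt|ge] := ltnP j k; last by apply: Llt => //; lia.
  by apply: trmx_inj; rewrite !trmx_mul trmxK Ks trmx0 mulmxA Llt.
- move=> k kN; have [->|k0] := eqVneq k 0.
    by apply: (unitL _ 0); rewrite /L eqxx EE1.
  apply: (unitL _ k); have [kN'|kN'] := eqVneq k N.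
    by rewrite kN' LN mulmxBl -mulmxA (EE0 0) ?mulmx0 ?subr0 ?EE1//; lia.
  rewrite Lk; last lia.
  rewrite /model_row !mulmxBl -!mulmxA EE1// !EE0; try lia.
  by rewrite !mulmx0 !subr0.
Qed.

End WhiteRows.

(** * Models driven by white noise *)

Section Model.
Context {disp : measure_display} {T : measurableType disp} {R : realType}.
Variable P : probability T R.
Context {d N : nat}.
Variable x : nat -> T -> 'cV[R]_d.
Hypothesis hx : ZMNG P N x.
Local Notation n := (\sum_(k < N.+1) d)%N.
Local Notation X := (stack N x).
Local Notation K := (covmx P X X).

Lemma sel_model_row (Gp GN : nat -> 'M[R]_d) k w : (k <= N)%N ->
  model_row N sel Gp GN k *m X w = x k w - Gp k *m x k.-1 w - GN k *m x N w.
Proof.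
move=> kN; rewrite /model_row !mulmxBl -!mulmxA !sel_stack//.
exact: leq_trans (leq_pred _) kN.
Qed.

Lemma governed_of_white_rows (Gp GN G : nat -> 'M[R]_d) (L : nat -> 'M[R]_(d, n))
    (GN0 : 'M[R]_d) :
  L 0 = sel 0 -> L N = sel N - GN0 *m sel 0 ->
  (forall k, (0 < k < N)%N -> L k = model_row N sel Gp GN k) ->
  (forall j k, (j <= N)%N -> (k <= N)%N -> j != k -> L j *m K *m (L k)^T = 0) ->
  (forall k, (k <= N)%N -> L k *m K *m (L k)^T = G k /\ G k \in unitmx) ->
  governed_by P N x Gp GN G.
Proof.
have [gX X0 _] := hx.
move=> L0 LN Lk white LG; exists (fun k w => L k *m X w); split.
- rewrite /white_gaussian; have -> : stack N (fun k w => L k *m X w) =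
      fun w => \mxcol_(k < N.+1) L k *m X w.
    by apply/funext => w; rewrite mxcol_mul.
  split; [exact: gaussian_vector_lin|exact: zero_mean_lin|].
  by move=> j k jN kN jk; rewrite covmx_lin// white.
- by move=> k kN; rewrite covmx_lin//; exact: LG.
- move=> k kN; apply: aeW => w; rewrite Lk// sel_model_row; last lia.
  by rewrite -[x k w - _ - _]addrA -opprD [RHS]addrC subrK.
- left; exists GN0; split; apply: aeW => w; first by rewrite L0 sel_stack.
  by rewrite LN mulmxBl -mulmxA !sel_stack// addrC subrK.
Qed.

(** The noise of a model is a linear image of the stacked vector only almost surely. *)
Lemma covmx_ae_lin (e f : T -> 'cV[R]_d) (a b : 'M[R]_(d, n)) :
  (forall i, measurable_fun [set: T] (fun w => e w i ord0)) ->
  (forall i, measurable_fun [set: T] (fun w => f w i ord0)) ->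
  zero_mean P e -> zero_mean P f ->
  {ae P, forall w, e w = a *m X w} -> {ae P, forall w, f w = b *m X w} ->
  covmx P e f = a *m K *m b^T.
Proof.
have [gX X0 _] := hx.
move=> me mf e0 f0 ea fb; rewrite -(covmx_lin gX X0); apply/matrixP => i j.
rewrite !covmx_Rintegral//; try exact: zero_mean_lin.
rewrite /Rintegral; congr fine; apply: integral_ae_eqr => //.
- exact: measurable_funM.
- by apply: measurable_funM; exact: (measurable_gaussian_lin gX).
- by apply: filterS2 ea fb => w -> ->.
Qed.

Lemma tridiagonal_of_governed (Mt M Gp GN G : nat -> 'M[R]_d) :
  (forall k, (1 <= k <= N)%N -> posdefmx (M k)) ->
  governed_by P N x Gp GN G ->
  (forall k, (1 <= k < N)%N ->
    [/\ Gp k = Mt k - GN k *m MNcond N Mt k.-1,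
        GN k = G k *m (MNcond N Mt k)^T *m invmx (CNcond N Mt M k)
      & G k = invmx (Ginv N Mt M k)]) ->
  cyclic_tridiagonal N sel K.
Proof.
move=> pM [e [[[me _] e0 white] eG ek bd]] fm.
have GpE k : (1 <= k < N)%N -> Gp k = Mt k - GN k *m MNcond N Mt k.-1 by case/fm.
have GNE k : (1 <= k < N)%N ->
  GN k = G k *m (MNcond N Mt k)^T *m invmx (CNcond N Mt M k) by case/fm.
have GE k : (1 <= k < N)%N -> G k = invmx (Ginv N Mt M k) by case/fm.
have mek k i : (k <= N)%N -> measurable_fun [set: T] (fun w => e k w i ord0).
  by move=> kN; have := me (pos k i); under eq_fun do rewrite stack_pos//.
have e0k k : (k <= N)%N -> zero_mean P (e k).
  by move=> kN i; have := e0 (pos k i); under [X in expectation _ X]eq_fun do rewrite stack_pos//.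
pose L : nat -> 'M[R]_(d, n) := model_row N sel Gp GN.
have eL k : (0 < k < N)%N -> {ae P, forall w, e k w = L k *m X w}.
  move=> kN; apply: filterS (ek k kN) => w xk; rewrite sel_model_row; last lia.
  by rewrite xk -[X in _ = X]addrA -opprD addrAC subrr add0r.
have cov (j k : nat) (a b : 'M[R]_(d, n)) : (j <= N)%N -> (k <= N)%N ->
    {ae P, forall w, e j w = a *m X w} -> {ae P, forall w, e k w = b *m X w} ->
    covmx P (e j) (e k) = a *m K *m b^T.
  by move=> jN kN ea eb; apply: covmx_ae_lin => //; try exact: e0k; move=> i; exact: mek.
have cov0 (j k : nat) (a b : 'M[R]_(d, n)) : (j <= N)%N -> (k <= N)%N -> j != k ->
    {ae P, forall w, e j w = a *m X w} -> {ae P, forall w, e k w = b *m X w} ->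
    a *m K *m b^T = 0.
  by move=> jN kN jk ea eb; rewrite -(cov j k)// white.
(* Under either boundary condition x_0 and x_N are linear combinations of e_0 and e_N, so whiteness
   makes e_k uncorrelated with both. *)
have LB k : (0 < k < N)%N ->
    L k *m K *m (sel 0)^T = 0 /\ L k *m K *m (sel N)^T = 0.
  move=> kN; have D (a b : 'M[R]_(d, n)) : (a + b)^T = a^T + b^T by exact: linearD.
  case: bd => [[B [x0 xN]]|[B [xN x0]]].
  - have e0L : {ae P, forall w, e 0%N w = sel 0 *m X w}.
      by apply: filterS x0 => w <-; rewrite sel_stack.
    have eNL : {ae P, forall w, e N w = (sel N - B *m sel 0) *m X w}.
      apply: filterS xN => w xw; rewrite mulmxBl -mulmxA !sel_stack// xw.
      by rewrite addrC addKr.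
    have h0 : L k *m K *m (sel 0)^T = 0.
      by apply: (cov0 k 0) => //; [lia|lia|exact: eL].
    split=> //; have -> : @sel R d N N = (sel N - B *m sel 0) + B *m sel 0 by rewrite subrK.
    rewrite D mulmxDr trmx_mul mulmxA h0 mul0mx addr0.
    by apply: (cov0 k N) => //; [lia|lia|exact: eL].
  - have eNL : {ae P, forall w, e N w = sel N *m X w}.
      by apply: filterS xN => w <-; rewrite sel_stack.
    have e0L : {ae P, forall w, e 0%N w = (sel 0 - B *m sel N) *m X w}.
      apply: filterS x0 => w xw; rewrite mulmxBl -mulmxA !sel_stack// xw.
      by rewrite addrC addKr.
    have hN : L k *m K *m (sel N)^T = 0.
      by apply: (cov0 k N) => //; [lia|lia|exact: eL].
    split=> //; have -> : @sel R d N 0 = (sel 0 - B *m sel N) + B *m sel N by rewrite subrK.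
    rewrite D mulmxDr trmx_mul mulmxA hN mul0mx addr0.
    by apply: (cov0 k 0) => //; [lia|lia|exact: eL].
have [pK _] := reciprocal_tridiagonal hx.
apply: (tridiagonal_of_model sel_tr_sel sum_tr_sel_sel pK (Gp := Gp) (GN := GN) (G := G)).
- move=> k kN; have [h0 hN] := LB k kN; have [eGk uG] := eG k ltac:(lia).
  split=> //; rewrite -eGk; symmetry; apply: cov; try lia; exact: eL.
- by move=> j k j0 jk; apply: (cov0 k j); try lia; apply: eL; lia.
- by move=> j k j0 jk; apply: (cov0 j k); try lia; apply: eL; lia.
- move=> k k0 kN; rewrite !(invG GE); try lia.
  exact: (GN_step pM GpE GNE GE).
Qed.

End Model.

Theorem theorem3p1 (disp : measure_display) (T : measurableType disp)
    (R : realType) (P : probability T R) (d N : nat)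
    (x : nat -> T -> 'cV[R]_d) (hx : ZMNG P N x) :
  reciprocal P N x <->
  exists Mt M : nat -> 'M[R]_d,
    (forall k : nat, (1 <= k <= N)%N -> posdefmx (M k)) /\
    exists Gp GN G : nat -> 'M[R]_d,
      governed_by P N x Gp GN G /\
      forall k : nat, (1 <= k < N)%N ->
        [/\ Gp k = Mt k - GN k *m MNcond N Mt k.-1,
            GN k = G k *m (MNcond N Mt k)^T *m invmx (CNcond N Mt M k)
          & G k = invmx (invmx (M k) +
                    (MNcond N Mt k)^T *m invmx (CNcond N Mt M k)
                      *m MNcond N Mt k)].
Proof.
have [pK ->] := reciprocal_tridiagonal hx; split; last first.
  move=> [Mt [M [pM [Gp [GN [G [gov fm]]]]]]].
  exact: (tridiagonal_of_governed hx pM gov fm).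
move=> tri.
have [Mt [M [pM H]]] : exists Mt M : nat -> 'M[R]_d,
    (forall k, (1 <= k <= N)%N -> posdefmx (M k)) /\
    forall Gp GN G : nat -> 'M[R]_d,
      (forall k, (1 <= k < N)%N -> Gp k = Mt k - GN k *m MNcond N Mt k.-1) ->
      (forall k, (1 <= k < N)%N ->
        GN k = G k *m (MNcond N Mt k)^T *m invmx (CNcond N Mt M k)) ->
      (forall k, (1 <= k < N)%N -> G k = invmx (Ginv N Mt M k)) ->
      forall k, (0 < k < N)%N ->
        [/\ forall j, (j < k)%N ->
              model_row N sel Gp GN k *m covmx P (stack N x) (stack N x) *m (sel j)^T = 0,
            model_row N sel Gp GN k *m covmx P (stack N x) (stack N x) *m (sel N)^T = 0
          & model_row N sel Gp GN k *m covmx P (stack N x) (stack N x) *m (sel k)^T = G k].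
  (* For N = 0 all index ranges are empty and any matrices do. *)
  have [N0|N0] := posnP N.
    by exists (fun=> 0), (fun=> 0); split => [k|Gp GN G _ _ _ k]; lia.
  exact: (model_of_tridiagonal sel_tr_sel sum_tr_sel_sel pK N0 tri).
exists Mt, M; split => //.
pose G0 k := invmx (Ginv N Mt M k).
pose GN k := G0 k *m (MNcond N Mt k)^T *m invmx (CNcond N Mt M k).
pose Gp k := Mt k - GN k *m MNcond N Mt k.-1.
have {}H := H Gp GN G0 (fun _ _ => erefl) (fun _ _ => erefl) (fun _ _ => erefl).
have [L [GN0 [L0 LN Lk white uL]]] := white_rows_of_model sel_tr_sel pK H.
(* This extends the prescribed [G0] to k = 0 and k = N by the covariances of the end residuals. *)
pose G k := L k *m covmx P (stack N x) (stack N x) *m (L k)^T.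
exists Gp, GN, G; split.
  apply: (governed_of_white_rows hx L0 LN) => //.
  - by move=> k /Lk [].
  - by move=> k kN; split => //; exact: uL.
by move=> k /Lk [_ GE]; rewrite /G GE.
Qed.
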